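(* Let $\mathcal{G}=\{U_i,l_{ij},s_{ijk}\}$ be a real gerbe on a smooth manifold $X$ whose gerbe class $[\mathcal{G}]\in\check H^2(X,\underline{\mathbb{R}}^* )$ is trivial. (a) Then $\mathcal{G}$ admits a trivialization, namely a collection of real line bundles $\{l_i\}$ on $\{U_i\}$ together with isomorphisms $l_i\otimes l_j^*=l_{ij}$ on $U_i\cap U_j$. Given a second trivialization $\{l'_i\}$, all $l_i\otimes(l'_i)^*$ patch together to a global line bundle $\xi$ on $X$. (b) Given any gerbe connection $\{\nabla_{ij}\}$ on $\mathcal{G}$, there is a collection of connections $\nabla_i$ on $l_i$ such that $\nabla_i\otimes\nabla_j^*=\nabla_{ij}$ under the isomorphism $l_i\otimes l_j^*=l_{ij}$. From a second trivialization $\{l'_i\}$ with such connections $\{\nabla'_i\}$, the $\nabla_i\otimes(\nabla'_i)^*$ together form a well-defined global connection $D$ on the bundle $\xi$. (c) Suppose further that $\nabla=\{\nabla_{ij}\}$ is a flat gerbe connection with trivial holonomy, $c(\nabla)$ trivial. Then one can choose all connections $\{\nabla_i\}$ in part (b) to be flat. Given a second trivialization with flat local connections, the induced connection $D$ of part (b) is flat as well. (d) Let $h=\{h_{ij}\}$ be a gerbe metric on $\mathcal{G}$. Then there is a collection of metrics $h_i$ on $l_i$ such that $h_i/h_j=h_{ij}$ on $U_i\cap U_j$. For flat connections $\{\nabla_i\}$ as in part (c), the collection of 1-forms $\beta^0=\{\theta(\nabla_i,h_i)\}$ is an adaptation to $(\nabla,h)$. Moreover the holonomy form $B^0$ of $(\nabla,h,\beta^0)$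 is trivial (identically zero). (e) Fix a gerbe metric $h=\{h_{ij}\}$ and a collection of local metrics $\{h_i\}$ as in (d). Suppose $\nabla=\{\nabla_{ij}\}$ is a flat gerbe connection with trivial holonomy and $\beta=\{\beta_i\}$ is any adaptation to $(\nabla,h)$. If the holonomy form $B$ of $(\nabla,h,\beta)$ is trivial (identically zero), then there exist a possibly different flat gerbe connection $\nabla'=\{\nabla'_{ij}\}$ with trivial holonomy and a collection of flat local connections $\{\nabla'_i\}$ on $\{l_i\}$ subordinate to $\nabla'$ (i.e. $\nabla'_i\otimes(\nabla'_j)^*=\nabla'_{ij}$) such that $\beta_i=\theta(\nabla'_i,h_i)$ for all $i$. In other words, for a given $\beta$, the equations $\beta_i=\theta(\nabla'_i,h_i)$ admit such solutions $\nabla'_i$ if and only if $B=0$.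
   Context: A real gerbe $\mathcal{G}=\{U_i,l_{ij},s_{ijk}\}$ on $X$ consists of an open cover $\{U_i\}$ of $X$; real line bundles $l_{ij}$ on $U_i\cap U_j$ with given isomorphisms of $l_{ij}\otimes l_{ji}$ with the trivial bundle; and trivializations $s_{ijk}$ of $l_{ijk}=l_{ij}\otimes l_{jk}\otimes l_{ki}$ over $U_i\cap U_j\cap U_k$ that are co-closed ($\delta s=1$ on fourfold overlaps). After refining the cover so that each $l_{ij}$ has a trivialization $t_{ij}$ (with $t_{ji}=t_{ij}^{-1}$), write $s_{ijk}=r_{ijk}\,t_{ij}\otimes t_{jk}\otimes t_{ki}$; the cocycle $\{r_{ijk}\}$ defines the gerbe class $[\mathcal{G}]\in\check H^2(X,\underline{\mathbb{R}}^* )$, where $\underline{\mathbb{R}}^*$ is the sheaf of smooth $\mathbb{R}^*$-valued functions. In a trivialization $\{l_i\}$ of $\mathcal{G}$ the isomorphisms $l_i\otimes l_j^*=l_{ij}$ are required to be such that the canonical trivialization of $(l_i\otimes l_j^* )\otimes(l_j\otimes l_k^* )\otimes(l_k\otimes l_i^* )$ corresponds to $s_{ijk}$. A gerbe connection $\nabla=\{\nabla_{ij}\}$ consists of connections $\nabla_{ij}$ on $l_{ij}$ (compatible with $l_{ij}\otimes l_{ji}\cong$ trivial) such that $s_{ijk}$ is covariant constant for $\nabla_{ij}\otimes\nabla_{jk}\otimes\nabla_{ki}$; it is flat if all $\nabla_{ij}$ are flat. A gerbe metric $h=\{h_{ij}\}$ consists of fiber metrics $h_{ij}$ on $l_{ij}$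 (compatible with $l_{ij}\otimes l_{ji}\cong$ trivial) such that $s_{ijk}$ has norm $1$ for the induced product metric. The equation $h_i/h_j=h_{ij}$ means that $h_{ij}$ is the metric induced on $l_i\otimes l_j^*=l_{ij}$ by $h_i$ and the dual of $h_j$; $\nabla_j^*$ is the dual connection. Holonomy of a flat $\nabla$: choosing the $t_{ij}$ above to be $\nabla_{ij}$-flat, the $r_{ijk}$ are locally constant and define $c(\nabla)\in\check H^2(X,\mathbb{R}^* )$ (constant coefficients). For a connection $\nabla$ and a metric $h$ on a real line bundle, $\theta(\nabla,h)=\nabla-\nabla_h$, where $\nabla_h$ is the unique (flat) $h$-compatible connection; in a local frame $s$ with $\nabla=d+a$ it is $a-\frac12 d\ln h(s,s)$. An adaptation to $(\nabla,h)$, with $\nabla$ a flat gerbe connection, is a collection $\beta=\{\beta_i\}$ of 1-forms on $U_i$ with $\beta_i-\beta_j=\theta(\nabla_{ij},h_{ij})$ on $U_i\cap U_j$; the holonomy form of $(\nabla,h,\beta)$ is the global 2-form $B$ with $B=d\beta_i$ on $U_i$.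
   Formalization: The gerbe data are assumed alternating: the pairing of l_ij with l_ji is symmetric, s_jki is the cyclic permutation of s_ijk, and s_jik is its inverse. For arbitrary s_ijk on all ordered triples, repeated indices included, part (a) fails even on a point with two open sets. *)

(* Defs.v *)
From HB Require Import structures.
From mathcomp Require Import all_boot all_order all_algebra.
From mathcomp Require Import all_classical all_reals all_analysis.
Import Order.TTheory GRing.Theory Num.Theory numFieldNormedType.Exports.

Set Implicit Arguments.
Unset Strict Implicit.
Unset Printing Implicit Defensive.

Local Open Scope classical_set_scope.
Local Open Scope ring_scope.

(* Throughout, bundles, sections, forms and connections "on U" are total
   functions on the manifold whose values off U are irrelevant; the predicates
   taking U as an argument only constrain them on U, and equality "on U" is
   always spelled out pointwise.  Restriction to a smaller open set is therefore
   silent. *)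

Fixpoint Ck (R : realType) (n k : nat) (A : set 'rV[R]_n) (f : 'rV[R]_n -> R)
    : Prop :=
  (forall y, A y -> {for y, continuous f}) /\
  match k with
  | 0 => True
  | k'.+1 => forall i : 'I_n,
      (forall y, A y -> derivable f y (delta_mx 0 i)) /\
      Ck k' A (fun y => 'D_(delta_mx 0 i) f y)
  end.

Definition Cinfty (R : realType) (n : nat) (A : set 'rV[R]_n)
  (f : 'rV[R]_n -> R) := forall k, Ck k A f.

Record chart (R : realType) (n : nat) (X : topologicalType) := Chart {
  cdom : set X ;
  cmap : X -> 'rV[R]_n ;
  cinv : 'rV[R]_n -> X ;
  cdom_open : open cdom ;
  cimg_open : open (cmap @` cdom) ;
  cmapK : forall x, cdom x -> cinv (cmap x) = x ;
  cmap_continuous : forall x, cdom x -> {for x, continuous cmap} ;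
  cinv_continuous : forall y, (cmap @` cdom) y -> {for y, continuous cinv} }.

Definition compatible_charts (R : realType) (n : nat) (X : topologicalType)
    (c d : chart R n X) :=
  forall i : 'I_n,
    Cinfty (cmap c @` (cdom c `&` cdom d)) (fun y => cmap d (cinv c y) 0 i).

Record manifold (R : realType) (n : nat) := Manifold {
  mspace :> topologicalType ;
  mspace_hausdorff : hausdorff_space mspace ;
  mspace_second_countable : @second_countable mspace ;
  atlas : set (chart R n mspace) ;
  atlas_cover : forall x, exists2 c, atlas c & cdom c x ;
  atlas_compatible : forall c d, atlas c -> atlas d -> compatible_charts c d }.

Section Manifold.
Context (R : realType) (n : nat) (X : manifold R n).

Definition mchart := {c : chart R n X | atlas c}.
Definition mdom (c : mchart) : set X := cdom (proj1_sig c).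
Definition mcoord (c : mchart) : X -> 'rV[R]_n := cmap (proj1_sig c).
Definition mpoint (c : mchart) : 'rV[R]_n -> X := cinv (proj1_sig c).

Definition smooth_on (U : set X) (f : X -> R) :=
  forall c : mchart, Cinfty (mcoord c @` (U `&` mdom c)) (f \o mpoint c).

(* The partial derivative of f with respect to the i-th coordinate of c. *)
Definition pd (c : mchart) (i : 'I_n) (f : X -> R) (x : X) : R :=
  'D_(delta_mx 0 i) (f \o mpoint c) (mcoord c x).

Definition jacobian (c d : mchart) (i j : 'I_n) (x : X) : R :=
  pd c i (fun y => mcoord d y 0 j) x.

(* A 1-form is given by its components in every chart, which transform with the
   Jacobians of the coordinate changes; likewise for 2-forms. *)
Definition form1 := mchart -> 'I_n -> X -> R.
Definition form2 := mchart -> 'I_n -> 'I_n -> X -> R.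

Definition is_form1 (U : set X) (w : form1) :=
  (forall c i, smooth_on (U `&` mdom c) (w c i)) /\
  (forall c d i x, U x -> mdom c x -> mdom d x ->
     w c i x = \sum_(j < n) jacobian c d i j x * w d j x).

Definition is_form2 (U : set X) (w : form2) :=
  [/\ forall c i j, smooth_on (U `&` mdom c) (w c i j),
      forall c i j x, U x -> mdom c x -> w c i j x = - w c j i x &
      forall c d i j x, U x -> mdom c x -> mdom d x ->
        w c i j x =
        \sum_(k < n) \sum_(l < n)
          jacobian c d i k x * jacobian c d j l x * w d k l x].

Definition eq_form1 (U : set X) (v w : form1) :=
  forall c i x, U x -> mdom c x -> v c i x = w c i x.

Definition eq_form2 (U : set X) (v w : form2) :=
  forall c i j x, U x -> mdom c x -> v c i j x = w c i j x.

Definition sub_form1 (v w : form1) : form1 := fun c i x => v c i x - w c i x.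

Definition zero_form2 : form2 := fun _ _ _ _ => 0.

Definition ext_d (w : form1) : form2 :=
  fun c i j x => pd c i (w c j) x - pd c j (w c i) x.

Definition dualv (L : vectType R) : vectType R := 'Hom(L, R^o).

(* For finite-dimensional L and M the map a (x) b |-> (mu |-> mu b *: a) is an
   isomorphism from the tensor product onto Hom(M^*, L), which serves here as
   the definition of the tensor product. *)
Definition tensv (L M : vectType R) : vectType R := 'Hom(dualv M, L).

Definition tens (L M : vectType R) (a : L) (b : M) : tensv L M :=
  linfun (fun mu : dualv M => (mu b : R) *: a).

Definition evalv (M : vectType R) (b : M) : dualv (dualv M) :=
  linfun (fun mu : dualv M => mu b).

(* L (x) M^* acts on M: contractv (a (x) mu) b = mu b *: a. *)
Definition contractv (L M : vectType R) (u : tensv L (dualv M)) (b : M) : L :=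
  u (evalv b).

Record lbundle := LBundle {
  fiber :> X -> vectType R ;
  frames : set (set X * (forall x, fiber x)) }.
Arguments frames : clear implicits.

Definition section (l : lbundle) := forall x, l x.

(* A line bundle on U: a family of lines with an atlas of local frames whose
   transition functions are smooth. *)
Definition is_lbundle (U : set X) (l : lbundle) :=
  [/\ forall x, U x -> \dim {:l x} = 1%N,
      forall W e, frames l (W, e) -> open W /\ forall x, U x -> W x -> e x != 0,
      forall x, U x -> exists W e, frames l (W, e) /\ W x &
      forall W e W' e', frames l (W, e) -> frames l (W', e') ->
        exists g, smooth_on (U `&` W `&` W') g /\
          forall x, U x -> W x -> W' x -> e' x = g x *: e x].

Definition smooth_section (l : lbundle) (V : set X) (s : section l) :=
  forall W e, frames l (W, e) ->
    exists f, smooth_on (V `&` W) f /\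
      forall x, V x -> W x -> s x = f x *: e x.

Definition trivb : lbundle :=
  @LBundle (fun=> (R^o : vectType R)) [set (setT, fun=> 1)].

Definition dualb (l : lbundle) : lbundle :=
  @LBundle (fun x => dualv (l x))
    [set p : set X * (forall x, dualv (l x)) | exists2 e, frames l (p.1, e) &
       forall x, p.1 x -> e x != 0 -> p.2 x (e x) = 1].

Definition tensb (l m : lbundle) : lbundle :=
  @LBundle (fun x => tensv (l x) (m x))
    [set p : set X * (forall x, tensv (l x) (m x)) |
       exists W e W' e', [/\ frames l (W, e), frames m (W', e') &
       p = (W `&` W', fun x => tens (e x) (e' x))]].

Definition bundle_map (l m : lbundle) := forall x, 'Hom(l x, m x).

Definition is_bundle_iso (U : set X) (l m : lbundle) (phi : bundle_map l m) :=
  (forall x, U x -> bijective (phi x)) /\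
  (forall V s, open V -> V `<=` U ->
     @smooth_section l V s -> @smooth_section m V (fun x => phi x (s x))).

(* D s c i is the covariant derivative of s along the i-th coordinate
   vector field of the chart c. *)
Definition conn (l : lbundle) := section l -> mchart -> 'I_n -> section l.

Definition is_conn (U : set X) (l : lbundle) (D : conn l) :=
  forall V, open V -> V `<=` U ->
  [/\ forall s t, @smooth_section l V s -> @smooth_section l V t ->
        (forall x, V x -> s x = t x) ->
        forall c i x, V x -> mdom c x -> D s c i x = D t c i x,
      forall s t, @smooth_section l V s -> @smooth_section l V t ->
        forall c i x, V x -> mdom c x ->
        D (fun y => s y + t y) c i x = D s c i x + D t c i x,
      forall f s, smooth_on V f -> @smooth_section l V s ->
        forall c i x, V x -> mdom c x ->
        D (fun y => f y *: s y) c i x = pd c i f x *: s x + f x *: D s c i x,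
      forall s, @smooth_section l V s ->
        forall c i, @smooth_section l (V `&` mdom c) (D s c i) &
      forall s, @smooth_section l V s ->
        forall c d i x, V x -> mdom c x -> mdom d x ->
        D s c i x = \sum_(j < n) jacobian c d i j x *: D s d j x].

(* Vanishing of the curvature: covariant derivatives along coordinate vector
   fields commute. *)
Definition flat_conn (U : set X) (l : lbundle) (D : conn l) :=
  forall V s, open V -> V `<=` U -> @smooth_section l V s ->
  forall c i j x, V x -> mdom c x ->
    D (D s c j) c i x = D (D s c i) c j x.

Definition parallel (U : set X) (l : lbundle) (D : conn l) (s : section l) :=
  forall c i x, U x -> mdom c x -> D s c i x = 0.

Definition triv_conn : conn trivb := fun f c i x => pd c i f x.

(* The dual and tensor product connections are described by their Leibniz
   rules, which determine their values on smooth sections. *)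
Definition dual_conn (l : lbundle) (D : conn l) : conn (dualb l) :=
  fun sigma c i x => xget 0 [set tau : dualb l x |
    forall V s, open V -> V x -> @smooth_section l V s ->
      tau (s x) = pd c i (fun y => sigma y (s y)) x - sigma x (D s c i x)].

Definition tens_conn (l m : lbundle) (D : conn l) (E : conn m)
    : conn (tensb l m) :=
  fun u c i x => xget 0 [set w : tensb l m x |
    forall V s t, open V -> V x ->
      @smooth_section l V s -> @smooth_section m V t ->
      (forall y, V y -> u y = tens (s y) (t y)) ->
      w = tens (D s c i x) (t x) + tens (s x) (E t c i x)].

(* D corresponds to E on U under phi. *)
Definition conn_via (U : set X) (l m : lbundle) (phi : bundle_map l m)
    (D : conn l) (E : conn m) :=
  forall V s, open V -> V `<=` U -> @smooth_section l V s ->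
  forall c i x, V x -> mdom c x ->
    phi x (D s c i x) = E (fun y => phi y (s y)) c i x.

Definition metric (l : lbundle) := forall x, l x -> l x -> R.

Definition is_metric (U : set X) (l : lbundle) (h : metric l) :=
  [/\ forall x, U x -> forall (a : R) (u v w : l x),
        h x (a *: u + v) w = a * h x u w + h x v w,
      forall x, U x -> forall u v : l x, h x u v = h x v u,
      forall x, U x -> forall u : l x, u != 0 -> 0 < h x u u &
      forall V s t, open V -> V `<=` U ->
        @smooth_section l V s -> @smooth_section l V t ->
        smooth_on V (fun x => h x (s x) (t x))].

Definition triv_metric : metric trivb := fun x a b => (a : R) * b.

Definition dual_metric (l : lbundle) (h : metric l) : metric (dualb l) :=
  fun x sigma tau => xget 0 [set r : R |
    forall v : l x, r * h x v v = (sigma v : R) * tau v].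

(* In a tensor product of lines every element is of the form a (x) b. *)
Definition tens_metric (l m : lbundle) (h : metric l) (k : metric m)
    : metric (tensb l m) :=
  fun x u w => xget 0 [set r : R |
    exists (a a' : l x) (b b' : m x),
      [/\ u = tens a b, w = tens a' b' & r = h x a a' * k x b b']].

Definition metric_via (U : set X) (l m : lbundle) (phi : bundle_map l m)
    (h : metric l) (k : metric m) :=
  forall x, U x -> forall u v : l x, k x (phi x u) (phi x v) = h x u v.

Definition metric_conn (U : set X) (l : lbundle) (h : metric l) (D : conn l) :=
  forall V s t, open V -> V `<=` U ->
    @smooth_section l V s -> @smooth_section l V t ->
    forall c i x, V x -> mdom c x ->
      pd c i (fun y => h y (s y) (t y)) x =
      h x (D s c i x) (t x) + h x (s x) (D t c i x).

(* theta(nabla, h) = nabla - nabla_h on U, with nabla_h the unique connection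
   compatible with h. *)
Definition theta (U : set X) (l : lbundle) (D : conn l) (h : metric l) : form1 :=
  fun c i x => xget 0 [set r : R |
    exists Dh : conn l, [/\ is_conn U Dh, metric_conn U h Dh &
      forall V s, open V -> V `<=` U -> V x -> @smooth_section l V s ->
        D s c i x - Dh s c i x = r *: s x]].

Definition smooth_unit (U : set X) (f : X -> R) :=
  smooth_on U f /\ forall x, U x -> f x != 0.

Definition locconst_unit (U : set X) (f : X -> R) :=
  forall x, U x -> f x != 0 /\ \forall y \near x, f y = f x.

Definition open_cover (J : Type) (V : J -> set X) :=
  (forall a, open (V a)) /\ forall x, exists a, V a x.

Definition refinement (I J : Type) (U : I -> set X) (V : J -> set X)
    (tau : J -> I) :=
  open_cover V /\ forall a, V a `<=` U (tau a).

(* A is the sheaf of coefficients.  A cocycle on a cover is trivial in Cech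
   cohomology (the direct limit over refinements) iff it becomes a coboundary
   on some refinement. *)
Definition cech2_trivial (A : set X -> (X -> R) -> Prop) (J : Type)
    (V : J -> set X) (r : J -> J -> J -> X -> R) :=
  exists (K : Type) (W : K -> set X) (tau : K -> J) (g : K -> K -> X -> R),
    [/\ refinement V W tau,
        forall a b, A (W a `&` W b) (g a b) &
        forall a b c x, W a x -> W b x -> W c x ->
          r (tau a) (tau b) (tau c) x = g b c x * (g a c x)^-1 * g a b x].

(* All index pairs and triples occur, including degenerate ones, and s is
   alternating in the usual sense: s_jki is the cyclic permutation of s_ijk, and
   s_ijk and s_jik are mutually inverse under the pairings.  In the co-closedness
   condition, s_jkl (x) s_ijl = s_ikl (x) s_ijk after contracting l_lj with l_jl
   on the left and l_ik with l_ki on the right.  Since all fibers are lines, it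
   suffices to know these identities on decompositions into pure tensors, which
   always exist. *)
Record gerbe := Gerbe {
  gidx : Type ;
  gU : gidx -> set X ;
  gU_cover : open_cover gU ;
  gl : gidx -> gidx -> lbundle ;
  gl_bundle : forall i j, is_lbundle (gU i `&` gU j) (gl i j) ;
  gpair : forall i j, bundle_map (tensb (gl i j) (gl j i)) trivb ;
  gpair_iso : forall i j, is_bundle_iso (gU i `&` gU j) (gpair i j) ;
  gpair_sym : forall i j x, gU i x -> gU j x ->
    forall (a : gl i j x) (b : gl j i x),
      gpair i j x (tens a b) = gpair j i x (tens b a) ;
  gs : forall i j k, section (tensb (tensb (gl i j) (gl j k)) (gl k i)) ;
  gs_smooth : forall i j k,
    smooth_section (gU i `&` gU j `&` gU k) (gs i j k) ;
  gs_neq0 : forall i j k x, gU i x -> gU j x -> gU k x -> gs i j k x != 0 ;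
  gs_cyclic : forall i j k x, gU i x -> gU j x -> gU k x ->
    forall (a : gl i j x) (b : gl j k x) (c : gl k i x),
      gs i j k x = tens (tens a b) c -> gs j k i x = tens (tens b c) a ;
  gs_inverse : forall i j k x, gU i x -> gU j x -> gU k x ->
    forall (a : gl i j x) (b : gl j k x) (c : gl k i x)
           (a' : gl j i x) (c' : gl i k x) (b' : gl k j x),
      gs i j k x = tens (tens a b) c -> gs j i k x = tens (tens a' c') b' ->
      (gpair i j x (tens a a') : R) * gpair j k x (tens b b')
        * gpair k i x (tens c c') = 1 ;
  gs_coclosed : forall i j k l x, gU i x -> gU j x -> gU k x -> gU l x ->
    forall (a1 : gl j k x) (a2 : gl k l x) (a3 : gl l j x)
           (b1 : gl i j x) (b2 : gl j l x) (b3 : gl l i x)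
           (c1 : gl i k x) (c2 : gl k l x) (c3 : gl l i x)
           (d1 : gl i j x) (d2 : gl j k x) (d3 : gl k i x),
      gs j k l x = tens (tens a1 a2) a3 -> gs i j l x = tens (tens b1 b2) b3 ->
      gs i k l x = tens (tens c1 c2) c3 -> gs i j k x = tens (tens d1 d2) d3 ->
      (gpair l j x (tens a3 b2) : R) *: tens (tens (tens a1 a2) b1) b3 =
      (gpair i k x (tens c1 d3) : R) *: tens (tens (tens d2 c2) d1) c3 }.

Section Gerbe.
Context (G : gerbe).
Local Notation I := (gidx G).
Local Notation U := (@gU G).

(* Trivializations t_ab of l_ab on a refined cover, with t_ba = t_ab^-1. *)
Definition local_frames (J : Type) (V : J -> set X) (tau : J -> I)
    (t : forall a b, section (gl (tau a) (tau b))) :=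
  [/\ forall a b, smooth_section (V a `&` V b) (t a b),
      forall a b x, V a x -> V b x -> t a b x != 0 &
      forall a b x, V a x -> V b x ->
        gpair (tau a) (tau b) x (tens (t a b x) (t b a x)) = 1].

(* s_abc = r_abc t_ab (x) t_bc (x) t_ca. *)
Definition frame_cocycle (J : Type) (V : J -> set X) (tau : J -> I)
    (t : forall a b, section (gl (tau a) (tau b))) (r : J -> J -> J -> X -> R) :=
  forall a b c x, V a x -> V b x -> V c x ->
    gs (tau a) (tau b) (tau c) x =
    r a b c x *: tens (tens (t a b x) (t b c x)) (t c a x).

Definition gerbe_class_trivial :=
  exists (J : Type) (V : J -> set X) (tau : J -> I)
         (t : forall a b, section (gl (tau a) (tau b)))
         (r : J -> J -> J -> X -> R),
    [/\ refinement U V tau, local_frames V t, frame_cocycle V t r &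
        cech2_trivial smooth_unit V r].

Definition gerbe_conn := forall i j, conn (gl (g := G) i j).

Definition is_gerbe_conn (D : gerbe_conn) :=
  [/\ forall i j, is_conn (U i `&` U j) (D i j),
      forall i j, conn_via (U i `&` U j) (@gpair G i j)
        (tens_conn (D i j) (D j i)) triv_conn &
      forall i j k, parallel (U i `&` U j `&` U k)
        (tens_conn (tens_conn (D i j) (D j k)) (D k i)) (gs i j k)].

Definition is_flat_gerbe_conn (D : gerbe_conn) :=
  is_gerbe_conn D /\ forall i j, flat_conn (U i `&` U j) (D i j).

Definition holonomy_trivial (D : gerbe_conn) :=
  exists (J : Type) (V : J -> set X) (tau : J -> I)
         (t : forall a b, section (gl (tau a) (tau b)))
         (r : J -> J -> J -> X -> R),
    [/\ refinement U V tau, local_frames V t,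
        forall a b, parallel (V a `&` V b) (D (tau a) (tau b)) (t a b),
        frame_cocycle V t r &
        cech2_trivial locconst_unit V r].

Definition gerbe_metric := forall i j, metric (gl (g := G) i j).

Definition is_gerbe_metric (h : gerbe_metric) :=
  [/\ forall i j, is_metric (U i `&` U j) (h i j),
      forall i j, metric_via (U i `&` U j) (@gpair G i j)
        (tens_metric (h i j) (h j i)) triv_metric &
      forall i j k x, U i x -> U j x -> U k x ->
        tens_metric (tens_metric (h i j) (h j k)) (h k i)
          (gs i j k x) (gs i j k x) = 1].

(* The canonical trivialization of
   (l_i (x) l_j^* ) (x) (l_j (x) l_k^* ) (x) (l_k (x) l_i^* ) is
   (a (x) b^* ) (x) (b (x) c^* ) (x) (c (x) a^* ), for any a, b, c with dual
   vectors a^*, b^*, c^*. *)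
Record trivialization := Trivialization {
  tl : I -> lbundle ;
  tl_bundle : forall i, is_lbundle (U i) (tl i) ;
  tiso : forall i j, bundle_map (tensb (tl i) (dualb (tl j))) (gl i j) ;
  tiso_iso : forall i j, is_bundle_iso (U i `&` U j) (tiso i j) ;
  tiso_gs : forall i j k x, U i x -> U j x -> U k x ->
    forall (a : tl i x) (b : tl j x) (c : tl k x)
           (a' : dualb (tl i) x) (b' : dualb (tl j) x) (c' : dualb (tl k) x),
      a' a = 1 -> b' b = 1 -> c' c = 1 ->
      gs i j k x = tens (tens (tiso i j x (tens a b')) (tiso j k x (tens b c')))
                        (tiso k i x (tens c a')) }.

(* xi is the line bundle obtained by patching the l_i (x) l'_i^* along the
   isomorphisms induced on overlaps by l_i (x) l_j^* = l_ij = l'_i (x) l'_j^*: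
   regarding v in xi_x as maps v_i : l'_i -> l_i and v_j : l'_j -> l_j, one has
   v_i T' = T v_j whenever T : l_j -> l_i and T' : l'_j -> l'_i represent the
   same element of l_ij. *)
Definition is_patching (T T' : trivialization) (xi : lbundle)
    (psi : forall i, bundle_map xi (tensb (tl T i) (dualb (tl T' i)))) :=
  [/\ is_lbundle setT xi,
      forall i, is_bundle_iso (U i) (psi i) &
      forall i j x, U i x -> U j x ->
        forall (v : xi x) (u : tensb (tl T i) (dualb (tl T j)) x)
               (u' : tensb (tl T' i) (dualb (tl T' j)) x),
          tiso T i j x u = tiso T' i j x u' ->
          forall z : tl T' j x,
            contractv (psi i x v) (contractv u' z) =
            contractv u (contractv (psi j x v) z)].

Definition is_local_conns (D : gerbe_conn) (T : trivialization)
    (E : forall i, conn (tl T i)) :=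
  (forall i, is_conn (U i) (E i)) /\
  (forall i j, conn_via (U i `&` U j) (@tiso T i j)
     (tens_conn (E i) (dual_conn (E j))) (D i j)).

Definition flat_local_conns (T : trivialization) (E : forall i, conn (tl T i)) :=
  forall i, flat_conn (U i) (E i).

Definition is_patched_conn (T T' : trivialization)
    (E : forall i, conn (tl T i)) (E' : forall i, conn (tl T' i)) (xi : lbundle)
    (psi : forall i, bundle_map xi (tensb (tl T i) (dualb (tl T' i))))
    (D : conn xi) :=
  is_conn setT D /\
  forall i, conn_via (U i) (psi i) D (tens_conn (E i) (dual_conn (E' i))).

Definition is_local_metrics (h : gerbe_metric) (T : trivialization)
    (k : forall i, metric (tl T i)) :=
  (forall i, is_metric (U i) (k i)) /\
  (forall i j, metric_via (U i `&` U j) (@tiso T i j)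
     (tens_metric (k i) (dual_metric (k j))) (h i j)).

Definition is_adaptation (D : gerbe_conn) (h : gerbe_metric)
    (beta : I -> form1) :=
  (forall i, is_form1 (U i) (beta i)) /\
  (forall i j, eq_form1 (U i `&` U j) (sub_form1 (beta i) (beta j))
     (theta (U i `&` U j) (D i j) (h i j))).

Definition is_holonomy_form (beta : I -> form1) (B : form2) :=
  is_form2 setT B /\ forall i, eq_form2 (U i) B (ext_d (beta i)).

End Gerbe.
End Manifold.

Arguments zero_form2 {R n X}.
Arguments gU {R n X} G : rename.
Arguments is_patching {R n X G} T T' xi psi.

(* Main.v *)
Require Import Defs.
From HB Require Import structures.
From mathcomp Require Import all_boot all_order all_algebra.
From mathcomp Require Import all_classical all_reals all_analysis.
From mathcomp Require Import ring lra.
Import Order.TTheory GRing.Theory Num.Theory numFieldNormedType.Exports.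

(** Local frames turn the objects attached to the gerbe into cocycles, and most of the
    statement says that some cocycle is a coboundary.  Partitions of unity, in the form
    of averaging_operator, split cocycles of two kinds: positive functions
    (split_positive_cocycle) and 1-forms (split_form1_cocycle).  A real cocycle is
    positive up to signs; the signs carry the topology, and only part (a), where the
    triviality of the gerbe class enters, has to deal with them.

    (a) The hypothesis gives frames T_ab of the l_(tau a, tau b) over a finer cover W_a
    whose triple products are the s_abc (rescaled_frames).  The bundle l_i is glued from
    the l_(i, tau a) over the intersections of U_i and W_a, by means of the T_ab.  To get
    a family of vector spaces without taking quotients, bases theta_ij(x) of all fibres
    with theta_ij theta_jk theta_ki = s_ijk are chosen point by point
    (pointwise_bases); with them every fibre becomes R, and only the smooth structure
    remains to be described (glued_bundle).  The bundle xi is built in the same manner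
    (patched_bundle).

    (b) On frames e of l_i and e' of l_j, a connection nabla_ij has a form A_ee' in the
    frame e (x) e'^* of l_ij, and connections nabla_i with forms A_e are subordinate to
    it if and only if A_ee' = A_e - A_e'.  Since s_ijk is parallel, the A_ee' form a
    cocycle indexed by all local frames of all l_i (qform_cocycle); for two frames of the
    same l_i it is the logarithmic derivative of the transition function (qform_diag), so
    any splitting satisfies the transformation law of connection forms as well.

    (c) Over the finer cover on which there are parallel frames T with product s, one has
    e (x) e'^* = r T and A_ee' = dlog r.  Writing the positive cocycle r^2 as m_e / m_e'
    splits A_ee' into the closed forms dlog m_e / 2, and this closed splitting extends
    to all frames (flat_local_conns_exist).  Flatness of D is that of nabla_i and
    nabla'_i, read off in local frames.

    (d) The squared norms of e (x) e'^* form a positive cocycle, and the functions that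
    split it are the squared norms of e for metrics h_i.  In a frame theta is
    A_e - 1/2 d ln h_i(e, e) (theta_cform); thus it is additive, which makes it an
    adaptation, and d theta = d A_e is the curvature.

    (e) The connection nabla'_i must be the metric connection of h_i plus beta_i.  It is
    subordinate to nabla because beta is an adaptation to nabla, and its curvature is
    d beta_i = B.  So the flat nabla' can be taken to be nabla itself, and B = 0 is
    precisely the flatness of the nabla'_i. *)

Set Implicit Arguments.
Unset Strict Implicit.
Unset Printing Implicit Defensive.

Local Open Scope classical_set_scope.
Local Open Scope ring_scope.

Local Notation jacobian := Defs.jacobian.
Local Notation frames_of l := (@frames _ _ _ l).

(** * Differential calculus on R^n *)

Section Calculus.
Context (R : realType) (n : nat).
Implicit Types (f g : 'rV[R]_n -> R) (A B : set 'rV[R]_n) (y z v : 'rV[R]_n).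

Local Notation E i := (delta_mx 0 i : 'rV[R]_n).

Lemma is_derive_line f z v (t : R) : derivable f (t *: v + z) v ->
  is_derive t 1 (fun u : R => f (u *: v + z)) ('D_v f (t *: v + z)).
Proof.
have eq_quot : (fun h : R => h^-1 *: ((f \o shift (t *: v + z)) (h *: v)
                             - f (t *: v + z))) =
  (fun h : R => h^-1 *: (((fun u : R => f (u *: v + z)) \o shift t) (h *: (1 : R))
                             - f (t *: v + z))).
  apply/funext => h /=; congr (_ *: (f _ - _)).
  by rewrite scalerDl -addrA scaler1.
by move=> df; split; rewrite /derivable /derive -eq_quot.
Qed.

Lemma mvt_line f z v (s : R) :
  (forall t : R, `|t| <= `|s| -> derivable f (t *: v + z) v) ->
  exists2 t : R, `|t| <= `|s| & f (s *: v + z) - f z = s * 'D_v f (t *: v + z).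
Proof.
move=> df; set g : R -> R := fun u => f (u *: v + z).
have dg (t : R) : `|t| <= `|s| -> is_derive t 1 g ('D_v f (t *: v + z)).
  by move=> ts; apply: is_derive_line; exact: df.
have cg (t : R) : `|t| <= `|s| -> {for t, continuous g}.
  move=> /dg dgt; apply/differentiable_continuous/derivable1_diffP.
  exact: ex_derive.
have g0 : f z = g 0 by rewrite /g scale0r add0r.
have [s0|s0|->] := ltgtP s 0.
- have [x xs||t ts gE] := @MVT R g (fun t => 'D_v f (t *: v + z)) s 0 s0.
  + apply: dg; move: xs; rewrite in_itv/= => /andP[? ?].
    by rewrite !ltr0_norm// lerN2 ltW.
  + apply: continuous_in_subspaceT => u; rewrite inE /= in_itv/= => /andP[? ?].
    by apply: cg; rewrite !ler0_norm ?lerN2// ltW.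
  exists t; move: ts; rewrite in_itv/= => /andP[? ?].
    by rewrite !ltr0_norm// lerN2 ltW.
  by rewrite g0 -[f _]/(g s) -opprB gE sub0r mulrN opprK mulrC.
- have [x xs||t ts gE] := @MVT R g (fun t => 'D_v f (t *: v + z)) 0 s s0.
  + apply: dg; move: xs; rewrite in_itv/= => /andP[? ?].
    by rewrite !gtr0_norm// ltW.
  + apply: continuous_in_subspaceT => u; rewrite inE /= in_itv/= => /andP[? ?].
    by apply: cg; rewrite !ger0_norm// ltW.
  exists t; move: ts; rewrite in_itv/= => /andP[? ?].
    by rewrite !gtr0_norm// ltW.
  by rewrite g0 -[f _]/(g s) gE subr0 mulrC.
- by exists 0; rewrite ?normr0// mul0r scale0r add0r subrr.
Qed.

Definition trunc_row (h : 'rV[R]_n) k : 'rV[R]_n :=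
  \row_j (if (j < k)%N then h 0 j else 0).

Lemma norm_row_le (h : 'rV[R]_n) (M : R) :
  0 <= M -> (forall j, `|h 0 j| <= M) -> `|h| <= M.
Proof.
move=> M0 hM; rewrite [leLHS]/Num.Def.normr/= mx_normrE bigmax_le// => -[i j] _.
by rewrite ord1.
Qed.

Lemma coord_norm_le (h : 'rV[R]_n) j : `|h 0 j| <= `|h|.
Proof.
rewrite [leRHS]/Num.Def.normr/= mx_normrE.
exact: (le_bigmax _ _ (0, j)).
Qed.

(** A function with continuous partial derivatives is differentiable: passing from y to
    y + h by changing one coordinate at a time, the mean value theorem replaces each
    increment by a partial derivative at a point near y. *)
Lemma partials_differentiable f y :
  (\forall z \near y, forall i : 'I_n, derivable f z (E i)) ->
  (forall i : 'I_n, {for y, continuous ('D_(E i) f)}) ->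
  differentiable f y.
Proof.
move=> df cdf.
pose L (h : 'rV[R]_n) : R := \sum_j h 0 j * 'D_(E j) f y.
have L_lin : linear L.
  move=> a u w; rewrite /L scaler_sumr -big_split/=; apply: eq_bigr => j _.
  by rewrite !mxE mulrDl scalerAl.
pose Lb := GRing.isLinear.Build _ _ _ _ L L_lin.
pose Ll : {linear 'rV[R]_n -> R} := HB.pack L Lb.
have Lc : continuous Ll.
  have -> : (Ll : 'rV[R]_n -> R) =
      \sum_(j < n) (fun h : 'rV[R]_n => h 0 j * 'D_(E j) f y).
    by apply/funext => h /=; rewrite /L fct_sumE.
  move=> h; apply/differentiable_continuous/differentiable_sum => j.
  by apply: differentiableZl; exact: differentiable_coord.
suff main : f \o shift y = cst (f y) + (Ll : 'rV[R]_n -> R^o) +o_ (0 : 'rV[R]_n) id.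
  have dE := diff_unique Lc main.
  by apply/diff_locallyP; split; rewrite dE.
apply/eqaddoP => _/posnumP[e].
(* Dividing by n + 1 rather than n covers n = 0. *)
have e'0 : 0 < e%:num / n.+1%:R by rewrite divr_gt0// ltr0n.
have {}cdf : \forall z \near y, forall i : 'I_n,
    `|'D_(E i) f z - 'D_(E i) f y| < e%:num / n.+1%:R.
  apply: (@filter_forall _ _ _ _ (nbhs_filter y)) => i; have /cvgrPdist_lt/(_ _ e'0) := cdf i.
  by apply: filterS => z; rewrite distrC.
have /nbhs_ballP[r /= r0 rP] := @filterI _ _ (nbhs_filter y) _ _ df cdf.
apply/nbhs_ballP; exists r => //= h.
rewrite -ball_normE /= sub0r normrN => hr.
have step (k : 'I_n) : `|f (trunc_row h k.+1 + y) - f (trunc_row h k + y)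
     - h 0 k * 'D_(E k) f y| <= e%:num / n.+1%:R * `|h|.
  have tE (t : R) : t *: E k + (trunc_row h k + y) =
     (\row_j (if (j < k)%N then h 0 j else if j == k then t else 0)) + y.
    rewrite addrA; congr (_ + _); apply/rowP => j; rewrite !mxE eqxx/=.
    case: eqVneq => [->|jk]; first by rewrite ltnn mulr1 addr0.
    by rewrite mulr0 add0r.
  have tb (t : R) : `|t| <= `|h 0 k| -> ball y r (t *: E k + (trunc_row h k + y)).
    move=> tk; rewrite -ball_normE /= tE opprD addrCA subrr addr0 normrN.
    apply: le_lt_trans hr; apply: norm_row_le => // j; rewrite mxE.
    case: ifPn => _; first exact: coord_norm_le.
    case: ifPn => _; first by apply: le_trans tk _; exact: coord_norm_le.
    by rewrite normr0.
  have [t tk] := @mvt_line f (trunc_row h k + y) (E k) (h 0 k)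
                    (fun t tk => (rP _ (tb t tk)).1 k).
  have -> : h 0 k *: E k + (trunc_row h k + y) = trunc_row h k.+1 + y.
    rewrite tE; congr (_ + y); apply/rowP => j; rewrite !mxE ltnS.
    rewrite [in RHS]leq_eqVlt -[(nat_of_ord j == k)]/(j == k); case: eqVneq => [->|jk] /=.
      by rewrite ltnn.
    by case: ifP.
  move=> ->; rewrite -mulrBr normrM mulrC ler_pM// ?coord_norm_le//.
  by rewrite ltW// (rP _ (tb t tk)).2.
have tel k : (k <= n)%N -> f (trunc_row h k + y) - f y =
    \sum_(j < n | (j < k)%N) (f (trunc_row h j.+1 + y) - f (trunc_row h j + y)).
  elim: k => [_|k IH kn].
    rewrite big1 ?addr0//.
    have -> : trunc_row h 0 = 0 by apply/rowP => j; rewrite !mxE.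
    by rewrite add0r subrr.
  rewrite (bigD1 (Ordinal kn))//=.
  rewrite (eq_bigl (fun j : 'I_n => (j < k)%N)); last first.
    by move=> j; rewrite ltnS -val_eqE /= ltn_neqAle andbC.
  by rewrite -IH ?(ltnW kn)// addrA subrK.
have hE : trunc_row h n = h by apply/rowP => j; rewrite mxE ltn_ord.
rewrite /GRing.add /GRing.opp /= opprD addrA -{1}hE tel// /L.
rewrite (eq_bigl xpredT); last by move=> j; rewrite ltn_ord.
rewrite -sumrB; apply: le_trans (ler_norm_sum _ _ _) _.
apply: (@le_trans _ _ (\sum_(j < n) e%:num / n.+1%:R * `|h|)).
  by apply: ler_sum => j _; exact: step.
rewrite sumr_const card_ord -mulrnAl -mulr_natr ler_wpM2r//.
by rewrite -mulrA ger_pMr// mulrC ler_pdivrMr ?ltr0n// mul1r ler_nat.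
Unshelve. all: by end_near.
Qed.

Lemma near_continuous (T : topologicalType) (f g : T -> R) (y : T) :
  (\forall z \near y, f z = g z) ->
  {for y, continuous f} -> {for y, continuous g}.
Proof.
move=> fg cf; rewrite /prop_for /continuous_at -(nbhs_singleton fg).
by apply: cvg_trans cf; exact: near_eq_cvg.
Qed.

Lemma Ck_sub k A B f : B `<=` A -> Ck k A f -> Ck k B f.
Proof.
elim: k f => [|k IH] f BA [cf df]; first by split=> // y /BA/cf.
split=> [y /BA/cf//|i].
by have [d1 d2] := df i; split=> [y /BA/d1//|]; exact: IH.
Qed.

Lemma Ck_pred k A f : Ck k.+1 A f -> Ck k A f.
Proof.
elim: k f => [|k IH] f [cf df]; split=> // i.
by have [? ?] := df i; split => //; exact: IH.
Qed.

Lemma Ck_le k l A f : (k <= l)%N -> Ck l A f -> Ck k A f.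
Proof.
elim: l => [|l IH]; first by rewrite leqn0 => /eqP->.
by rewrite leq_eqVlt => /predU1P[->//|/IH +/Ck_pred].
Qed.

Lemma Ck_local k A f :
  (forall y, A y -> exists2 B, B y & Ck k B f) -> Ck k A f.
Proof.
elim: k f => [|k IH] f H; split=> //.
- by move=> y /H[B By [+ _]]; apply.
- by move=> y /H[B By [+ _]]; apply.
move=> i; split=> [y /H[B By [_ /(_ i)[+ _]]]|]; first exact.
by apply: IH => y /H[B By [_ /(_ i)[_ ?]]]; exists B.
Qed.

Lemma Ck_ext k A f g : open A -> (forall y, A y -> f y = g y) ->
  Ck k A f -> Ck k A g.
Proof.
move=> oA; elim: k f g => [|k IH] f g fg [cf df].
  split=> // y Ay; apply: near_continuous (cf y Ay).
  by apply: filterS (open_nbhs_nbhs (conj oA Ay)).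
have nfg y : A y -> \forall z \near y, f z = g z.
  by move=> Ay; apply: filterS (open_nbhs_nbhs (conj oA Ay)).
split=> [y Ay|i]; first by apply: near_continuous (cf y Ay); exact: nfg.
have [dfi kfi] := df i; split=> [y Ay|].
  by apply: near_eq_derivable (dfi y Ay); exact: nfg.
by apply: IH kfi => y Ay; apply: near_eq_derive; exact: nfg.
Qed.

Lemma C1_differentiable A f y : open A -> Ck 1 A f -> A y -> differentiable f y.
Proof.
move=> oA [_ df] Ay; apply: partials_differentiable => [|i].
  apply: filterS (open_nbhs_nbhs (conj oA Ay)) => z Az i.
  by have [+ _] := df i; apply.
by have [_ [+ _]] := df i; apply.
Qed.

Lemma Ck_cst k A (a : R) : Ck k A (fun=> a).
Proof.
elim: k a => [|k IH] a; split=> //; try by move=> y _; exact: cst_continuous.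
move=> i; split=> [y _|]; first exact: derivable_cst.
rewrite (_ : 'D_(E i) (fun=> a) = fun=> 0)//; apply: funext => y.
exact: derive_cst.
Qed.

Lemma Ck_add k A f g : open A -> Ck k A f -> Ck k A g ->
  Ck k A (fun y => f y + g y).
Proof.
move=> oA; elim: k f g => [|k IH] f g [cf df] [cg dg].
  by split=> // y Ay; apply: continuousD; [exact: cf|exact: cg].
split=> [y Ay|i]; first by apply: continuousD; [exact: cf|exact: cg].
have [dfi kfi] := df i; have [dgi kgi] := dg i.
split=> [y Ay|]; first exact: derivableD (dfi _ Ay) (dgi _ Ay).
apply: Ck_ext (IH _ _ kfi kgi) => // y Ay.
by rewrite [RHS](deriveD (dfi _ Ay) (dgi _ Ay)).
Qed.

Lemma Ck_mul k A f g : open A -> Ck k A f -> Ck k A g ->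
  Ck k A (fun y => f y * g y).
Proof.
move=> oA; elim: k f g => [|k IH] f g Cf Cg; have [cf df] := Cf; have [cg dg] := Cg.
  by split=> // y Ay; apply: continuousM; [exact: cf|exact: cg].
split=> [y Ay|i]; first by apply: continuousM; [exact: cf|exact: cg].
have [dfi kfi] := df i; have [dgi kgi] := dg i.
split=> [y Ay|]; first exact: derivableM (dfi _ Ay) (dgi _ Ay).
apply: Ck_ext (Ck_add oA (IH _ _ (Ck_pred Cf) kgi) (IH _ _ (Ck_pred Cg) kfi)) => //.
by move=> y Ay; rewrite [RHS](deriveM (dfi _ Ay) (dgi _ Ay)).
Qed.

Lemma Ck_sum k A (I : Type) (r : seq I) (F : I -> 'rV[R]_n -> R) : open A ->
  (forall i, Ck k A (F i)) -> Ck k A (fun y => \sum_(i <- r) F i y).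
Proof.
move=> oA CF; elim: r => [|a r IH].
  by under eq_fun do rewrite big_nil; exact: Ck_cst.
by under eq_fun do rewrite big_cons; exact: Ck_add.
Qed.

Lemma Ck_inv k A f : open A -> (forall y, A y -> f y != 0) -> Ck k A f ->
  Ck k A (fun y => (f y)^-1).
Proof.
move=> oA f0; elim: k => [|k IH] Cf; have [cf df] := Cf.
  by split=> // y Ay; apply: continuousV; [exact: f0|exact: cf].
split=> [y Ay|i]; first by apply: continuousV; [exact: f0|exact: cf].
have [dfi kfi] := df i; have Ci := IH (Ck_pred Cf).
split=> [y Ay|]; first exact: derivableV (f0 _ Ay) (dfi _ Ay).
apply: Ck_ext (Ck_mul oA (Ck_mul oA (Ck_cst k A (-1)) (Ck_mul oA Ci Ci)) kfi) => //.
move=> y Ay; rewrite [RHS](deriveV (f0 _ Ay) (dfi _ Ay)).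
by rewrite mulN1r -invfM -expr2.
Qed.

Lemma is_derive_translate f (w z v : 'rV[R]_n) : derivable f (w + z) v ->
  is_derive z v (fun u => f (w + u)) ('D_v f (w + z)).
Proof.
have eq_quot : (fun h : R => h^-1 *: ((f \o shift (w + z)) (h *: v)
                             - f (w + z))) =
  (fun h : R => h^-1 *: (((fun u => f (w + u)) \o shift z) (h *: v)
                             - f (w + z))).
  by apply/funext => h /=; congr (_ *: (f _ - _)); rewrite addrCA.
by move=> df; split; rewrite /derivable /derive -eq_quot.
Qed.

(** The mean value theorem, first along u for z |-> f (s v + z) - f z, then along v
    for the derivative of f along u. *)
Lemma second_difference f (u v y : 'rV[R]_n) (r s : R) :
  (forall z, ball y r z -> derivable f z u /\ derivable ('D_u f) z v) ->
  `|u| <= 1 -> `|v| <= 1 -> `|s| + `|s| < r ->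
  exists2 z : 'rV[R]_n, ball y r z &
    f (s *: v + (s *: u + y)) - f (s *: u + y) - (f (s *: v + y) - f y)
    = s * (s * 'D_v ('D_u f) z).
Proof.
move=> df u1 v1 sr.
have inball (a b : R) : `|a| <= `|s| -> `|b| <= `|s| ->
    ball y r (a *: v + (b *: u + y)).
  move=> as_ bs; rewrite -ball_normE /= addrA opprD addrCA subrr addr0 normrN.
  apply: le_lt_trans sr; apply: le_trans (ler_normD _ _) _.
  by rewrite !normrZ lerD// -[leRHS]mulr1 ler_pM.
have s0 : `|0 : R| <= `|s| by rewrite normr0.
pose g z := f (s *: v + z) - f z.
have dg (t : R) : `|t| <= `|s| ->
    is_derive (t *: u + y) u g
      ('D_u f (s *: v + (t *: u + y)) - 'D_u f (t *: u + y)).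
  move=> ts; apply: is_deriveB.
    by apply: is_derive_translate; exact: (df _ (inball _ _ _ ts)).1.
  apply: derivableP; have := inball 0 t s0 ts.
  by rewrite scale0r add0r => /df[].
have [t ts gE] := @mvt_line g y u s (fun t ts => @ex_derive _ _ _ _ _ _ _ (dg t ts)).
have [t' ts' hE] := @mvt_line ('D_u f) (t *: u + y) v s
   (fun t' ts' => (df _ (inball _ _ ts' ts)).2).
exists (t' *: v + (t *: u + y)); first exact: inball.
by rewrite -hE -(@derive_val _ _ _ _ _ _ _ (dg t ts)) -gE.
Qed.

Lemma delta_norm_le (i : 'I_n) : `|E i| <= 1.
Proof.
apply: norm_row_le => // j; rewrite mxE eqxx /=.
by case: (_ == _); rewrite ?normr1 ?normr0.
Qed.

Lemma sub_swap (a a' b c d x z : R) : a = a' ->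
  a - b - (c - d) = x -> a' - c - (b - d) = z -> x = z.
Proof. by move=> -> <- <-; ring. Qed.

Lemma dist_le_halves (a b c d e : R) :
  `|a - c| < e / 2 -> `|b - d| < e / 2 -> c = d -> `|a - b| <= e.
Proof.
move=> + + cd; rewrite cd !ltr_norml ler_norml => /andP[? ?] /andP[? ?].
by apply/andP; split; lra.
Qed.

(** Both mixed derivatives are limits of the same second difference, which is
    symmetric in the two directions. *)
Lemma schwarz A f y (i j : 'I_n) : open A -> Ck 2 A f -> A y ->
  'D_(E i) ('D_(E j) f) y = 'D_(E j) ('D_(E i) f) y.
Proof.
move=> oA [cf df] Ay.
suff close (e : R) : 0 < e ->
    `|'D_(E i) ('D_(E j) f) y - 'D_(E j) ('D_(E i) f) y| <= e.
  apply/subr0_eq/eqP; rewrite -normr_le0; apply/ler_addgt0Pr => e e0.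
  by rewrite add0r; exact: close.
move=> e0.
have C2 k l z : A z -> derivable f z (E k) /\ derivable ('D_(E k) f) z (E l).
  move=> Az; have [d1 [_ d2]] := df k; split; first exact: d1.
  by have [d3 _] := d2 l; exact: d3.
have c2 k l : {for y, continuous ('D_(E l) ('D_(E k) f))}.
  by have [_ [_ /(_ l)[_ [+ _]]]] := df k; apply.
have e20 : 0 < e / 2 by rewrite divr_gt0.
have nA : \forall z \near y, A z by exact: open_nbhs_nbhs.
have n1 : \forall z \near y, `|'D_(E i) ('D_(E j) f) y - 'D_(E i) ('D_(E j) f) z| < e / 2.
  by have /cvgrPdist_lt/(_ _ e20) := c2 j i.
have n2 : \forall z \near y, `|'D_(E j) ('D_(E i) f) y - 'D_(E j) ('D_(E i) f) z| < e / 2.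
  by have /cvgrPdist_lt/(_ _ e20) := c2 i j.
have /nbhs_ballP[r /= r0 rP] : \forall z \near y, (A z /\
    `|'D_(E i) ('D_(E j) f) y - 'D_(E i) ('D_(E j) f) z| < e / 2) /\
    `|'D_(E j) ('D_(E i) f) y - 'D_(E j) ('D_(E i) f) z| < e / 2.
  exact: filterI (filterI nA n1) n2.
pose s := r / 4.
have s0 : 0 < s by rewrite divr_gt0.
have sr : `|s| + `|s| < r by rewrite gtr0_norm// /s; lra.
have [z1 /rP[[_ z1P] _] E1] := @second_difference f (E j) (E i) y r s
  (fun z bz => C2 j i z (rP z bz).1.1) (delta_norm_le j) (delta_norm_le i) sr.
have [z2 /rP[_ z2P] E2] := @second_difference f (E i) (E j) y r s
  (fun z bz => C2 i j z (rP z bz).1.1) (delta_norm_le i) (delta_norm_le j) sr.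
have : s * (s * 'D_(E i) ('D_(E j) f) z1) = s * (s * 'D_(E j) ('D_(E i) f) z2).
  have swap : s *: E i + (s *: E j + y) = s *: E j + (s *: E i + y) by rewrite addrCA.
  exact: sub_swap (congr1 f swap) E1 E2.
do 2![move/(mulfI (lt0r_neq0 s0))] => z12.
exact: dist_le_halves z1P z2P z12.
Qed.

End Calculus.

Section ChainRule.
Context (R : realType) (n m : nat).
Implicit Types (f : 'rV[R]_m -> R) (Phi : 'rV[R]_n -> 'rV[R]_m).

Lemma derive_comp_coord f Phi y (i : 'I_n) :
  differentiable f (Phi y) ->
  (forall j, differentiable (fun z => Phi z 0 j : R) y) ->
  'D_(delta_mx 0 i) (f \o Phi) y =
  \sum_(j < m) 'D_(delta_mx 0 j) f (Phi y)
     * 'D_(delta_mx 0 i) (fun z => Phi z 0 j) y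
  /\ derivable (f \o Phi) y (delta_mx 0 i).
Proof.
move=> df dPhi.
have PhiE : Phi = \sum_(j < m) (fun z => Phi z 0 j *: (delta_mx 0 j : 'rV[R]_m)).
  by apply/funext => z; rewrite fct_sumE {1}[Phi z]row_sum_delta.
have dP : differentiable Phi y.
  by rewrite PhiE; apply: differentiable_sum => j; exact: differentiableZl.
have dc : differentiable (f \o Phi) y by exact: differentiable_comp.
split; last exact: diff_derivable.
rewrite deriveE// diff_comp//= -[in LHS](@deriveE _ _ _ Phi)//.
rewrite derive_mx; last exact: diff_derivable.
rewrite [X in 'd _ _ X]row_sum_delta linear_sum; apply: eq_bigr => j _.
by rewrite linearZ/= mxE -deriveE// mulrC.
Qed.

(** By induction on k: the chain rule writes the partial derivatives of the composite
    with those of f, composed with Phi, to which the induction hypothesis applies. *)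
Lemma Ck_comp k (A : set 'rV[R]_n) (B : set 'rV[R]_m) f Phi :
  open A -> open B -> (forall y, A y -> B (Phi y)) ->
  (forall j, Cinfty A (fun y => Phi y 0 j)) -> Ck k B f -> Ck k A (f \o Phi).
Proof.
move=> oA oB AB CPhi.
have dPhi y : A y -> forall j, differentiable (fun z => Phi z 0 j : R) y.
  by move=> Ay j; exact: C1_differentiable oA (CPhi j 1%N) Ay.
have cPhi y : A y -> {for y, continuous Phi}.
  move=> Ay; apply: differentiable_continuous.
  rewrite (_ : Phi = \sum_(j < m) (fun z => Phi z 0 j *: (delta_mx 0 j : 'rV[R]_m))).
    by apply: differentiable_sum => j; apply: differentiableZl; exact: dPhi.
  by apply/funext => z; rewrite fct_sumE {1}[Phi z]row_sum_delta.
have cc f' : (forall y, B y -> {for y, continuous f'}) ->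
    forall y, A y -> {for y, continuous (f' \o Phi)}.
  by move=> cf y Ay; apply: continuous_comp; [exact: cPhi|exact/cf/AB].
elim: k f => [|k IH] f Cf; have [cf df] := Cf; first by split=> //; exact: cc.
have dfB z : B z -> differentiable f z.
  by apply: C1_differentiable oB _; exact: Ck_le Cf.
split=> [|i]; first exact: cc.
split=> [y Ay|].
  by have [] := @derive_comp_coord f Phi y i (dfB _ (AB _ Ay)) (dPhi y Ay).
apply: Ck_ext; last first.
- apply: (@Ck_sum R n k A 'I_m (index_enum 'I_m)
     (fun j y => ('D_(delta_mx 0 j) f \o Phi) y
       * 'D_(delta_mx 0 i) (fun z => Phi z 0 j) y)) => // j.
  apply: Ck_mul => //; first by apply: IH; have [] := df j.
  by have [_ /(_ i)[]] := CPhi j k.+1.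
- move=> y Ay /=.
  by have [->] := @derive_comp_coord f Phi y i (dfB _ (AB _ Ay)) (dPhi y Ay).
- by [].
Qed.

End ChainRule.

Section FlatFunctions.
Context (R : realType).

(** The derivative of t^-m exp (-1/t) is a combination of two functions of the same
    kind, so that smoothness is an induction within this family. *)
Definition flatexp (m : nat) (t : R) : R :=
  if 0 < t then t ^- m * expR (- t^-1) else 0.

Lemma flatexp_gt0 m t : 0 < t -> 0 < flatexp m t.
Proof. by move=> t0; rewrite /flatexp t0 mulr_gt0 ?expR_gt0// invr_gt0 exprn_gt0. Qed.

Lemma flatexp_ge0 m t : 0 <= flatexp m t.
Proof.
by case: (ltP 0 t) => t0; [exact/ltW/flatexp_gt0|rewrite /flatexp ltNge t0].
Qed.

Lemma flatexp_le0 m t : t <= 0 -> flatexp m t = 0.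
Proof. by move=> t0; rewrite /flatexp ltNge t0. Qed.

(** The exponential series bounds exp (1/t) from below by (1/t)^(m+1) / (m+1)!.  The
    bound for m+1 is one for the difference quotients of flatexp m at 0. *)
Lemma flatexp_small m t : `|flatexp m t| <= m.+1`!%:R * `|t|.
Proof.
case: (ltP 0 t) => t0; last first.
  by rewrite flatexp_le0// normr0 mulr_ge0.
rewrite ger0_norm ?flatexp_ge0// gtr0_norm// /flatexp t0 expRN.
rewrite ler_pdivrMr ?expR_gt0// mulrAC -ler_pdivrMr//.
have := @expR_ge1Dxn R t^-1 m; rewrite invr_ge0 ltW// => /(_ isT) le_exp.
have : t^-1 ^+ m.+1 / m.+1`!%:R <= expR t^-1 by apply: le_trans le_exp; rewrite lerDr.
by rewrite -exprVn -exprSr mulrC -ler_pdivrMl ?ltr0n ?fact_gt0.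
Qed.

Lemma is_derive_flatexp m (t : R) :
  is_derive t (1 : R) (flatexp m) (flatexp m.+2 t - m%:R * flatexp m.+1 t).
Proof.
have [t0|t0|->] := ltgtP t 0.
- rewrite !flatexp_le0 ?ltW// mulr0 subr0.
  apply: (@near_eq_is_derive _ _ _ (cst 0)).
  all: try exact: is_derive_cst.
  near=> u => /=; rewrite flatexp_le0// ltW//.
  by near: u; exact: lt_nbhsl.
- pose g (u : R) : R := (u^-1) ^+ m * expR (- u^-1).
  apply: (@near_eq_is_derive _ _ _ g).
    near=> u => /=; rewrite /g /flatexp ifT ?exprVn//; near: u; exact: lt_nbhsr.
  have tn0 : t != 0 by rewrite gt_eqF.
  rewrite /flatexp t0.
  have d1 : is_derive t (1 : R) (fun u : R => u^-1) (- t ^- 2).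
    split; first exact: derivableV.
    by rewrite deriveV// derive_id scaler1.
  have d2 : is_derive t (1 : R) (expR \o (fun u : R => - u^-1))
                (expR (- t^-1) * - - t ^- 2) by exact: is_derive1_comp.
  have d3 : is_derive t (1 : R) (fun u : R => u^-1 ^+ m) (- m%:R * t ^- m.+1).
    case: m g => [|m] g.
      by rewrite (_ : (fun _ => _) = cst 1)// mulr0n oppr0 mul0r; exact: is_derive_cst.
    have := is_deriveX m.+1 d1; rewrite exprfctE => d4; apply: is_derive_eq d4 _.
    rewrite /GRing.scale/= exprVn mulrN mulNr; congr (- _).
    by rewrite -mulrA -invfM -exprD addn2.
  have d4 := is_deriveM d3 d2; apply: is_derive_eq d4 _.
  rewrite /GRing.scale/= opprK !exprVn !exprS !invfM expr0 invr1 mulr1.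
  set a := t^-1; set b := t^-m; set c := expR _.
  by ring.
- rewrite !flatexp_le0// mulr0 subr0.
  suff lim0 : (fun h : R => h^-1 *: ((flatexp m \o shift 0) (h *: (1 : R)) - flatexp m 0))
     @ 0^' --> (0 : R).
    by split; [apply/cvg_ex; exists 0|exact: cvg_lim].
  apply/cvgrPdist_lt => e e0; near=> h.
  have h0 : h != 0 by near: h; exact: nbhs_dnbhs_neq.
  rewrite sub0r normrN /= addr0 scaler1 (@flatexp_le0 m 0)// subr0.
  have -> : h^-1 *: flatexp m h = flatexp m.+1 h.
    by rewrite /flatexp; case: ifP => _; rewrite ?scaler0// exprS invfM -mulrA.
  apply: le_lt_trans (flatexp_small _ _) _.
  rewrite -ltr_pdivlMl ?ltr0n ?fact_gt0// mulrC; near: h.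
  by apply: dnbhs0_lt; rewrite divr_gt0// ltr0n fact_gt0.
Unshelve. all: by end_near.
Qed.

Lemma Ck_flatexp n k m (A : set 'rV[R]_n) (f : 'rV[R]_n -> R) :
  open A -> Ck k A f -> Ck k A (fun y => flatexp m (f y)).
Proof.
move=> oA; elim: k m => [|k IH] m Cf; have [cf df] := Cf.
  split=> // y Ay; apply: continuous_comp; first exact: cf.
  by apply/differentiable_continuous/derivable1_diffP; have [] := is_derive_flatexp m (f y).
have cfl (t : R) : differentiable (flatexp m) t.
  by apply/derivable1_diffP; have [] := is_derive_flatexp m t.
split=> [y Ay|i].
  by apply: continuous_comp; [exact: cf|exact: differentiable_continuous].
have dff y : A y -> differentiable f y.
  by move=> Ay; apply: C1_differentiable oA _ Ay; exact: Ck_le Cf.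
have dc y : A y -> differentiable (flatexp m \o f) y.
  by move=> Ay; apply: differentiable_comp => //; exact: dff.
have [dfi kfi] := df i; split=> [y Ay|]; first exact/diff_derivable/dc.
have Cp := Ck_pred Cf.
apply: Ck_ext (Ck_mul oA (Ck_add oA (IH m.+2 Cp)
   (Ck_mul oA (Ck_cst k A (- m%:R)) (IH m.+1 Cp))) kfi) => // y Ay.
rewrite [RHS](deriveE _ (dc y Ay)) diff_comp//=; last exact: dff.
rewrite -[X in _ = 'd _ _ X]mulr1 -/(GRing.scale _ _) linearZ/= -deriveE; last exact: dff.
rewrite -[X in _ = _ *: X]deriveE; last exact: cfl.
have [_ ->] := is_derive_flatexp m (f y).
by rewrite /GRing.scale/= mulrC mulNr.
Qed.

End FlatFunctions.

(** * Smooth functions and partitions of unity *)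

Section SmoothFunctions.
Context (R : realType) (n : nat) (X : manifold R n).
Implicit Types (c d : mchart X) (f g : X -> R) (U V : set X) (x : X).

Lemma mpointK c x : mdom c x -> mpoint c (mcoord c x) = x.
Proof. exact: cmapK. Qed.

Lemma mdom_open c : open (mdom c).
Proof. exact: cdom_open. Qed.

Lemma mpoint_cts c x : mdom c x -> {for mcoord c x, continuous (mpoint c)}.
Proof. by move=> cx; apply: cinv_continuous; exists x. Qed.

Lemma mimg_open c V : open V -> open (mcoord c @` (V `&` mdom c)).
Proof.
move=> oV; rewrite openE => _ [x [Vx cx] <-].
have oVc : open (V `&` mdom c) by exact: openI (mdom_open c).
have nx : nbhs (mpoint c (mcoord c x)) (V `&` mdom c).
  by rewrite mpointK//; exact: open_nbhs_nbhs.
have n1 : nbhs (mcoord c x) (mpoint c @^-1` (V `&` mdom c)) := mpoint_cts cx nx.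
have n2 : nbhs (mcoord c x) (mcoord c @` mdom c).
  by apply: open_nbhs_nbhs; split; [exact: cimg_open|exists x].
rewrite /interior.
apply: filterS (filterI n1 n2) => z [/= zV [x' cx' x'z]].
by exists x' => //; rewrite -x'z mpointK in zV.
Qed.

Lemma near_mpoint c x (P : set X) : mdom c x -> (\forall y \near x, P y) ->
  \forall z \near mcoord c x, P (mpoint c z).
Proof.
move=> cx nP; apply: (mpoint_cts cx); rewrite /= mpointK//.
Qed.

Lemma smooth_sub U V f : V `<=` U -> smooth_on U f -> smooth_on V f.
Proof.
move=> VU Uf c k; apply: Ck_sub (Uf c k).
by move=> _ [x [/VU ? ?] <-]; exists x.
Qed.

Lemma smooth_local U f :
  (forall x, U x -> exists2 V, V x & smooth_on V f) -> smooth_on U f.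
Proof.
move=> H c k; apply: Ck_local => _ [x [/H[V Vx Vf] cx] <-].
by exists (mcoord c @` (V `&` mdom c)); [exists x|exact: Vf].
Qed.

Lemma smooth_ext U f g : open U -> (forall x, U x -> f x = g x) ->
  smooth_on U f -> smooth_on U g.
Proof.
move=> oU fg Uf c k; apply: Ck_ext (Uf c k); first exact: mimg_open.
by move=> _ [x [Ux cx] <-] /=; rewrite mpointK// fg.
Qed.

Lemma smooth_cst U (a : R) : smooth_on U (fun=> a).
Proof. by move=> c k; exact: Ck_cst. Qed.

Lemma smooth_add U f g : open U -> smooth_on U f -> smooth_on U g ->
  smooth_on U (fun x => f x + g x).
Proof. by move=> oU Uf Ug c k; apply: Ck_add; [exact: mimg_open|exact: Uf|exact: Ug]. Qed.

Lemma smooth_mul U f g : open U -> smooth_on U f -> smooth_on U g ->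
  smooth_on U (fun x => f x * g x).
Proof. by move=> oU Uf Ug c k; apply: Ck_mul; [exact: mimg_open|exact: Uf|exact: Ug]. Qed.

Lemma smooth_opp U f : open U -> smooth_on U f -> smooth_on U (fun x => - f x).
Proof.
move=> oU Uf; apply: smooth_ext (smooth_mul oU (smooth_cst U (-1)) Uf) => // x _.
by rewrite mulN1r.
Qed.

Lemma smooth_subr U f g : open U -> smooth_on U f -> smooth_on U g ->
  smooth_on U (fun x => f x - g x).
Proof. by move=> oU Uf Ug; apply: smooth_add => //; exact: smooth_opp. Qed.

Lemma smooth_sum U (I : Type) (r : seq I) (F : I -> X -> R) : open U ->
  (forall i, smooth_on U (F i)) -> smooth_on U (fun x => \sum_(i <- r) F i x).
Proof.
move=> oU UF c k.
by apply: (@Ck_sum _ _ _ _ _ _ (fun i => F i \o mpoint c)) => [|i]; [exact: mimg_open|exact: UF].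
Qed.

Lemma smooth_prod U (I : Type) (r : seq I) (F : I -> X -> R) : open U ->
  (forall i, smooth_on U (F i)) -> smooth_on U (fun x => \prod_(i <- r) F i x).
Proof.
move=> oU UF; elim: r => [|a r IH].
  by under eq_fun do rewrite big_nil; exact: smooth_cst.
by under eq_fun do rewrite big_cons; exact: smooth_mul.
Qed.

Lemma smooth_inv U f : open U -> (forall x, U x -> f x != 0) ->
  smooth_on U f -> smooth_on U (fun x => (f x)^-1).
Proof.
move=> oU f0 Uf c k.
apply: (@Ck_inv _ _ _ _ (f \o mpoint c)); [exact: mimg_open| |exact: Uf].
by move=> _ [x [Ux cx] <-] /=; rewrite mpointK//; exact: f0.
Qed.

Lemma smooth_div U f g : open U -> (forall x, U x -> g x != 0) ->
  smooth_on U f -> smooth_on U g -> smooth_on U (fun x => f x / g x).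
Proof. by move=> oU g0 Uf Ug; apply: smooth_mul => //; exact: smooth_inv. Qed.

Lemma smooth_flatexp U m f : open U -> smooth_on U f ->
  smooth_on U (fun x => flatexp m (f x)).
Proof.
move=> oU Uf c k; apply: (@Ck_flatexp R n k m _ (f \o mpoint c)).
  exact: mimg_open.
exact: Uf.
Qed.

(** Coordinate changes are smooth, so one chart is enough. *)
Lemma smooth_in_chart c V f : open V -> V `<=` mdom c ->
  Cinfty (mcoord c @` (V `&` mdom c)) (f \o mpoint c) -> smooth_on V f.
Proof.
move=> oV Vc Vf d k.
apply: (@Ck_ext _ _ _ _ ((f \o mpoint c) \o (fun y => mcoord c (mpoint d y)))).
- exact: mimg_open.
- by move=> _ [x [Vx dx] <-] /=; rewrite !mpointK//; exact: Vc.
- apply: (@Ck_comp _ _ _ _ _ (mcoord c @` (V `&` mdom c))).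
  + exact: mimg_open.
  + exact: mimg_open.
  + by move=> _ [x [Vx dx] <-] /=; exists x => //=; [split=> //; exact: Vc|rewrite mpointK].
  + move=> j l; apply: Ck_sub (atlas_compatible (proj2_sig d) (proj2_sig c) j l).
    by move=> _ [x [Vx dx] <-]; exists x => //; split=> //; exact: Vc.
  + exact: Vf.
Qed.

Lemma smooth_coord c j : smooth_on (mdom c) (fun x => mcoord c x 0 j).
Proof.
move=> d k; apply: Ck_sub (atlas_compatible (proj2_sig d) (proj2_sig c) j k).
by move=> _ [x [cx dx] <-]; exists x.
Qed.

Lemma smooth_differentiable U f c x : open U -> smooth_on U f -> U x ->
  mdom c x -> differentiable (f \o mpoint c) (mcoord c x).
Proof.
move=> oU Uf Ux cx; apply: C1_differentiable (Uf c 1%N) _.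
  exact: mimg_open.
by exists x.
Qed.

Lemma smooth_derivable U f c i x : open U -> smooth_on U f -> U x ->
  mdom c x -> derivable (f \o mpoint c) (mcoord c x) (delta_mx 0 i).
Proof. by move=> oU Uf Ux cx; apply/diff_derivable/smooth_differentiable; eauto. Qed.

Lemma pd_near c i f g x : mdom c x -> (\forall y \near x, f y = g y) ->
  pd c i f x = pd c i g x.
Proof. by move=> cx fg; apply: near_eq_derive; apply: (near_mpoint cx fg). Qed.

Lemma pd_ext U c i f g x : open U -> U x -> mdom c x ->
  (forall y, U y -> f y = g y) -> pd c i f x = pd c i g x.
Proof.
by move=> oU Ux cx fg; apply: pd_near => //; apply: filterS (open_nbhs_nbhs (conj oU Ux)).
Qed.

Lemma smooth_pd U f c i : open U -> smooth_on U f ->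
  smooth_on (U `&` mdom c) (pd c i f).
Proof.
move=> oU Uf; have oUc : open (U `&` mdom c) by exact: openI (mdom_open c).
apply: (@smooth_in_chart c) => //.
move=> k.
apply: (@Ck_ext _ _ _ _ ('D_(delta_mx 0 i) (f \o mpoint c))).
- exact: mimg_open.
- by move=> _ [x [_ cx] <-]; rewrite /= /pd mpointK.
- have [_ /(_ i)[_]] := Uf c k.+1; apply: Ck_sub.
  by move=> _ [x [[Ux _] cx] <-]; exists x.
Qed.

Section Rules.
Variables (U : set X) (c : mchart X) (i : 'I_n) (x : X).
Hypotheses (oU : open U) (Ux : U x) (cx : mdom c x).

Lemma pd_cst (a : R) : pd c i (fun=> a) x = 0.
Proof. exact: derive_cst. Qed.

Lemma pd_add f g : smooth_on U f -> smooth_on U g ->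
  pd c i (fun y => f y + g y) x = pd c i f x + pd c i g x.
Proof. by move=> Uf Ug; apply: deriveD; apply: (@smooth_derivable U). Qed.

Lemma pd_mul f g : smooth_on U f -> smooth_on U g ->
  pd c i (fun y => f y * g y) x = pd c i f x * g x + f x * pd c i g x.
Proof.
move=> Uf Ug; have df := smooth_derivable (i := i) oU Uf Ux cx.
have dg := smooth_derivable (i := i) oU Ug Ux cx.
rewrite [LHS](deriveM df dg) /= mpointK// addrC; congr (_ + _).
by rewrite [LHS]mulrC.
Qed.

Lemma pd_inv f : smooth_on U f -> f x != 0 ->
  pd c i (fun y => (f y)^-1) x = - pd c i f x / f x ^+ 2.
Proof.
move=> Uf fx; have df := smooth_derivable (i := i) oU Uf Ux cx.
rewrite [LHS](deriveV _ df) /= mpointK// mulNr /GRing.scale/= mulNr.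
by rewrite mulrC.
Qed.

Lemma pd_opp f : smooth_on U f -> pd c i (fun y => - f y) x = - pd c i f x.
Proof. by move=> Uf; apply: deriveN; apply: (@smooth_derivable U). Qed.

Lemma pd_sub f g : smooth_on U f -> smooth_on U g ->
  pd c i (fun y => f y - g y) x = pd c i f x - pd c i g x.
Proof. by move=> Uf Ug; rewrite pd_add ?pd_opp//; exact: smooth_opp. Qed.

Lemma pd_chain d f : mdom d x -> smooth_on U f ->
  pd c i f x = \sum_(j < n) jacobian c d i j x * pd d j f x.
Proof.
move=> dx Uf.
have -> : pd c i f x = 'D_(delta_mx 0 i)
    ((f \o mpoint d) \o (fun y => mcoord d (mpoint c y))) (mcoord c x).
  apply: near_eq_derive.
  have nd : \forall y \near x, mdom d y by apply: open_nbhs_nbhs; split=> //; exact: mdom_open.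
  by apply: filterS (near_mpoint cx nd) => z dz /=; rewrite mpointK.
have [||-> _] := @derive_comp_coord R n n (f \o mpoint d)
  (fun y => mcoord d (mpoint c y)) (mcoord c x) i.
- by rewrite mpointK//; apply: (@smooth_differentiable U).
- move=> j; apply: (@smooth_differentiable (mdom d) (fun y => mcoord d y 0 j)) => //.
    exact: mdom_open.
  exact: smooth_coord.
- by apply: eq_bigr => j _; rewrite mulrC mpointK.
Qed.

Lemma pd_comm j f : smooth_on U f ->
  pd c i (pd c j f) x = pd c j (pd c i f) x.
Proof.
move=> Uf.
have pd2 k l : pd c k (pd c l f) x =
   'D_(delta_mx 0 k) ('D_(delta_mx 0 l) (f \o mpoint c)) (mcoord c x).
  apply: near_eq_derive.
  apply: filterS (open_nbhs_nbhs (conj (mimg_open (c := c) oU) _)).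
    by move=> _ [y [_ cy] <-]; rewrite /= /pd mpointK.
  by exists x.
rewrite !pd2; apply: (@schwarz R n (mcoord c @` (U `&` mdom c))).
- exact: mimg_open.
- exact: Uf.
- by exists x.
Qed.

End Rules.

End SmoothFunctions.

Section Averaging.
Context (R : realType) (n : nat) (X : manifold R n).

(** In a chart around x, phi is a product over the coordinates of flat functions of
    r^2 - (y_i - x_i)^2, and C is the cube of radius r.  The extension by 0 is smooth
    because C is compact, hence closed in the Hausdorff space X. *)
Lemma bump_exists (O : set X) (x : X) : open O -> O x ->
  exists (phi : X -> R) (C : set X),
    [/\ smooth_on setT phi, forall y, 0 <= phi y, 1 < phi x,
        closed C /\ C `<=` O & forall y, ~ C y -> phi y = 0].
Proof.
move=> oO Ox; have [c0 ac cx0] := atlas_cover x.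
pose c : mchart X := exist _ c0 ac; have cx : mdom c x by [].
have oB := mimg_open (c := c) oO.
have [r0 /= r00 r0B] : nbhs_ball (mcoord c x) (mcoord c @` (O `&` mdom c)).
  by apply/nbhs_ballP; apply: open_nbhs_nbhs; split=> //; exists x.
pose r := r0 / 2; have r_gt0 : 0 < r by rewrite divr_gt0.
pose K : set 'rV[R]_n := [set z | `|z - mcoord c x| <= r].
have KB : K `<=` mcoord c @` (O `&` mdom c).
  move=> z Kz; apply: r0B; rewrite -ball_normE /= distrC.
  by apply: le_lt_trans Kz _; rewrite /r; lra.
have cK : compact K.
  apply: bounded_closed_compact.
    exists (r + `|mcoord c x|); split; first exact: num_real.
    move=> M rM z Kz; rewrite -[z](subrK (mcoord c x)).
    apply: le_trans (ler_normD _ _) _; apply: le_trans (ltW rM).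
    by rewrite lerD2r.
  rewrite (_ : K = (fun z => `|z - mcoord c x|) @^-1` [set t | t <= r])//.
  apply: preimage_closed; last exact: closed_le.
  move=> z _; apply: continuous_comp; last exact: norm_continuous.
  by apply: continuousB; [exact: id|exact: cst_continuous].
pose C := mpoint c @` K.
have clC : closed C.
  apply: compact_closed; first exact: mspace_hausdorff.
  apply: continuous_compact cK; apply: continuous_in_subspaceT => z.
  rewrite inE => /KB [y [Oy cy] <-]; exact: mpoint_cts.
have CO : C `<=` O by move=> _ [z /KB [y [Oy cy] <-] <-]; rewrite mpointK.
pose b (y : X) : R := 2 * \prod_(i < n)
  (flatexp 0 (r ^+ 2 - (mcoord c y 0 i - mcoord c x 0 i) ^+ 2) / flatexp 0 (r ^+ 2)).
pose phi (y : X) : R := if `[< mdom c y >] then b y else 0.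
have phi0 y : ~ C y -> phi y = 0.
  move=> nC; rewrite /phi; case: asboolP => // cy.
  have : ~ K (mcoord c y) by move=> Ky; apply: nC; exists (mcoord c y) => //; rewrite mpointK.
  move=> /negP; rewrite -ltNge => rlt.
  have [i ri] : exists i, r < `|mcoord c y 0 i - mcoord c x 0 i|.
    apply: contrapT => /forallNP H; move: rlt; rewrite ltNge => /negP; apply.
    apply: norm_row_le => [|j]; first exact: ltW.
    by rewrite !mxE leNgt; apply/negP; exact: H.
  rewrite /b (bigD1 i)//= flatexp_le0 ?(mul0r, mulr0)// subr_le0.
  by rewrite -[leRHS]real_normK ?num_real// lerXn2r ?nnegrE// ltW.
have sb : smooth_on (mdom c) b.
  have oc := mdom_open c.
  apply: smooth_mul => //; first exact: smooth_cst.
  apply: smooth_prod => // i; apply: smooth_mul => //; last exact: smooth_cst.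
  apply: smooth_flatexp => //; apply: smooth_subr => //; first exact: smooth_cst.
  have sc : smooth_on (mdom c) (fun y => mcoord c y 0 i - mcoord c x 0 i).
    by apply: smooth_subr => //; [exact: smooth_coord|exact: smooth_cst].
  by under eq_fun do rewrite expr2; exact: smooth_mul.
exists phi, C; split=> //.
- apply: smooth_local => y _; have [cy|ncy] := pselect (mdom c y).
    exists (mdom c) => //; apply: smooth_ext sb => [|z cz]; first exact: mdom_open.
    by rewrite /phi asboolT.
  exists (~` C); first by move=> [z /KB [w [Ow cw] <-]]; rewrite mpointK// => wy; apply: ncy; rewrite -wy.
  apply: smooth_ext (@smooth_cst _ _ _ _ 0) => [|z /phi0->//].
  by rewrite openC.
- move=> y; rewrite /phi; case: asboolP => // _; rewrite mulr_ge0// prodr_ge0// => i _.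
  by rewrite divr_ge0// flatexp_ge0.
- rewrite /phi asboolT// /b big1 ?mulr1 ?ltr1n// => i _.
  by rewrite subrr expr0n/= subr0 divff// gt_eqF// flatexp_gt0// exprn_gt0.
Qed.

(** For each member of a countable basis, a bump function exceeding 1 on it is chosen
    whenever one exists; every x lies in such a member, because a bump function at x
    exceeds 1 in a neighbourhood of x. *)
Lemma countable_bumps (J : Type) (O : J -> set X) (j0 : J) :
  (forall a, open (O a)) -> (forall x, exists a, O a x) ->
  exists (phi : nat -> X -> R) (al : nat -> J) (C : nat -> set X),
    (forall m, [/\ smooth_on setT (phi m), forall y, 0 <= phi m y,
        closed (C m) /\ C m `<=` O (al m) & forall y, ~ C m y -> phi m y = 0]) /\
    forall x : X, exists m, \forall y \near x, 1 < phi m y.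
Proof.
move=> oO cO.
pose good (p : (X -> R) * J * set X) :=
  [/\ smooth_on setT p.1.1, forall y, 0 <= p.1.1 y,
      closed p.2 /\ p.2 `<=` O p.1.2 & forall y, ~ p.2 y -> p.1.1 y = 0].
have [Bs cBs [oBs bBs]] := @mspace_second_countable _ _ X.
have /pcard_leP [f] := cBs.
pose base m : set X := xget set0 [set V | Bs V /\ f V = m].
have baseE V : Bs V -> base (f V) = V.
  move=> BV; rewrite /base; case: xgetP => [W _ [BW fW]|/(_ V)]; last by case.
  by apply: (@inj _ _ _ f); rewrite ?inE.
have ex m : exists q, good q /\
    ((exists2 q', good q' & base m `<=` [set y | 1 < q'.1.1 y]) ->
      base m `<=` [set y | 1 < q.1.1 y]).
  have [[q gq bq]|nq] := pselect (exists2 q, good q & base m `<=` [set y | 1 < q.1.1 y]).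
    by exists q.
  exists (fun=> 0, j0, set0); split=> //; split=> //=; last by split=> //; exact: closed0.
  exact: smooth_cst.
have [p pP] := choice ex.
exists (fun m => (p m).1.1), (fun m => (p m).1.2), (fun m => (p m).2).
split=> [m|x]; first exact: (pP m).1.
have [a Oax] := cO x.
have [phi [C [sphi phi_ge0 phix [cC CO] phi0]]] := bump_exists (oO a) Oax.
have gq : good (phi, a, C) by [].
have nx : nbhs x [set y | 1 < phi y].
  have cphi : {for x, continuous phi}.
    have [c0 ac cx0] := atlas_cover x; pose c : mchart X := exist _ c0 ac.
    have cx : mdom c x by [].
    have d := smooth_differentiable (openT : open (setT : set X)) sphi I cx.
    have cc : {for x, continuous ((phi \o mpoint c) \o mcoord c)}.
      apply: continuous_comp; first exact: cmap_continuous.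
      exact: differentiable_continuous d.
    apply: near_continuous cc; apply: filterS (open_nbhs_nbhs (conj (mdom_open c) cx)).
    by move=> y cy /=; rewrite mpointK.
  exact: (cphi _ (lt_nbhsr phix)).
have [V [BV Vx] VS] := bBs x _ nx.
exists (f V); apply: (@filterS _ _ _ V).
  by have := (pP (f V)).2; rewrite baseE//; apply; exists (phi, a, C).
by apply: open_nbhs_nbhs; split=> //; exact: oBs.
Qed.

Lemma sum_trunc (t : nat -> R) a b : (forall m, (a <= m)%N -> t m = 0) ->
  (forall m, (b <= m)%N -> t m = 0) -> \sum_(m < a) t m = \sum_(m < b) t m.
Proof.
wlog ab : a b / (a <= b)%N => [H ta tb|ta tb].
  by case: (leqP a b) => [|/ltnW] ab; [exact: H|apply/esym/H].
rewrite -!(big_mkord xpredT) (big_cat_nat _ ab)//= [X in _ + X]big_nat_cond [X in _ + X]big1 ?addr0//.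
by move=> m /andP[/andP[am _] _]; exact: ta.
Qed.

(** A partition of unity subordinate to a cover, packaged as the operator that
    averages families of functions defined on the members of the cover. *)
Lemma averaging_operator (J : Type) (O : J -> set X) :
  (forall a, open (O a)) -> (forall x, exists a, O a x) ->
  exists S : (J -> X -> R) -> X -> R,
    (forall F V, open V -> (forall a, smooth_on (V `&` O a) (F a)) ->
      smooth_on V (S F)) /\
    (forall x, exists (M : nat) (w : 'I_M -> R) (al : 'I_M -> J),
      [/\ forall m, 0 <= w m, \sum_m w m = 1, forall m, w m != 0 -> O (al m) x &
          forall F, S F x = \sum_m w m * F (al m) x]).
Proof.
move=> oO cO.
have [[x0]|nX] := pselect (inhabited X); last first.
  exists (fun _ _ => 0); split=> [F V oV _|x]; first exact: smooth_cst.
  by exfalso; apply: nX; split.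
have [j0 _] := cO x0.
have [phi [al [C [phiP phi1]]]] := countable_bumps j0 oO cO.
(* Once phi_j exceeds 1 near x, the factor flatexp 0 (1 - phi_j) kills all rho_m with
   j < m there, so the family is locally finite; and rho_m is positive for the first m
   with phi_m at least 1. *)
pose rho m y := phi m y * \prod_(j < m) flatexp 0 (1 - phi j y).
have oT : open (setT : set X) by exact: openT.
have srho m : smooth_on setT (rho m).
  apply: smooth_mul => //; first by have [] := phiP m.
  apply: smooth_prod => // j; apply: smooth_flatexp => //; apply: smooth_subr => //.
    exact: smooth_cst.
  by have [] := phiP j.
have rho_ge0 m y : 0 <= rho m y.
  have [_ p0 _ _] := phiP m.
  by rewrite mulr_ge0// prodr_ge0// => j _; exact: flatexp_ge0.
have rho0 m y : ~ C m y -> rho m y = 0.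
  by move=> nC; have [_ _ _ p0] := phiP m; rewrite /rho p0// mul0r.
have [Mk /= MkP] := choice phi1.
pose M x := (Mk x).+1.
have rhoM x : \forall y \near x, forall m, (M x <= m)%N -> rho m y = 0.
  apply: filterS (MkP x) => y y1 m Mm.
  by rewrite /rho (bigD1 (Ordinal Mm))//= flatexp_le0 ?(mul0r, mulr0)// subr_le0 ltW.
have rhoM0 x m : (M x <= m)%N -> rho m x = 0.
  by have := nbhs_singleton (rhoM x); apply.
pose T y := \sum_(m < M y) rho m y.
have T0 y : 0 < T y.
  have ex1 : exists m, 1 <= phi m y.
    by exists (Mk y); exact/ltW/(nbhs_singleton (MkP y)).
  have [m m1 mmin] := ex_minnP ex1.
  have rm : 0 < rho m y.
    rewrite mulr_gt0//; first exact: lt_le_trans m1.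
    rewrite prodr_gt0// => j _; rewrite flatexp_gt0// subr_gt0 ltNge.
    by apply/negP => /mmin; rewrite leqNgt ltn_ord.
  have mM : (m < M y)%N.
    by rewrite ltnNge; apply/negP => /rhoM0 r0; rewrite r0 ltxx in rm.
  rewrite /T (bigD1 (Ordinal mM))//=; apply: ltr_pwDl => //.
  by apply: sumr_ge0.
have sums (F : nat -> X -> R) (V : set X) : open V ->
    (forall m, smooth_on (V `&` O (al m)) (F m)) ->
    smooth_on V (fun y => \sum_(m < M y) rho m y * F m y).
  move=> oV sF; apply: smooth_local => x Vx.
  pose W := interior [set y | forall m, (M x <= m)%N -> rho m y = 0].
  have oW : open W by exact: open_interior.
  have Wx : W x by exact: rhoM.
  have WP : W `<=` [set y | forall m, (M x <= m)%N -> rho m y = 0].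
    exact: interior_subset.
  exists (V `&` W) => //; have oVW : open (V `&` W) by exact: openI.
  apply: (@smooth_ext _ _ _ _ (fun y => \sum_(m < M x) rho m y * F m y)) => //.
    move=> y [Vy Wy]; apply: (@sum_trunc (fun m => rho m y * F m y)) => m Mm.
      by rewrite (WP y Wy)// mul0r.
    by rewrite rhoM0// mul0r.
  apply: (@smooth_sum _ _ _ _ _ _ (fun (m : 'I_(M x)) y => rho m y * F m y)) => // m.
  have [_ _ [cC CO] _] := phiP m.
  apply: smooth_local => y [Vy Wy]; have [Oy|nOy] := pselect (O (al m) y).
    exists (V `&` O (al m)) => //.
    have oVO : open (V `&` O (al m)) by exact: openI.
    by apply: smooth_mul => //; apply: smooth_sub (srho m).
  exists (~` C m); first by move=> /CO.
  apply: smooth_ext (@smooth_cst _ _ _ _ 0); first by rewrite openC.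
  by move=> z nC; rewrite rho0// mul0r.
exists (fun F y => (\sum_(m < M y) rho m y * F (al m) y) / T y); split=> [F V oV sF|x].
  apply: smooth_div => //; first by move=> y _; rewrite gt_eqF.
    by apply: (sums (fun m => F (al m))) => // m.
  apply: smooth_ext (sums (fun _ _ => 1) V oV _) => //.
    by move=> y _; apply: eq_bigr => m _; rewrite mulr1.
  by move=> m; exact: smooth_cst.
exists (M x), (fun m => rho m x / T x), (fun m => al m); split=> [m||m|F].
- by rewrite divr_ge0// ltW.
- by rewrite -mulr_suml -/(T x) divff// gt_eqF.
- move=> rx; have [_ _ [_ CO] _] := phiP m; apply: CO; apply: contrapT => nC.
  by move: rx; rewrite rho0// mul0r eqxx.
- by rewrite mulr_suml; apply: eq_bigr => m _; rewrite mulrAC.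
Qed.

End Averaging.

(** * 1-forms and the splitting of cocycles *)

Section Forms.
Context (R : realType) (n : nat) (X : manifold R n).
Implicit Types (c d : mchart X) (f g : X -> R) (U V : set X) (x : X).
Implicit Types (v w : form1 X).

Definition add_form1 v w : form1 X := fun c i x => v c i x + w c i x.
Definition scale_form1 (a : R) w : form1 X := fun c i x => a * w c i x.
Definition dlog g : form1 X := fun c i x => pd c i g x / g x.

Lemma is_form1_sub U V w : V `<=` U -> is_form1 U w -> is_form1 V w.
Proof.
move=> VU [sw tw]; split=> [c i|c d i x /VU]; last exact: tw.
by apply: smooth_sub (sw c i) => x [/VU].
Qed.

Lemma is_form1_ext U v w : open U -> eq_form1 U v w -> is_form1 U v -> is_form1 U w.
Proof.
move=> oU vw [sv tv]; split=> [c i|c d i x Ux cx dx].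
  apply: smooth_ext (sv c i); first exact: openI (mdom_open c).
  by move=> x [Ux cx]; exact: vw.
rewrite -vw// (tv c d)//; apply: eq_bigr => j _; by rewrite vw.
Qed.

Lemma is_form1_local U w : (forall x, U x -> exists2 V, V x & is_form1 V w) ->
  is_form1 U w.
Proof.
move=> H; split=> [c i|c d i x Ux cx dx].
  apply: smooth_local => x [Ux cx]; have [V Vx [sV _]] := H x Ux.
  by exists (V `&` mdom c).
by have [V Vx [_ tV]] := H x Ux; exact: tV.
Qed.

Lemma is_form1_add U v w : open U -> is_form1 U v -> is_form1 U w ->
  is_form1 U (add_form1 v w).
Proof.
move=> oU [sv tv] [sw tw]; split=> [c i|c d i x Ux cx dx].
  by apply: smooth_add; [exact: openI (mdom_open c)|exact: sv|exact: sw].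
rewrite /add_form1 (tv c d)// (tw c d)// -big_split/=.
by apply: eq_bigr => j _; rewrite mulrDr.
Qed.

Lemma is_form1_scale U a w : open U -> is_form1 U w -> is_form1 U (scale_form1 a w).
Proof.
move=> oU [sw tw]; split=> [c i|c d i x Ux cx dx].
  by apply: smooth_mul; [exact: openI (mdom_open c)|exact: smooth_cst|exact: sw].
rewrite /scale_form1 (tw c d)// mulr_sumr.
by apply: eq_bigr => j _; rewrite mulrCA.
Qed.

Lemma is_form1_dlog U g : open U -> smooth_unit U g -> is_form1 U (dlog g).
Proof.
move=> oU [sg g0]; split=> [c i|c d i x Ux cx dx].
  have oUc : open (U `&` mdom c) by exact: openI (mdom_open c).
  apply: smooth_div => //; first by move=> x [/g0].
    exact: smooth_pd.
  by apply: smooth_sub sg => x [].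
rewrite /dlog (pd_chain i oU Ux cx dx sg) mulr_suml.
by apply: eq_bigr => j _; rewrite mulrA.
Qed.

Section Dlog.
Variables (U : set X) (c : mchart X) (i : 'I_n) (x : X).
Hypotheses (oU : open U) (Ux : U x) (cx : mdom c x).

Lemma dlog_mul f g : smooth_on U f -> smooth_on U g -> f x != 0 -> g x != 0 ->
  dlog (fun y => f y * g y) c i x = dlog f c i x + dlog g c i x.
Proof.
move=> Uf Ug fx gx; rewrite /dlog (pd_mul i oU)//; field.
by rewrite fx gx.
Qed.

Lemma dlog_inv f : smooth_on U f -> f x != 0 ->
  dlog (fun y => (f y)^-1) c i x = - dlog f c i x.
Proof. by move=> Uf fx; rewrite /dlog (pd_inv i oU)//; field. Qed.

Lemma dlog_ext f g : (forall y, U y -> f y = g y) -> dlog f c i x = dlog g c i x.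
Proof. by move=> fg; rewrite /dlog (pd_ext i oU Ux cx fg) fg. Qed.

Lemma ext_d_ext v w j : eq_form1 U v w -> ext_d v c i j x = ext_d w c i j x.
Proof.
move=> vw; have oUc : open (U `&` mdom c) by exact: openI (mdom_open c).
by congr (_ - _); apply: (pd_ext _ oUc) => // y [Uy cy]; exact: vw.
Qed.

Lemma ext_d_add v w j : is_form1 U v -> is_form1 U w ->
  ext_d (add_form1 v w) c i j x = ext_d v c i j x + ext_d w c i j x.
Proof.
move=> [sv _] [sw _]; have oUc : open (U `&` mdom c) by exact: openI (mdom_open c).
have Ucx : (U `&` mdom c) x by [].
by rewrite /ext_d /add_form1 !(pd_add _ oUc)//; ring.
Qed.

Lemma ext_d_scale a w j : is_form1 U w ->
  ext_d (scale_form1 a w) c i j x = a * ext_d w c i j x.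
Proof.
move=> [sw _]; have oUc : open (U `&` mdom c) by exact: openI (mdom_open c).
have Ucx : (U `&` mdom c) x by [].
rewrite /ext_d /scale_form1 !(pd_mul _ oUc)//; try exact: smooth_cst.
by rewrite !pd_cst//; ring.
Qed.

Lemma ext_d_sub v w j : is_form1 U v -> is_form1 U w ->
  ext_d (sub_form1 v w) c i j x = ext_d v c i j x - ext_d w c i j x.
Proof.
move=> [sv _] [sw _]; have oUc : open (U `&` mdom c) by exact: openI (mdom_open c).
have Ucx : (U `&` mdom c) x by [].
by rewrite /ext_d /sub_form1 !(pd_sub _ oUc)//; ring.
Qed.

(** Second derivatives commute. *)
Lemma ext_d_dlog g j : smooth_unit U g -> ext_d (dlog g) c i j x = 0.
Proof.
move=> [sg g0]; have oUc : open (U `&` mdom c) by exact: openI (mdom_open c).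
have Ucx : (U `&` mdom c) x by [].
have sgc : smooth_on (U `&` mdom c) g by apply: smooth_sub sg => ? [].
have sV : smooth_on (U `&` mdom c) (fun y => (g y)^-1).
  by apply: smooth_inv => // y [/g0].
rewrite /ext_d /dlog !(pd_mul _ oUc)//; try exact: smooth_pd.
rewrite !(pd_inv _ oUc)//; try exact: g0.
by rewrite (pd_comm i oU Ux cx j sg); ring.
Qed.

End Dlog.

Lemma is_form1_sub_form U v w : open U -> is_form1 U v -> is_form1 U w ->
  is_form1 U (sub_form1 v w).
Proof.
move=> oU fv fw.
apply: is_form1_ext (is_form1_add oU fv (is_form1_scale (-1) oU fw)) => // c i x _ _.
by rewrite /add_form1 /scale_form1 mulN1r.
Qed.

Section Splitting.
Variables (J : Type) (O : J -> set X).
Hypotheses (oO : forall a, open (O a)) (cO : forall x, exists a, O a x).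

(** m_a is the average of the H_ab over b, which is nonzero because averages of
    positive numbers are positive.  For a cocycle with signs this would fail. *)
Lemma split_positive_cocycle (H : J -> J -> X -> R) :
  (forall a b, smooth_on (O a `&` O b) (H a b)) ->
  (forall a b x, O a x -> O b x -> 0 < H a b x) ->
  (forall a b e x, O a x -> O b x -> O e x -> H a e x = H a b x * H b e x) ->
  exists m : J -> X -> R,
    [/\ forall a, smooth_on (O a) (m a), forall a x, O a x -> 0 < m a x &
        forall a b x, O a x -> O b x -> m a x = H a b x * m b x].
Proof.
move=> sH H0 HH; have [S [sS SE]] := averaging_operator oO cO.
exists (fun a => S (H a)); split=> [a|a x Oax|a b x Oax Obx].
- by apply: sS.
- have [M [w [al [w0 w1 wO ->]]]] := SE x.
  have t0 m : 0 <= w m * H a (al m) x.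
    have [->|wm] := eqVneq (w m) 0; first by rewrite mul0r.
    by rewrite mulr_ge0// ltW// H0//; exact: wO.
  rewrite lt_neqAle sumr_ge0// andbT eq_sym; apply/negP.
  rewrite psumr_eq0// => /allP all0.
  have /eqP := w1; rewrite big1 ?(eq_sym 0) ?oner_eq0// => m _.
  apply/eqP/negPn/negP => wm; have := all0 m (mem_index_enum m).
  by rewrite mulf_eq0 (negbTE wm)/= gt_eqF// H0//; exact: wO.
- have [M [w [al [w0 w1 wO SEx]]]] := SE x.
  rewrite !SEx mulr_sumr; apply: eq_bigr => m _.
  have [->|wm] := eqVneq (w m) 0; first by rewrite !mul0r mulr0.
  by rewrite (HH a b)//; [ring|exact: wO].
Qed.

(** B_a is the average of the A_ab over b.  Averaging commutes with changes of chart,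
    the Jacobians being independent of b. *)
Lemma split_form1_cocycle (A : J -> J -> form1 X) :
  (forall a b, is_form1 (O a `&` O b) (A a b)) ->
  (forall a b e c i x, O a x -> O b x -> O e x -> mdom c x ->
     A a e c i x = A a b c i x + A b e c i x) ->
  exists B : J -> form1 X,
    (forall a, is_form1 (O a) (B a)) /\
    forall a b c i x, O a x -> O b x -> mdom c x ->
      B a c i x = A a b c i x + B b c i x.
Proof.
move=> fA AA; have [S [sS SE]] := averaging_operator oO cO.
exists (fun a c i => S (fun b => A a b c i)); split=> [a|a b c i x Oax Obx cx].
  split=> [c i|c d i x Oax cx dx].
    apply: sS; first exact: openI (mdom_open c).
    by move=> b; have [+ _] := fA a b; move=> /(_ c i); rewrite setIAC.
  have [M [w [al [w0 w1 wO SEx]]]] := SE x.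
  under [RHS]eq_bigr do rewrite SEx mulr_sumr.
  rewrite SEx exchange_big/=; apply: eq_bigr => m _.
  have [->|wm] := eqVneq (w m) 0.
    by rewrite mul0r big1// => j _; rewrite mul0r mulr0.
  have [_ /(_ c d i x)->//] := fA a (al m); last by split=> //; exact: wO.
  by rewrite mulr_sumr; apply: eq_bigr => j _; rewrite mulrCA.
have [M [w [al [w0 w1 wO SEx]]]] := SE x.
rewrite !SEx -[A a b c i x]mul1r -w1 mulr_suml -big_split/=; apply: eq_bigr => m _.
have [->|wm] := eqVneq (w m) 0; first by rewrite !mul0r addr0.
by rewrite (AA a b)//; [ring|exact: wO].
Qed.

End Splitting.
End Forms.

(** * Linear algebra of lines *)

Section Lines.
Context (R : realType).
Implicit Types (L M : vectType R).

Definition line L := \dim {:L} = 1%N.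

(** The vector dual to e when L is a line. *)
Definition dvec L (e : L) : dualv L := linfun (coord [tuple e] ord0).

Lemma dvec_self L (e : L) : e != 0 -> dvec e e = 1.
Proof.
move=> e0; rewrite lfunE /= -[X in coord _ _ X]/([tuple e]`_(ord0 : 'I_1)).
by rewrite coord_free ?eqxx// seq1_free.
Qed.

Lemma dvecZ L (e : L) a v : dvec e (a *: v) = a * dvec e v.
Proof. by rewrite linearZ. Qed.

Lemma dvecD L (e : L) u v : dvec e (u + v) = dvec e u + dvec e v.
Proof. by rewrite linearD. Qed.

Lemma line_coef L (e v : L) : line L -> e != 0 -> v = dvec e v *: e.
Proof.
move=> dL e0; have : v \in <<[tuple e]>>%VS.
  have -> : <<[tuple e]>>%VS = fullv.
    apply/eqP; rewrite eqEdim subvf/= dL span_seq1 dim_vline.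
    by case: (e =P 0) e0.
  exact: memvf.
by move=> /coord_span {1}->; rewrite big_ord1 lfunE.
Qed.

Lemma dvec_neq0 L (e v : L) : line L -> e != 0 -> v != 0 -> dvec e v != 0.
Proof.
by move=> dL e0; apply: contraNneq => v0; rewrite (line_coef v dL e0) v0 scale0r.
Qed.

Lemma dvecZZ L (e : L) a : e != 0 -> dvec e (a *: e) = a.
Proof. by move=> e0; rewrite dvecZ dvec_self// mulr1. Qed.

Lemma scale_line_inj L (e : L) a b : e != 0 -> a *: e = b *: e -> a = b.
Proof. by move=> e0 /(congr1 (dvec e)); rewrite !dvecZZ. Qed.

Lemma line_dual L : line L -> line (dualv L).
Proof.
rewrite /line !dimvf => d.
by have -> : dim (dualv L) = (dim L * 1)%N by []; rewrite d.
Qed.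

Lemma line_tens L M : line L -> line M -> line (tensv L M).
Proof.
rewrite /line !dimvf => d d'.
by have -> : dim (tensv L M) = (dim M * 1 * dim L)%N by []; rewrite d d'.
Qed.

Lemma linfun_linear L M (f : L -> M) : linear f -> linfun f =1 f.
Proof.
move=> f_lin v; pose fb := GRing.isLinear.Build _ _ _ _ f f_lin.
pose fl : {linear L -> M} := HB.pack f fb.
by rewrite -[X in linfun X]/(fl : _ -> _) lfunE.
Qed.

Lemma tensE L M (a : L) (b : M) (mu : dualv M) : tens a b mu = (mu b : R) *: a.
Proof.
rewrite /tens linfun_linear// => k u v.
by rewrite add_lfunE scale_lfunE scalerDl scalerA.
Qed.

Lemma evalvE M (b : M) (mu : dualv M) : evalv b mu = mu b.
Proof.
by rewrite /evalv linfun_linear// => k u v; rewrite add_lfunE scale_lfunE.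
Qed.

Lemma tensZl L M k (a : L) (b : M) : tens (k *: a) b = k *: tens a b.
Proof. by apply/lfunP => mu; rewrite scale_lfunE !tensE !scalerA mulrC. Qed.

Lemma tensZr L M k (a : L) (b : M) : tens a (k *: b) = k *: tens a b.
Proof. by apply/lfunP => mu; rewrite scale_lfunE !tensE scalerA linearZ. Qed.

Lemma tens_neq0 L M (a : L) (b : M) : a != 0 -> b != 0 -> tens a b != 0.
Proof.
move=> a0 b0; apply: contraNneq a0 => ab0.
by have := tensE a b (dvec b); rewrite ab0 lfunE/= dvec_self// scale1r => <-.
Qed.

Lemma contractvE L M (a : L) (mu : dualv M) (b : M) :
  contractv (tens a mu) b = (mu b : R) *: a.
Proof. by rewrite /contractv tensE evalvE. Qed.

Lemma contractvZ L M k (u : tensv L (dualv M)) (b : M) :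
  contractv (k *: u) b = k *: contractv u b.
Proof. by rewrite /contractv scale_lfunE. Qed.

Lemma contractvZr L M k (u : tensv L (dualv M)) (b : M) :
  contractv u (k *: b) = k *: contractv u b.
Proof.
rewrite /contractv; have -> : evalv (k *: b) = k *: evalv b; last by rewrite linearZ.
by apply/lfunP => mu; rewrite scale_lfunE !evalvE linearZ.
Qed.

Lemma line_hom_bijective L M (f : 'Hom(L, M)) (e : L) :
  line L -> line M -> e != 0 -> f e != 0 -> bijective f.
Proof.
move=> dL dM e0 fe0; exists (fun w => dvec (f e) w *: e) => [v|w].
  by rewrite {1}(line_coef v dL e0) linearZ/= dvecZZ// -line_coef.
by rewrite linearZ/= -line_coef.
Qed.

Lemma hom_inj_neq0 L M (f : 'Hom(L, M)) (e : L) :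
  bijective f -> e != 0 -> f e != 0.
Proof.
move=> [g fK _]; apply: contraNneq => fe.
by rewrite -(fK e) fe -(linear0 f) fK.
Qed.

Lemma dvec_hom L M (f : 'Hom(L, M)) (e v : L) : line L -> e != 0 -> f e != 0 ->
  dvec (f e) (f v) = dvec e v.
Proof. by move=> dL e0 fe0; rewrite {1}(line_coef v dL e0) linearZ/= dvecZZ. Qed.

Lemma dvec_dual L (e : L) (mu : dualv L) : line L -> e != 0 -> mu = mu e *: dvec e.
Proof.
move=> dL e0; apply/lfunP => v; rewrite scale_lfunE {1}(line_coef v dL e0) linearZ/=.
by rewrite /GRing.scale/= mulrC.
Qed.

Lemma dvec_unique L (e : L) (mu : dualv L) : line L -> e != 0 -> mu e = 1 ->
  mu = dvec e.
Proof. by move=> dL e0 mue; rewrite (dvec_dual mu dL e0) mue scale1r. Qed.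

Lemma dvecV L (e : L) a : line L -> e != 0 -> a != 0 ->
  dvec (a *: e) = a^-1 *: dvec e.
Proof.
move=> dL e0 a0; apply/esym/dvec_unique => //; first by rewrite scaler_eq0 negb_or a0.
by rewrite scale_lfunE dvecZZ// /GRing.scale/= mulVf.
Qed.

Lemma dvec_vec_neq0 L (e : L) : e != 0 -> dvec e != 0.
Proof.
move=> e0; apply/negP => /eqP d0; have := dvec_self e0.
by rewrite d0 lfunE/= => /eqP; rewrite eq_sym oner_eq0.
Qed.

Lemma line_vpick L : line L -> vpick {:L} != 0.
Proof. by move=> dL; rewrite vpick0 -dimv_eq0 dL. Qed.

End Lines.

(** * Line bundles and their local frames *)

Section Bundles.
Context (R : realType) (n : nat) (X : manifold R n).
Implicit Types (U V O : set X) (x : X) (l m : lbundle X).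

Definition coefs l (e s : Defs.section l) : X -> R := fun x => dvec (e x) (s x).

(** A frame is a nowhere vanishing smooth section; the frames that define the smooth
    structure of l are only some of them. *)
Definition frame_on l O (e : Defs.section l) :=
  [/\ open O, smooth_section O e & forall x, O x -> e x != 0].

Lemma smooth_section_ext l V (s t : Defs.section l) :
  (forall x, V x -> s x = t x) -> smooth_section V s -> smooth_section V t.
Proof.
move=> st ss W e We; have [f [sf sE]] := ss W e We; exists f; split=> // x Vx Wx.
by rewrite -st// sE.
Qed.

Lemma smooth_section_sub l U V (s : Defs.section l) : V `<=` U ->
  smooth_section U s -> smooth_section V s.
Proof.
move=> VU ss W e We; have [f [sf sE]] := ss W e We; exists f; split=> [|x /VU Ux Wx].
  by apply: smooth_sub sf => x [/VU].
exact: sE.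
Qed.

Section OneBundle.
Variables (U : set X) (l : lbundle X).
Hypotheses (oU : open U) (bl : is_lbundle U l).

Lemma bundle_line x : U x -> line (l x).
Proof. by have [H _ _ _] := bl; exact: H. Qed.

Lemma coefsE (e s : Defs.section l) x : U x -> e x != 0 -> s x = coefs e s x *: e x.
Proof. by move=> Ux ex; apply: line_coef => //; exact: bundle_line. Qed.

Lemma frames_frame_on W (e : Defs.section l) : frames_of l (W, e) -> frame_on (U `&` W) e.
Proof.
move=> We; have [_ /(_ W e We)[oW e0] _ tr] := bl; split.
- exact: openI.
- move=> W' e' We'; have [g [sg eE]] := tr _ _ _ _ We' We; exists g; split.
    by rewrite setIAC.
  by move=> x [Ux Wx] W'x; exact: eE.
- by move=> x [Ux Wx]; exact: e0.
Qed.

Lemma local_frame x : U x -> exists O (e : Defs.section l), [/\ frame_on O e, O x & O `<=` U].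
Proof.
move=> Ux; have [_ _ /(_ x Ux)[W [e [We Wx]]] _] := bl.
by exists (U `&` W), e; split=> //; exact: frames_frame_on.

Qed.

Lemma coefs_smooth O V (e s : Defs.section l) : frame_on O e -> O `<=` U ->
  open V -> V `<=` O -> smooth_section V s -> smooth_on V (coefs e s).
Proof.
move=> [oO se e0] OU oV VO ss; apply: smooth_local => x Vx.
have [_ nf cov _] := bl; have [W [f [Wf Wx]]] := cov x (OU _ (VO _ Vx)).
have [oW f0] := nf _ _ Wf.
have [a [sa aE]] := se W f Wf; have [b [sb bE]] := ss W f Wf.
have oVW : open (V `&` W) by exact: openI.
exists (V `&` W) => //.
have a0 y : (V `&` W) y -> a y != 0.
  move=> [/VO Oy Wy]; apply: contraNneq (e0 y Oy) => ay.
  by rewrite aE// ay scale0r.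
apply: (@smooth_ext _ _ _ _ (fun y => b y / a y)) => //.
  move=> y [Vy Wy]; have a0y := a0 y (conj Vy Wy).
  rewrite /coefs bE// aE//; last exact: VO.
  have Uy : U y by exact/OU/VO.
  rewrite dvecV//; [|exact: bundle_line|exact: f0].
  by rewrite scale_lfunE dvecZZ ?f0// mulrC.
apply: smooth_div => //.
by apply: smooth_sub sa => y [/VO].
Qed.

Lemma coefs_smoothI O V (e s : Defs.section l) : frame_on O e -> O `<=` U ->
  open V -> smooth_section V s -> smooth_on (V `&` O) (coefs e s).
Proof.
move=> fe OU oV ss; have [oO _ _] := fe.
apply: (coefs_smooth fe OU) => //; first exact: openI.
by apply: smooth_section_sub ss => x [].
Qed.

Lemma section_of_coef O V (e : Defs.section l) a : frame_on O e ->
  open V -> V `<=` O -> O `<=` U -> smooth_on V a ->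
  smooth_section V (fun x => a x *: e x).
Proof.
move=> [oO se e0] oV VO OU sa W f Wf; have [b [sb bE]] := se W f Wf.
have [_ /(_ W f Wf)[oW _] _ _] := bl.
exists (fun x => a x * b x); split=> [|x Vx Wx].
  apply: smooth_mul; first exact: openI.
    by apply: smooth_sub sa => x [].
  by apply: smooth_sub sb => x [/VO].
by rewrite bE//; [rewrite scalerA|exact: VO].
Qed.

Lemma smooth_section_local V (s : Defs.section l) : open V -> V `<=` U ->
  (forall x, V x -> exists V', [/\ V' x, open V' & smooth_section V' s]) ->
  smooth_section V s.
Proof.
move=> oV VU H W f Wf; have [_ /(_ W f Wf)[oW f0] _ _] := bl.
exists (coefs f s); split=> [|x Vx Wx]; last first.
  by apply: coefsE; [exact: VU|exact: f0 (VU _ Vx) Wx].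
apply: smooth_local => x [Vx Wx]; have [V' [V'x oV' sV']] := H x Vx.
have [a [sa aE]] := sV' W f Wf.
have oVV : open (V `&` (V' `&` W)) by do 2!apply: openI => //.
exists (V `&` (V' `&` W)) => //.
apply: (@smooth_ext _ _ _ _ a) => //.
  move=> y [Vy [V'y Wy]]; rewrite /coefs aE// dvecZZ//; exact: f0 (VU _ Vy) Wy.
by apply: smooth_sub sa => y [].
Qed.

Lemma frame_sub O O' (e : Defs.section l) : open O' -> O' `<=` O ->
  frame_on O e -> frame_on O' e.
Proof.
by move=> oO' OO [oO se e0]; split=> // [|x /OO]; [exact: smooth_section_sub se|exact: e0].
Qed.

Lemma frame_scale O (e : Defs.section l) a : frame_on O e -> O `<=` U ->
  smooth_unit O a -> frame_on O (fun x => a x *: e x).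
Proof.
move=> fe OU [sa a0]; have [oO se e0] := fe; split=> // [|x Ox].
  exact: section_of_coef fe oO _ OU sa.
by rewrite scaler_eq0 negb_or a0// e0.
Qed.

Lemma coefs_unit O (e e' : Defs.section l) : frame_on O e -> frame_on O e' ->
  O `<=` U -> smooth_unit O (coefs e e').
Proof.
move=> fe fe' OU; have [oO se e0] := fe; have [_ se' e0'] := fe'; split.
  exact: coefs_smooth fe OU oO _ se'.
by move=> x Ox; apply: dvec_neq0; [exact/bundle_line/OU|exact: e0|exact: e0'].
Qed.

Lemma frameI O O' (e : Defs.section l) : open O' -> frame_on O e -> frame_on (O `&` O') e.
Proof.
move=> oO' fe; have [oO _ _] := fe.
by apply: frame_sub fe => [|x []//]; exact: openI.
Qed.

End OneBundle.

Lemma is_lbundle_sub U V l : V `<=` U -> is_lbundle U l -> is_lbundle V l.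
Proof.
move=> VU [d nf cov tr]; split.
- by move=> x /VU/d.
- by move=> W e We; have [oW e0] := nf W e We; split=> // x /VU; exact: e0.
- by move=> x /VU/cov.
- move=> W e W' e' We We'; have [g [sg gE]] := tr _ _ _ _ We We'.
  exists g; split=> [|x /VU]; last exact: gE.
  by apply: smooth_sub sg => x [[/VU]].
Qed.

Lemma tensb_lbundle U l m : open U -> is_lbundle U l -> is_lbundle U m ->
  is_lbundle U (tensb l m).
Proof.
move=> oU bl bm; have [dl nl cl tl] := bl; have [dm nm cm tm] := bm; split.
- by move=> x Ux; apply: line_tens; [exact: dl|exact: dm].
- move=> W e [W1 [e1 [W2 [e2 [F1 F2 [-> ->]]]]]].
  have [oW1 e10] := nl _ _ F1; have [oW2 e20] := nm _ _ F2.
  split; first exact: openI.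
  by move=> x Ux [W1x W2x]; apply: tens_neq0; [exact: e10|exact: e20].
- move=> x Ux; have [W1 [e1 [F1 W1x]]] := cl x Ux; have [W2 [e2 [F2 W2x]]] := cm x Ux.
  exists (W1 `&` W2), (fun y => tens (e1 y) (e2 y)); split=> //.
  by exists W1, e1, W2, e2.
- move=> W e W' e' [W1 [e1 [W2 [e2 [F1 F2 [-> ->]]]]]].
  move=> [W1' [e1' [W2' [e2' [F1' F2' [-> ->]]]]]].
  have [g1 [sg1 g1E]] := tl _ _ _ _ F1 F1'; have [g2 [sg2 g2E]] := tm _ _ _ _ F2 F2'.
  have [oW1 _] := nl _ _ F1; have [oW2 _] := nm _ _ F2.
  have [oW1' _] := nl _ _ F1'; have [oW2' _] := nm _ _ F2'.
  exists (fun x => g1 x * g2 x); split; last first.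
    move=> x Ux [W1x W2x] [W1'x W2'x]; rewrite g1E// g2E//.
    by rewrite tensZl tensZr scalerA.
  apply: smooth_mul.
  + by do ?[exact: openI|apply: openI].
  + by apply: smooth_sub sg1 => x [[Ux [? ?]] [? ?]].
  + by apply: smooth_sub sg2 => x [[Ux [? ?]] [? ?]].
Qed.

Lemma dualb_frame l W (p : Defs.section (dualb l)) U : is_lbundle U l ->
  frames_of (dualb l) (W, p) ->
  exists2 e, frames_of l (W, e) & forall x, U x -> W x -> p x = dvec (e x).
Proof.
move=> bl [/= e We pe]; exists e => // x Ux Wx.
have [_ /(_ W e We)[_ e0] _ _] := bl.
by apply: dvec_unique; [exact: (bundle_line bl Ux)|exact: e0|apply: pe => //; exact: e0].
Qed.

Lemma dualb_lbundle U l : open U -> is_lbundle U l -> is_lbundle U (dualb l).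
Proof.
move=> oU bl; have [dl nl cl tl] := bl; split.
- by move=> x Ux; apply: line_dual; exact: dl.
- move=> W p /(dualb_frame bl)[e We pE]; have [oW e0] := nl _ _ We; split=> // x Ux Wx.
  by rewrite pE//; apply: dvec_vec_neq0; exact: e0.
- move=> x Ux; have [W [e [We Wx]]] := cl x Ux.
  exists W, (fun y => dvec (e y)); split=> //; exists e => // y Wy; exact: dvec_self.
- move=> W p W' p' /(dualb_frame bl)[e We pE] /(dualb_frame bl)[e' We' pE'].
  have [g [sg gE]] := tl _ _ _ _ We' We.
  have [oW e0] := nl _ _ We; have [oW' e0'] := nl _ _ We'.
  exists g; split; first by rewrite setIAC.
  move=> x Ux Wx W'x; rewrite pE// pE'// gE//.
  have g0 : g x != 0.
    by apply: contraNneq (e0 x Ux Wx) => gx; rewrite gE// gx scale0r.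
  rewrite dvecV//; [|exact: dl|exact: e0'].
  by rewrite scalerA mulfV// scale1r.
Qed.

Lemma smooth_section_tens l m V (s : Defs.section l) (t : Defs.section m) :
  open V -> smooth_section V s -> smooth_section V t ->
  (forall W e, frames_of l (W, e) -> open W) ->
  (forall W e, frames_of m (W, e) -> open W) ->
  smooth_section (l := tensb l m) V (fun x => tens (s x) (t x)).
Proof.
move=> oV ss st ol om W e [W1 [e1 [W2 [e2 [F1 F2 [-> ->]]]]]].
have [a [sa aE]] := ss _ _ F1; have [b [sb bE]] := st _ _ F2.
exists (fun x => a x * b x); split; last first.
  by move=> x Vx [W1x W2x]; rewrite aE// bE// tensZl tensZr scalerA.
apply: smooth_mul.
- by do 2?[apply: openI => //]; [exact: ol F1|exact: om F2].
- by apply: smooth_sub sa => x [? []].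
- by apply: smooth_sub sb => x [? []].
Qed.

Section TensDual.
Variables (U : set X) (l m : lbundle X).
Hypotheses (oU : open U) (bl : is_lbundle U l) (bm : is_lbundle U m).

Lemma frame_tens O (e : Defs.section l) (f : Defs.section m) :
  frame_on O e -> frame_on O f ->
  frame_on (l := tensb l m) O (fun x => tens (e x) (f x)).
Proof.
move=> [oO se e0] [_ sf f0]; split=> // [|x Ox]; last first.
  by apply: tens_neq0; [exact: e0|exact: f0].
have [_ nl _ _] := bl; have [_ nm _ _] := bm.
by apply: smooth_section_tens => // W g => [/nl|/nm] [].
Qed.

Lemma frame_dual O (e : Defs.section l) : frame_on O e -> O `<=` U ->
  frame_on (l := dualb l) O (fun x => dvec (e x)).
Proof.
move=> fe OU; have [oO se e0] := fe; split=> // [|x Ox]; last first.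
  by apply: dvec_vec_neq0; exact: e0.
move=> W p /(dualb_frame bl)[f Wf pE]; have [a [sa aE]] := se W f Wf.
have [_ /(_ W f Wf)[oW f0] _ _] := bl.
have a0 x : O x -> W x -> a x != 0.
  by move=> Ox Wx; apply: contraNneq (e0 x Ox) => ax; rewrite aE// ax scale0r.
exists (fun x => (a x)^-1); split.
  by apply: smooth_inv => //; [exact: openI|move=> x [Ox Wx]; exact: a0].
move=> x Ox Wx; have Ux := OU _ Ox.
rewrite pE// aE// dvecV//; [exact: (bundle_line bl Ux)|exact: f0|exact: a0].
Qed.

Lemma frame_iso O (e : Defs.section l) (phi : bundle_map l m) :
  frame_on O e -> O `<=` U -> is_bundle_iso U phi ->
  frame_on O (fun x => phi x (e x)).
Proof.
move=> [oO se e0] OU [bij sm]; split=> // [|x Ox]; first exact: sm.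
by apply: hom_inj_neq0; [exact/bij/OU|exact: e0].
Qed.

Lemma bundle_iso_coef (phi : bundle_map l m) x (a v : l x) :
  U x -> a != 0 -> is_bundle_iso U phi -> dvec (phi x a) (phi x v) = dvec a v.
Proof.
move=> Ux ax [bij _]; apply: dvec_hom => //; first exact: (bundle_line bl Ux).
by apply: hom_inj_neq0 => //; exact: bij.
Qed.

End TensDual.

End Bundles.

(** * Connections and their local forms *)

Section Connections.
Context (R : realType) (n : nat) (X : manifold R n).
Implicit Types (U V Q : set X) (x : X) (l m : lbundle X) (A : form1 X).

(** The connection form A of D in the frame e, defined by D e = A (x) e. *)
Definition cform l (D : conn l) (e : Defs.section l) : form1 X :=
  fun c i x => dvec (e x) (D e c i x).

(** D (f e) = (df + f A) (x) e.  A total operator D is constrained by the axioms of a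
    connection on smooth sections only, and for a 1-form A this formula implies them all. *)
Definition local_formula l (D : conn l) Q (e : Defs.section l) A :=
  forall V (s : Defs.section l), open V -> smooth_section V s ->
  forall c i x, V x -> Q x -> mdom c x ->
    D s c i x = (pd c i (coefs e s) x + coefs e s x * A c i x) *: e x.

Section OneConnection.
Variables (U : set X) (l : lbundle X).
Hypotheses (oU : open U) (bl : is_lbundle U l).
Implicit Types (e s t : Defs.section l) (D : conn l).

Lemma conn_local_formula D Q e : is_conn U D -> frame_on Q e -> Q `<=` U ->
  local_formula D Q e (cform D e).
Proof.
move=> cD fe OU V s oV ss c i x Vx Ox cx; have [oO se e0] := fe.
have oVO : open (V `&` Q) by exact: openI.
have VOO : V `&` Q `<=` Q by move=> ? [].
have VOU : V `&` Q `<=` U by apply: subset_trans OU.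
have ss' : smooth_section (V `&` Q) s by apply: smooth_section_sub ss => ? [].
have sc : smooth_on (V `&` Q) (coefs e s) by exact: (coefs_smooth bl fe OU oVO VOO ss').
have [H1 _ H3 _ _] := cD _ oVO VOU.
rewrite (H1 s (fun y => coefs e s y *: e y))//.
- rewrite H3//; last exact: smooth_section_sub se.
  rewrite [X in _ + _ *: X](line_coef (D e c i x) (bundle_line bl (OU _ Ox)) (e0 x Ox)).
  by rewrite scalerA -scalerDl.
- exact: (section_of_coef bl fe oVO VOO OU sc).
- by move=> y [_ Oy]; apply: (coefsE bl); [exact: OU|exact: e0].
Qed.

Lemma cform_of_formula D Q e A : frame_on Q e -> local_formula D Q e A ->
  eq_form1 Q (cform D e) A.
Proof.
move=> [oO se e0] DA c i x Ox cx; rewrite /cform (DA Q e)//.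
rewrite dvecZZ; last exact: e0.
have ce y : Q y -> coefs e e y = 1 by move=> Oy; rewrite /coefs dvec_self//; exact: e0.
by rewrite (pd_ext _ oO Ox cx ce) pd_cst ce// mul1r add0r.
Qed.

Lemma cform_is_form1 D Q e : is_conn U D -> frame_on Q e -> Q `<=` U ->
  is_form1 Q (cform D e).
Proof.
move=> cD fe OU; have [oO se e0] := fe; have [_ _ _ H4 H5] := cD _ oO OU.
split=> [c i|c d i x Ox cx dx].
  have oQc : open (Q `&` mdom c) by exact: openI (mdom_open c).
  have sub : Q `&` mdom c `<=` Q by move=> ? [].
  exact: (coefs_smooth bl fe OU oQc sub (H4 e se c i)).
rewrite /cform (H5 e se c d i x)// linear_sum; apply: eq_bigr => j _.
by rewrite linearZ.
Qed.

(** The five axioms are local, and d + A satisfies them. *)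
Lemma is_conn_of_formula D :
  (forall x, U x -> exists Q e A,
    [/\ frame_on Q e, Q x, Q `<=` U, is_form1 Q A & local_formula D Q e A]) ->
  is_conn U D.
Proof.
move=> H V oV VU.
have loc x : V x -> exists Q e A, [/\ [/\ frame_on Q e, Q x, Q `<=` U, is_form1 Q A &
      local_formula D Q e A], open (V `&` Q) &
    forall s, smooth_section V s ->
      smooth_section (V `&` Q) s /\ smooth_on (V `&` Q) (coefs e s)].
  move=> Vx; have [Q [e [A HQ]]] := H x (VU _ Vx); have [fe _ QU _ _] := HQ.
  have [oQ _ _] := fe; exists Q, e, A; split=> //; first exact: openI.
  move=> s ss; split; first by apply: smooth_section_sub ss => ? [].
  exact: (coefs_smoothI bl fe QU oV ss).
split.
- move=> s t ss st st_eq c i x Vx cx.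
  have [Q [e [A [[fe Qx QU fA DA] _ _]]]] := loc x Vx.
  rewrite (DA V s)// (DA V t)//; rewrite /coefs st_eq//.
  by congr ((_ + _) *: _); apply: (pd_ext _ oV) => // y Vy; rewrite st_eq.
- move=> s t ss st c i x Vx cx.
  have [Q [e [A [[fe Qx QU fA DA] oN sub]]]] := loc x Vx.
  have [_ _ e0] := fe; have [ss' cs] := sub s ss; have [st' ct] := sub t st.
  have cst' : smooth_section (V `&` Q) (fun y => s y + t y).
    apply: (@smooth_section_ext _ _ _ _ _ (fun y => (coefs e s y + coefs e t y) *: e y)).
      move=> y [Vy Qy]; rewrite scalerDl -!(coefsE bl)//; do ?[exact: QU|exact: e0].
    by apply: (section_of_coef bl fe oN) => //; exact: smooth_add.
  rewrite (DA (V `&` Q) s)// (DA (V `&` Q) t)//.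
  rewrite (DA (V `&` Q) (fun y => s y + t y))// -scalerDl; congr (_ *: _).
  rewrite (_ : coefs e (fun y => s y + t y) = fun y => coefs e s y + coefs e t y).
    by rewrite (pd_add _ oN)//; ring.
  by apply/funext => y; rewrite /coefs dvecD.
- move=> f s sf ss c i x Vx cx.
  have [Q [e [A [[fe Qx QU fA DA] oN sub]]]] := loc x Vx.
  have [_ _ e0] := fe; have [ss' cs] := sub s ss.
  have sf' : smooth_on (V `&` Q) f by apply: smooth_sub sf => ? [].
  have cfs : smooth_section (V `&` Q) (fun y => f y *: s y).
    apply: (@smooth_section_ext _ _ _ _ _ (fun y => (f y * coefs e s y) *: e y)).
      move=> y [Vy Qy]; rewrite -scalerA -!(coefsE bl)//; do ?[exact: QU|exact: e0].
    by apply: (section_of_coef bl fe oN) => //; exact: smooth_mul.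
  rewrite (DA (V `&` Q) s)// (DA (V `&` Q) (fun y => f y *: s y))//.
  rewrite [X in _ = _ *: X + _](coefsE bl s (QU _ Qx) (e0 x Qx)) !scalerA -scalerDl.
  congr (_ *: _).
  rewrite (_ : coefs e (fun y => f y *: s y) = fun y => f y * coefs e s y).
    by rewrite (pd_mul _ oN)//; ring.
  by apply/funext => y; rewrite /coefs dvecZ.
- move=> s ss c i; have oVc : open (V `&` mdom c) by exact: openI (mdom_open c).
  apply: (smooth_section_local bl) => // [x [/VU]//|x [Vx cx]].
  have [Q [e [A [[fe Qx QU fA DA] oN sub]]]] := loc x Vx.
  have [_ cs] := sub s ss.
  have oNc : open (V `&` Q `&` mdom c) by exact: openI (mdom_open c).
  exists (V `&` Q `&` mdom c); split=> //.
  apply: (@smooth_section_ext _ _ _ _ _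
    (fun y => (pd c i (coefs e s) y + coefs e s y * A c i y) *: e y)).
    by move=> y [[Vy Qy] cy]; rewrite (DA V s).
  apply: (section_of_coef bl fe oNc _ QU); first by move=> ? [[]].
  apply: smooth_add => //; first exact: smooth_pd.
  apply: smooth_mul => //; first by apply: smooth_sub cs => ? [].
  by have [+ _] := fA; move=> /(_ c i); apply: smooth_sub => ? [[]].
- move=> s ss c d i x Vx cx dx.
  have [Q [e [A [[fe Qx QU fA DA] oN sub]]]] := loc x Vx.
  have [_ cs] := sub s ss.
  rewrite (DA V s)//; under eq_bigr do rewrite (DA V s)// scalerA.
  rewrite -scaler_suml; congr (_ *: _).
  have [_ tA] := fA; rewrite (pd_chain i oN _ cx dx cs)// (tA c d i x)//.
  by rewrite mulr_sumr -big_split/=; apply: eq_bigr => j _; ring.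
Qed.

Lemma cform_change D Q Q' e e' : is_conn U D -> frame_on Q e -> frame_on Q' e' ->
  Q `<=` U -> forall c i x, Q x -> Q' x -> mdom c x ->
  cform D e' c i x = cform D e c i x + dlog (coefs e e') c i x.
Proof.
move=> cD fe fe' OU c i x Ox Q'x cx; have [oO se e0] := fe; have [oO' se' e0'] := fe'.
rewrite {1}/cform (conn_local_formula cD fe OU oO' se')//.
have Lx := bundle_line bl (OU _ Ox); have ex := e0 _ Ox; have e'x := e0' _ Q'x.
have c0 : coefs e e' x != 0 by exact: dvec_neq0.
rewrite [in X in dvec X](coefsE bl e' (OU _ Ox) ex) dvecV// scale_lfunE dvecZZ// /dlog.
by rewrite /GRing.scale/=; field.
Qed.

(** At each point one of the frames is picked to define D; by the transformation law
    of the forms, the result does not depend on the frame. *)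
Lemma conn_of_forms (K : Type) (Q : K -> set X) (e : K -> Defs.section l)
    (A : K -> form1 X) :
  (forall k, [/\ frame_on (Q k) (e k), Q k `<=` U & is_form1 (Q k) (A k)]) ->
  (forall x, U x -> exists k, Q k x) ->
  (forall k k' c i x, Q k x -> Q k' x -> mdom c x ->
     A k' c i x = A k c i x + dlog (coefs (e k) (e k')) c i x) ->
  exists D : conn l, is_conn U D /\
    forall k, local_formula D (Q k) (e k) (A k).
Proof.
move=> HO cov compat.
pose D : conn l := fun s c i x =>
  if pselect (exists k, Q k x) is left H then
    let k := sval (cid H) in
    (pd c i (coefs (e k) s) x + coefs (e k) s x * A k c i x) *: e k x
  else 0.
have DA k : local_formula D (Q k) (e k) (A k).
  move=> V s oV ss c i x Vx Ox cx; rewrite /D; case: pselect => [H|[]]; last by exists k.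
  case: cid => k' /= Q'x; have [fe OU fA] := HO k; have [fe' OU' fA'] := HO k'.
  have [oO se e0] := fe; have [oO' se' e0'] := fe'.
  have oN : open (V `&` Q k `&` Q k') by do 2?apply: openI.
  have subV : V `&` Q k `&` Q k' `<=` V by move=> ? [[]].
  have subO : V `&` Q k `&` Q k' `<=` Q k by move=> ? [[]].
  have subO' : V `&` Q k `&` Q k' `<=` Q k' by move=> ? [].
  pose g := coefs (e k) (e k').
  have sg : smooth_on (V `&` Q k `&` Q k') g.
    by apply: (coefs_smooth bl fe OU) => //; exact: smooth_section_sub se'.
  have cs' : smooth_on (V `&` Q k `&` Q k') (coefs (e k') s).
    by apply: (coefs_smooth bl fe' OU') => //; exact: smooth_section_sub ss.
  have Lx y : Q k y -> line (l y) by move=> /OU Uy; exact: (bundle_line bl Uy).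
  have Es y : (V `&` Q k `&` Q k') y -> coefs (e k) s y = g y * coefs (e k') s y.
    move=> [[Vy Oy] Q'y]; rewrite {1}/coefs.
    by rewrite {1}(line_coef (s y) (Lx y Oy) (e0' y Q'y)) dvecZ mulrC.
  have Nx : (V `&` Q k `&` Q k') x by [].
  rewrite (pd_ext _ oN Nx cx Es) (pd_mul _ oN)// Es//.
  have gx : g x != 0 by apply: dvec_neq0; [exact: Lx|exact: e0|exact: e0'].
  rewrite (compat k k')// -/g /dlog.
  rewrite [X in _ *: X = _](line_coef (e k' x) (Lx x Ox) (e0 x Ox)) scalerA; congr (_ *: _).
  by rewrite -/(coefs (e k) (e k') x) -/g; field.
exists D; split=> //; apply: is_conn_of_formula => x Ux.
have [k Ox] := cov x Ux; have [fe OU fA] := HO k.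
by exists (Q k), (e k), (A k).
Qed.

(** The curvature is dA: the terms quadratic in A and those with one derivative of the
    section are symmetric, as are the second derivatives. *)
Lemma conn_curvature D Q e V s : frame_on Q e -> Q `<=` U -> is_form1 Q (cform D e) ->
  is_conn U D -> open V -> V `<=` U -> smooth_section V s ->
  forall c i j x, V x -> Q x -> mdom c x ->
  D (D s c j) c i x - D (D s c i) c j x =
    (coefs e s x * ext_d (cform D e) c i j x) *: e x.
Proof.
move=> fe OU fA cD oV VU ss c i j x Vx Ox cx; have [oO se e0] := fe.
have DA := conn_local_formula cD fe OU.
have [_ _ _ H4 _] := cD V oV VU.
have oVc : open (V `&` mdom c) by exact: openI (mdom_open c).
have oVO : open (V `&` Q) by exact: openI.
have oN : open (V `&` Q `&` mdom c) by exact: openI (mdom_open c).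
have Nx : (V `&` Q `&` mdom c) x by [].
have cs : smooth_on (V `&` Q) (coefs e s).
  exact: (coefs_smoothI bl fe OU oV ss).
have cs' : smooth_on (V `&` Q `&` mdom c) (coefs e s) by apply: smooth_sub cs => ? [].
have sA k : smooth_on (V `&` Q `&` mdom c) (cform D e c k).
  by have [+ _] := fA; move=> /(_ c k); apply: smooth_sub => ? [[]].
have sp k : smooth_on (V `&` Q `&` mdom c) (pd c k (coefs e s)) by exact: smooth_pd.
have step k k' : D (D s c k) c k' x =
    (pd c k' (pd c k (coefs e s)) x
     + (pd c k' (coefs e s) x * cform D e c k x + coefs e s x * pd c k' (cform D e c k) x)
     + (pd c k (coefs e s) x + coefs e s x * cform D e c k x) * cform D e c k' x) *: e x.
  rewrite (DA _ _ oVc (H4 s ss c k))//.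
  have E y : (V `&` Q `&` mdom c) y -> coefs e (D s c k) y =
      pd c k (coefs e s) y + coefs e s y * cform D e c k y.
    move=> [[Vy Oy] cy]; rewrite {1}/coefs (DA V s)// dvecZZ//; exact: e0.
  rewrite (pd_ext _ oN Nx cx E) E//; congr ((_ + _) *: _).
  rewrite (pd_add _ oN)//; last exact: smooth_mul.
  by rewrite (pd_mul _ oN).
rewrite !step -scalerBl; congr (_ *: _); rewrite /ext_d.
have VOx : (V `&` Q) x by [].
by rewrite (pd_comm _ oVO VOx cx j cs); ring.
Qed.

Lemma flat_conn_form D Q e : is_conn U D -> flat_conn U D -> frame_on Q e ->
  Q `<=` U -> forall c i j x, Q x -> mdom c x -> ext_d (cform D e) c i j x = 0.
Proof.
move=> cD fD fe OU c i j x Ox cx; have [oO se e0] := fe.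
have fA := cform_is_form1 cD fe OU.
have := conn_curvature fe OU fA cD oO OU se i j Ox Ox cx.
rewrite (fD Q e oO OU se c i j x Ox cx) subrr => /esym/eqP.
rewrite scaler_eq0 (negbTE (e0 x Ox)) orbF /coefs dvec_self ?mul1r ?e0//.
by move/eqP.
Qed.

Lemma flat_conn_of_forms D : is_conn U D ->
  (forall x, U x -> exists Q e, [/\ frame_on Q e, Q x, Q `<=` U &
     forall c i j, mdom c x -> ext_d (cform D e) c i j x = 0]) ->
  flat_conn U D.
Proof.
move=> cD H V s oV VU ss c i j x Vx cx.
have [Q [e [fe Ox OU dA]]] := H x (VU _ Vx).
have fA := cform_is_form1 cD fe OU.
apply/eqP; rewrite -subr_eq0 (conn_curvature fe OU fA cD oV VU ss)// dA//.
by rewrite mulr0 scale0r.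
Qed.

Lemma parallel_cform D Q e : frame_on Q e -> parallel Q D e ->
  forall c i x, Q x -> mdom c x -> cform D e c i x = 0.
Proof. by move=> fe pe c i x Ox cx; rewrite /cform pe// linear0. Qed.

End OneConnection.

Lemma is_conn_sub U V l (D : conn l) : V `<=` U -> is_conn U D -> is_conn V D.
Proof. by move=> VU cD W oW WV; apply: cD => //; exact: subset_trans VU. Qed.

End Connections.

(** * Tensor products and duals of connections *)

Section InducedConnections.
Context (R : realType) (n : nat) (X : manifold R n).
Implicit Types (U V : set X) (x : X) (l m : lbundle X) (A : form1 X).

Section TensorConnection.
Variables (U : set X) (l m : lbundle X).
Hypotheses (oU : open U) (bl : is_lbundle U l) (bm : is_lbundle U m).
Variables (D : conn l) (E : conn m).
Hypotheses (cD : is_conn U D) (cE : is_conn U E).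

Local Notation DE := (tens_conn D E).

(** The Leibniz rule that characterizes the tensor product connection is consistent:
    if u = (a e) (x) (b f) then its right-hand side depends on a b only. *)
Lemma tens_conn_formula Q (e : Defs.section l) (f : Defs.section m) :
  frame_on Q e -> frame_on Q f -> Q `<=` U ->
  local_formula (DE : conn (tensb l m)) Q (fun x => tens (e x) (f x))
    (add_form1 (cform D e) (cform E f)).
Proof.
move=> fe ff QU V u oV su c i x Vx Qx cx.
have [oQ se e0] := fe; have [_ sf f0] := ff.
have fef : frame_on (l := tensb l m) Q (fun x => tens (e x) (f x)) by exact: frame_tens bl bm _ _ _ fe ff.
have btm := tensb_lbundle oU bl bm.
have ex := e0 _ Qx; have fx := f0 _ Qx.
have oVQ : open (V `&` Q) by exact: openI.
pose F := coefs (l := tensb l m) (fun x => tens (e x) (f x)) u.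
have sF : smooth_on (V `&` Q) F.
  exact: (coefs_smoothI btm fef QU oV su).
have uE y : V y -> Q y -> u y = F y *: tens (e y) (f y).
  move=> Vy Qy; have [_ _ h] := fef; exact: (coefsE btm u (QU _ Qy) (h y Qy)).
rewrite /add_form1 -/F.
set w0 := _ *: _.
have w0P : forall V' s t, open V' -> V' x ->
    @smooth_section _ _ _ l V' s -> @smooth_section _ _ _ m V' t ->
    (forall y, V' y -> u y = tens (s y) (t y)) ->
    w0 = tens (D s c i x) (t x) + tens (s x) (E t c i x).
  move=> V' s t oV' V'x ss st ust.
  have oN : open (V `&` Q `&` V') by exact: openI.
  have Nx : (V `&` Q `&` V') x by [].
  have sa : smooth_on (V `&` Q `&` V') (coefs e s).
    apply: (coefs_smooth bl fe QU) => //; first by move=> ? [[]].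
    by apply: smooth_section_sub ss => ? [].
  have sb : smooth_on (V `&` Q `&` V') (coefs f t).
    apply: (coefs_smooth bm ff QU) => //; first by move=> ? [[]].
    by apply: smooth_section_sub st => ? [].
  have sE y : Q y -> s y = coefs e s y *: e y.
    by move=> Qy; apply: (coefsE bl); [exact: QU|exact: e0].
  have tE y : Q y -> t y = coefs f t y *: f y.
    by move=> Qy; apply: (coefsE bm); [exact: QU|exact: f0].
  have FE y : (V `&` Q `&` V') y -> F y = coefs e s y * coefs f t y.
    move=> [[Vy Qy] V'y].
    have ef0 : tens (e y) (f y) != 0 by apply: tens_neq0; [exact: e0|exact: f0].
    apply: (scale_line_inj ef0).
    by rewrite -uE// ust// {1}(sE y Qy) {1}(tE y Qy) tensZl tensZr scalerA.
  rewrite (conn_local_formula bl cD fe QU oV' ss)//.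
  rewrite (conn_local_formula bm cE ff QU oV' st)//.
  rewrite {1}(sE x Qx) {1}(tE x Qx) !tensZl !tensZr !scalerA -scalerDl /w0.
  congr (_ *: _).
  by rewrite (pd_ext _ oN Nx cx FE) (pd_mul _ oN)// FE//; ring.
rewrite /tens_conn; apply: xget_subset1; first exact: w0P.
move=> w w' /= wP w'P.
have dec : [/\ smooth_section (V `&` Q) (fun y => F y *: e y),
    smooth_section (V `&` Q) f &
    forall y, (V `&` Q) y -> u y = tens (F y *: e y) (f y)].
  split; [exact: (section_of_coef bl fe)|by apply: smooth_section_sub sf => ? []|].
  by move=> y [Vy Qy]; rewrite tensZl uE.
by have [d1 d2 d3] := dec; rewrite (wP _ _ _ oVQ _ d1 d2 d3)// (w'P _ _ _ oVQ _ d1 d2 d3).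
Qed.

Lemma tens_is_conn : is_conn U (DE : conn (tensb l m)).
Proof.
have btm := tensb_lbundle oU bl bm; apply: (is_conn_of_formula btm) => x Ux.
have [Q [e [fe Qx QU]]] := local_frame oU bl Ux.
have [Q' [f [ff Q'x Q'U]]] := local_frame oU bm Ux.
have [oQ _ _] := fe; have [oQ' _ _] := ff.
have oN : open (Q `&` Q') by exact: openI.
have NU : Q `&` Q' `<=` U by move=> y [/QU].
have fe' : frame_on (Q `&` Q') e by apply: frame_sub fe => // ? [].
have ff' : frame_on (Q `&` Q') f by apply: frame_sub ff => // ? [].
exists (Q `&` Q'), (fun x => tens (e x) (f x)), (add_form1 (cform D e) (cform E f)).
split=> //; first exact: frame_tens bl bm _ _ _ fe' ff'.
- apply: is_form1_add => //; first exact: (cform_is_form1 bl cD).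
  exact: (cform_is_form1 bm cE).
- exact: tens_conn_formula.
Qed.

Lemma cform_tens Q (e : Defs.section l) (f : Defs.section m) :
  frame_on Q e -> frame_on Q f -> Q `<=` U ->
  eq_form1 Q (cform (DE : conn (tensb l m)) (fun x => tens (e x) (f x)))
    (add_form1 (cform D e) (cform E f)).
Proof.
move=> fe ff QU; apply: cform_of_formula; last exact: tens_conn_formula.
exact: frame_tens bl bm _ _ _ fe ff.
Qed.

End TensorConnection.

Section DualConnection.
Variables (U : set X) (l : lbundle X).
Hypotheses (oU : open U) (bl : is_lbundle U l).
Variables (D : conn l).
Hypotheses (cD : is_conn U D).

(** Here too the Leibniz rule, tested on sections a e, gives a value independent of
    a. *)
Lemma dual_conn_formula Q (e : Defs.section l) :
  frame_on Q e -> Q `<=` U ->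
  local_formula (dual_conn D : conn (dualb l)) Q (fun x => dvec (e x))
    (scale_form1 (-1) (cform D e)).
Proof.
move=> fe QU V u oV su c i x Vx Qx cx.
have [oQ se e0] := fe.
have fd : frame_on (l := dualb l) Q (fun x => dvec (e x)) by exact: frame_dual bl _ _ fe QU.
have bd := dualb_lbundle oU bl.
have oVQ : open (V `&` Q) by exact: openI.
have VQx : (V `&` Q) x by [].
pose F := coefs (l := dualb l) (fun x => dvec (e x)) u.
have sF : smooth_on (V `&` Q) F.
  exact: (coefs_smoothI bd fd QU oV su).
have uE y : Q y -> u y = F y *: dvec (e y).
  by move=> Qy; have [_ _ h] := fd; exact: (coefsE bd u (QU _ Qy) (h y Qy)).
rewrite /scale_form1 -/F.
set w0 := _ *: _.
have w0P : forall V' s, open V' -> V' x -> @smooth_section _ _ _ l V' s ->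
    w0 (s x) = pd c i (fun y => u y (s y)) x - u x (D s c i x).
  move=> V' s oV' V'x ss.
  have oN : open (V `&` Q `&` V') by exact: openI.
  have Nx : (V `&` Q `&` V') x by [].
  have sa : smooth_on (V `&` Q `&` V') (coefs e s).
    apply: (coefs_smooth bl fe QU) => //; first by move=> ? [[]].
    by apply: smooth_section_sub ss => ? [].
  have sF' : smooth_on (V `&` Q `&` V') F by apply: smooth_sub sF => ? [].
  have usE y : (V `&` Q `&` V') y -> u y (s y) = F y * coefs e s y.
    by move=> [[Vy Qy] V'y]; rewrite uE// scale_lfunE.
  rewrite (pd_ext _ oN Nx cx usE) (pd_mul _ oN)//.
  rewrite (conn_local_formula bl cD fe QU oV' ss)// uE// /w0 !scale_lfunE.
  rewrite dvecZZ; last exact: e0.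
  by rewrite -/(coefs e s x) /GRing.scale/=; ring.
rewrite /dual_conn; apply: xget_subset1; first exact: w0P.
move=> w w' /= wP w'P; apply/lfunP => v.
rewrite (line_coef v (bundle_line bl (QU _ Qx)) (e0 _ Qx)) !linearZ/=.
by rewrite (wP _ _ oQ Qx se) (w'P _ _ oQ Qx se).
Qed.

Lemma dual_is_conn : is_conn U (dual_conn D : conn (dualb l)).
Proof.
have bd := dualb_lbundle oU bl; apply: (is_conn_of_formula bd) => x Ux.
have [Q [e [fe Qx QU]]] := local_frame oU bl Ux.
have [oQ _ _] := fe.
exists Q, (fun x => dvec (e x)), (scale_form1 (-1) (cform D e)); split=> //.
- exact: frame_dual bl _ _ fe QU.
- by apply: is_form1_scale => //; exact: (cform_is_form1 bl cD).
- exact: dual_conn_formula.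
Qed.

Lemma cform_dual Q (e : Defs.section l) :
  frame_on Q e -> Q `<=` U ->
  eq_form1 Q (cform (dual_conn D : conn (dualb l)) (fun x => dvec (e x)))
    (scale_form1 (-1) (cform D e)).
Proof.
move=> fe QU; apply: cform_of_formula; last exact: dual_conn_formula.
exact: frame_dual bl _ _ fe QU.
Qed.

End DualConnection.

Section ViaIso.
Variables (U : set X) (l m : lbundle X) (phi : bundle_map l m).
Hypotheses (oU : open U) (bl : is_lbundle U l) (bm : is_lbundle U m).
Hypothesis iphi : is_bundle_iso U phi.
Variables (D : conn l) (E : conn m).

Lemma conn_via_cform Q (e : Defs.section l) : conn_via U phi D E ->
  frame_on Q e -> Q `<=` U ->
  eq_form1 Q (cform D e) (cform E (fun y => phi y (e y))).
Proof.
move=> DE fe QU c i x Qx cx; have [oQ se e0] := fe.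
rewrite /cform -(DE Q e oQ QU se c i x Qx cx).
by rewrite (bundle_iso_coef bl _ (QU _ Qx) (e0 _ Qx) iphi).
Qed.

(** Both sides obey the same Leibniz rule, so comparing them on one frame around each
    point is enough. *)
Lemma conn_via_of_cform : is_conn U D -> is_conn U E ->
  (forall x, U x -> exists Q (e : Defs.section l), [/\ frame_on Q e, Q x, Q `<=` U &
    forall c i, mdom c x -> cform D e c i x = cform E (fun y => phi y (e y)) c i x]) ->
  conn_via U phi D E.
Proof.
move=> cD cE H V s oV VU ss c i x Vx cx.
have [Q [e [fe Qx QU DE]]] := H x (VU _ Vx).
have fphi : frame_on Q (fun y => phi y (e y)) by exact: frame_iso iphi.
have [oQ se e0] := fe; have [bij sm] := iphi.
rewrite (conn_local_formula bl cD fe QU oV ss)//.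
rewrite (conn_local_formula bm cE fphi QU oV (sm V s oV VU ss))//.
rewrite linearZ/= DE//; congr ((_ + _ * _) *: _).
  have oN : open (V `&` Q) by exact: openI.
  have Nx : (V `&` Q) x by [].
  apply: (pd_ext _ oN Nx cx) => y [Vy Qy].
  by rewrite /coefs (bundle_iso_coef bl _ (QU _ Qy) (e0 _ Qy) iphi).
by rewrite /coefs (bundle_iso_coef bl _ (QU _ Qx) (e0 _ Qx) iphi).
Qed.

End ViaIso.

End InducedConnections.

(** * Metrics and the form theta *)

Section Metrics.
Context (R : realType) (n : nat) (X : manifold R n).
Implicit Types (U V : set X) (x : X) (l m : lbundle X).

(** On a line this condition amounts to bilinearity. *)
Definition homogeneous_at l (h : metric l) x :=
  forall a b (u : l x), h x (a *: u) (b *: u) = a * b * h x u u.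

Definition sqnorm l (h : metric l) (e : Defs.section l) : X -> R :=
  fun x => h x (e x) (e x).

Lemma metric_homogeneous U l (h : metric l) x :
  is_metric U h -> U x -> homogeneous_at h x.
Proof.
move=> [lin sym _ _] Ux.
have h0 w : h x 0 w = 0.
  have := lin x Ux 1 0 0 w; rewrite scaler0 addr0 mul1r.
  by move/eqP; rewrite -subr_eq subrr => /eqP.
have hZ a u w : h x (a *: u) w = a * h x u w.
  by rewrite -[a *: u]addr0 lin// h0 addr0.
by move=> a b u; rewrite hZ sym// hZ mulrA.
Qed.

Lemma sqnorm_unit U l (h : metric l) Q (e : Defs.section l) :
  is_metric U h -> frame_on Q e -> Q `<=` U ->
  smooth_unit Q (sqnorm h e) /\ forall x, Q x -> 0 < sqnorm h e x.
Proof.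
move=> [_ _ pos sm] [oQ se e0] QU.
have p x : Q x -> 0 < sqnorm h e x by move=> Qx; apply: pos; [exact: QU|exact: e0].
split=> //; split; first exact: sm.
by move=> x /p; exact: lt0r_neq0.
Qed.

(** The product of the factors does not depend on how the two vectors are written as
    pure tensors. *)
Lemma tens_metricE l m (h : metric l) (k : metric m) x (a : l x) (b : m x) F G :
  line (l x) -> line (m x) -> homogeneous_at h x -> homogeneous_at k x ->
  a != 0 -> b != 0 ->
  tens_metric h k (F *: tens a b) (G *: tens a b) = F * G * (h x a a * k x b b).
Proof.
move=> Ll Lm hh hk a0 b0; rewrite /tens_metric; apply: xget_subset1.
  exists (F *: a), (G *: a), b, b; split; rewrite ?tensZl// hh; last by ring.
move=> r r' /= [a1 [a2 [b1 [b2 [E1 E2 ->]]]]] [a3 [a4 [b3 [b4 [E3 E4 ->]]]]].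
have ab0 := tens_neq0 a0 b0.
have val (u : l x) (v : m x) c : c *: tens a b = tens u v -> dvec a u * dvec b v = c.
  rewrite {1}(line_coef u Ll a0) {1}(line_coef v Lm b0) tensZl tensZr scalerA.
  by move/(scale_line_inj ab0).
have hE (u v : l x) : h x u v = dvec a u * dvec a v * h x a a.
  by rewrite {1}(line_coef u Ll a0) {1}(line_coef v Ll a0) hh.
have kE (u v : m x) : k x u v = dvec b u * dvec b v * k x b b.
  by rewrite {1}(line_coef u Lm b0) {1}(line_coef v Lm b0) hk.
rewrite (hE a1) (hE a3) (kE b1) (kE b3).
transitivity ((dvec a a1 * dvec b b1) * (dvec a a2 * dvec b b2) * (h x a a * k x b b)).
  by ring.
rewrite (val _ _ _ E1) (val _ _ _ E2) -(val _ _ _ E3) -(val _ _ _ E4).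
by ring.
Qed.

Lemma tens_metric_homogeneous l m (h : metric l) (k : metric m) x :
  line (l x) -> line (m x) -> homogeneous_at h x -> homogeneous_at k x ->
  homogeneous_at (l := tensb l m) (tens_metric h k) x.
Proof.
move=> Ll Lm hh hk a b u.
have a0 := line_vpick Ll; have b0 := line_vpick Lm.
have Lt := line_tens Ll Lm.
rewrite (line_coef u Lt (tens_neq0 a0 b0)) !scalerA.
by rewrite !tens_metricE//; ring.
Qed.

Lemma dual_metricE l (h : metric l) x (e : l x) F G : line (l x) ->
  homogeneous_at h x -> e != 0 -> h x e e != 0 ->
  dual_metric h (F *: dvec e) (G *: dvec e) = F * G / h x e e.
Proof.
move=> Ll hh e0 he0; rewrite /dual_metric; apply: xget_subset1.
  move=> v /=; rewrite !scale_lfunE /GRing.scale/=.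
  rewrite {1 2}(line_coef v Ll e0) hh; by field.
move=> r r' /= /(_ e) + /(_ e) => <-.
by move=> /(mulIf he0).
Qed.

Lemma dual_metric_homogeneous l (h : metric l) x : line (l x) ->
  homogeneous_at h x -> (forall u : l x, u != 0 -> h x u u != 0) ->
  homogeneous_at (l := dualb l) (dual_metric h) x.
Proof.
move=> Ll hh h0 a b u; have e0 := line_vpick Ll.
rewrite (dvec_dual u Ll e0) !scalerA !dual_metricE//; try exact: h0.
by ring.
Qed.

Lemma metric_via_of_values U l m (phi : bundle_map l m) (h : metric l) (k : metric m) :
  is_lbundle U l ->
  (forall x, U x -> homogeneous_at h x) -> (forall x, U x -> homogeneous_at k x) ->
  (forall x, U x -> exists2 u : l x, u != 0 & k x (phi x u) (phi x u) = h x u u) ->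
  metric_via U phi h k.
Proof.
move=> bl hh hk H x Ux v w; have [u u0 hu] := H x Ux.
have Lx := bundle_line bl Ux.
rewrite (line_coef v Lx u0) (line_coef w Lx u0) !linearZ/=.
by rewrite hk// hh// hu.
Qed.

Section OneMetric.
Variables (U : set X) (l : lbundle X).
Hypotheses (oU : open U) (bl : is_lbundle U l).

Lemma sqnorm_change h Q (e e' : Defs.section l) x : is_metric U h ->
  frame_on Q e -> Q `<=` U -> Q x ->
  sqnorm h e' x = coefs e e' x * coefs e e' x * sqnorm h e x.
Proof.
move=> mh [_ _ e0] QU Qx.
rewrite /sqnorm {1 2}(coefsE bl e' (QU _ Qx) (e0 _ Qx)).
by rewrite (metric_homogeneous mh (QU _ Qx)).
Qed.

(** On a line a metric is given by the squared norm of a basis vector; the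
    transformation law makes the result independent of the frame used at a point. *)
Lemma metric_of_values (K : Type) (Q : K -> set X) (e : K -> Defs.section l)
    (H : K -> X -> R) :
  (forall k, frame_on (Q k) (e k) /\ Q k `<=` U) ->
  (forall x, U x -> exists k, Q k x) ->
  (forall k, smooth_on (Q k) (H k)) -> (forall k x, Q k x -> 0 < H k x) ->
  (forall k k' x, Q k x -> Q k' x ->
     H k' x = coefs (e k) (e k') x * coefs (e k) (e k') x * H k x) ->
  exists h : metric l, is_metric U h /\ forall k x, Q k x -> sqnorm h (e k) x = H k x.
Proof.
move=> HQ cov sH H0 compat.
pose h : metric l := fun x u v =>
  if pselect (exists k, Q k x) is left P then
    let k := sval (cid P) in dvec (e k x) u * dvec (e k x) v * H k x
  else 0.
have hE k x u v : Q k x -> h x u v = dvec (e k x) u * dvec (e k x) v * H k x.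
  move=> Qx; rewrite /h; case: pselect => [P|[]]; last by exists k.
  case: cid => k' /= Q'x.
  have [[oQ se e0] QU] := HQ k; have [[oQ' se' e0'] QU'] := HQ k'.
  have Lx := bundle_line bl (QU _ Qx).
  rewrite (compat k k' x Qx Q'x) /coefs.
  rewrite [in RHS](line_coef u Lx (e0' _ Q'x)) [in RHS](line_coef v Lx (e0' _ Q'x)) !dvecZ.
  by ring.
exists h; split; last first.
  move=> k x Qx; have [[oQ se e0] QU] := HQ k.
  by rewrite /sqnorm (hE k)// dvec_self ?e0// !mul1r.
split=> [x Ux a u v w|x Ux u v|x Ux u u0|V s t oV VU ss st].
- by have [k Qx] := cov x Ux; rewrite !(hE k)// dvecD dvecZ; ring.
- by have [k Qx] := cov x Ux; rewrite !(hE k)//; ring.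
- have [k Qx] := cov x Ux; rewrite !(hE k)//.
  have [[oQ se e0] QU] := HQ k.
  rewrite mulr_gt0 ?H0// -expr2 exprn_even_gt0//=.
  by apply: dvec_neq0 => //; [exact: (bundle_line bl Ux)|exact: e0].
- apply: smooth_local => x Vx; have [k Qx] := cov x (VU _ Vx).
  have [fe QU] := HQ k; have [oQ se e0] := fe.
  have oN : open (V `&` Q k) by exact: openI.
  exists (V `&` Q k) => //.
  apply: (@smooth_ext _ _ _ _ (fun y => coefs (e k) s y * coefs (e k) t y * H k y)) => //.
    by move=> y [Vy Qy]; rewrite (hE k).
  apply: smooth_mul => //; last by apply: smooth_sub (sH k) => ? [].
  apply: smooth_mul => //.
    exact: (coefs_smoothI bl fe QU oV ss).
  exact: (coefs_smoothI bl fe QU oV st).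
Qed.

Variable h : metric l.
Hypothesis mh : is_metric U h.

(** The form 1/2 d ln h(e, e) of the metric connection. *)
Definition metric_form (e : Defs.section l) : form1 X :=
  scale_form1 2^-1 (dlog (sqnorm h e)).

Lemma metric_form_is_form1 Q e : frame_on Q e -> Q `<=` U -> is_form1 Q (metric_form e).
Proof.
move=> fe QU; have [oQ _ _] := fe; apply: is_form1_scale => //.
apply: is_form1_dlog => //; exact: (sqnorm_unit mh fe QU).1.
Qed.

Lemma metric_form_closed Q e : frame_on Q e -> Q `<=` U ->
  forall c i j x, Q x -> mdom c x -> ext_d (metric_form e) c i j x = 0.
Proof.
move=> fe QU c i j x Qx cx; have [oQ _ _] := fe.
have [su _] := sqnorm_unit mh fe QU.
rewrite /metric_form (ext_d_scale _ oQ)//; last exact: is_form1_dlog.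
by rewrite (ext_d_dlog _ oQ)// mulr0.
Qed.

Lemma metric_form_change Q Q' e e' c i x : frame_on Q e -> frame_on Q' e' ->
  Q `<=` U -> Q' `<=` U -> Q x -> Q' x -> mdom c x ->
  metric_form e' c i x = metric_form e c i x + dlog (coefs e e') c i x.
Proof.
move=> fe fe' QU QU' Qx Q'x cx; have [oQ se e0] := fe; have [oQ' se' e0'] := fe'.
have oN : open (Q `&` Q') by exact: openI.
have Nx : (Q `&` Q') x by [].
have [[sH _] H0] := sqnorm_unit mh fe QU.
have sc : smooth_on (Q `&` Q') (coefs e e').
  apply: (coefs_smooth bl fe QU) => //.
  by apply: smooth_section_sub se' => ? [].
have sH' : smooth_on (Q `&` Q') (sqnorm h e) by apply: smooth_sub sH => ? [].
have c0 : coefs e e' x != 0.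
  by apply: dvec_neq0; [exact: (bundle_line bl (QU _ Qx))|exact: e0|exact: e0'].
have h0 : sqnorm h e x != 0 by rewrite gt_eqF// H0.
have E y : (Q `&` Q') y -> sqnorm h e' y = coefs e e' y * coefs e e' y * sqnorm h e y.
  by move=> [Qy Q'y]; exact: sqnorm_change mh fe QU Qy.
rewrite /metric_form /scale_form1 (dlog_ext _ oN Nx cx E).
rewrite (dlog_mul _ oN)//; last by rewrite mulf_neq0.
  rewrite (dlog_mul _ oN)//; by field.
exact: smooth_mul.
Qed.

(** Compatibility with h, tested on the pair (e, e), already determines the form; so
    the metric connection is unique. *)
Lemma metric_conn_cform D Q e : is_conn U D -> metric_conn U h D ->
  frame_on Q e -> Q `<=` U -> eq_form1 Q (cform D e) (metric_form e).
Proof.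
move=> cD mD fe QU c i x Qx cx; have [oQ se e0] := fe.
have [_ H0] := sqnorm_unit mh fe QU; have hx := H0 x Qx.
have [lin sym _ _] := mh.
have hh := metric_homogeneous mh (QU _ Qx).
have := mD Q e e oQ QU se se c i x Qx cx.
rewrite (conn_local_formula bl cD fe QU oQ se)//.
have ce y : Q y -> coefs e e y = 1 by move=> Qy; rewrite /coefs dvec_self//; exact: e0.
rewrite (pd_ext _ oQ Qx cx ce) pd_cst ce// add0r mul1r.
have h1 a : h (a *: e x) (e x) = a * h (e x) (e x).
  by rewrite -{2}[e x]scale1r hh mulr1.
have h2 a : h (e x) (a *: e x) = a * h (e x) (e x).
  by rewrite -{1}[e x]scale1r hh mul1r.
rewrite h1 h2 -/(sqnorm h e) -/(sqnorm h e x) => E.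
by rewrite /metric_form /scale_form1 /dlog E; field; rewrite gt_eqF.
Qed.

(** The connection d + 1/2 d ln h(e, e), e any local frame. *)
Lemma metric_conn_exists : exists D : conn l, [/\ is_conn U D, metric_conn U h D &
  forall Q e, frame_on Q e -> Q `<=` U -> eq_form1 Q (cform D e) (metric_form e)].
Proof.
pose K := {p : set X * Defs.section l | frame_on p.1 p.2 /\ p.1 `<=` U}.
have [D [cD DA]] := @conn_of_forms _ _ _ U l bl K (fun k => (sval k).1) (fun k => (sval k).2)
  (fun k => metric_form (sval k).2)
  (fun k => And3 (svalP k).1 (svalP k).2 (metric_form_is_form1 (svalP k).1 (svalP k).2))
  (fun x Ux => let: ex_intro Q (ex_intro e (And3 fe Qx QU)) := local_frame oU bl Ux in
     ex_intro _ (exist _ (Q, e) (conj fe QU)) Qx)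
  (fun k k' c i x Qx Q'x cx => metric_form_change i (svalP k).1 (svalP k').1
     (svalP k).2 (svalP k').2 Qx Q'x cx).
have DF Q e : frame_on Q e -> Q `<=` U -> local_formula D Q e (metric_form e).
  by move=> fe QU; exact: (DA (exist _ (Q, e) (conj fe QU))).
exists D; split=> //; last first.
  by move=> Q e fe QU; exact: (cform_of_formula fe (DF Q e fe QU)).
move=> V s t oV VU ss st c i x Vx cx.
have [Q [e [fe Qx QU]]] := local_frame oU bl (VU _ Vx).
have [oQ se e0] := fe.
have oN : open (V `&` Q) by exact: openI.
have Nx : (V `&` Q) x by [].
have [[sH _] H0] := sqnorm_unit mh fe QU; have hx := H0 x Qx.
have cs s' : smooth_section V s' -> smooth_on (V `&` Q) (coefs e s').
  exact: (coefs_smoothI bl fe QU oV).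
have hE y (a b : R) : Q y -> h (a *: e y) (b *: e y) = a * b * sqnorm h e y.
  by move=> Qy; rewrite (metric_homogeneous mh (QU _ Qy)).
have sE s' y : Q y -> s' y = coefs e s' y *: e y.
  by move=> Qy; apply: (coefsE bl); [exact: QU|exact: e0].
have E y : (V `&` Q) y -> h (s y) (t y) = coefs e s y * coefs e t y * sqnorm h e y.
  by move=> [Vy Qy]; rewrite {1}(sE s)// {1}(sE t)// hE.
rewrite (pd_ext _ oN Nx cx E) (DF Q e fe QU V s)// (DF Q e fe QU V t)//.
rewrite {1}(sE t)// {1}(sE s)// !hE//.
have sH' : smooth_on (V `&` Q) (sqnorm h e) by apply: smooth_sub sH => ? [].
rewrite (pd_mul _ oN)//; last by apply: smooth_mul => //; exact: cs.
rewrite (pd_mul _ oN); rewrite ?/metric_form ?/scale_form1 ?/dlog//; try exact: cs.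
by field; rewrite gt_eqF.
Qed.

(** By existence and uniqueness of the metric connection, theta is the difference of
    the connection forms. *)
Lemma theta_cform D Q e c i x : is_conn U D -> frame_on Q e -> Q `<=` U ->
  Q x -> mdom c x -> theta U D h c i x = cform D e c i x - metric_form e c i x.
Proof.
move=> cD fe QU Qx cx; have [oQ se e0] := fe.
rewrite /theta; apply: xget_subset1.
  have [Dh [cDh mDh DhA]] := metric_conn_exists.
  exists Dh; split=> // V s oV VU Vx ss.
  rewrite (conn_local_formula bl cD fe QU oV ss)//.
  rewrite (conn_local_formula bl cDh fe QU oV ss)// (DhA Q e fe QU c i x Qx cx).
  rewrite [X in _ = _ *: X](coefsE bl s (QU _ Qx) (e0 _ Qx)).
  by rewrite -scalerBl scalerA; congr (_ *: _); ring.
have val r : (exists Dh : conn l, [/\ is_conn U Dh, metric_conn U h Dh &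
      forall V s, open V -> V `<=` U -> V x -> @smooth_section _ _ _ l V s ->
        D s c i x - Dh s c i x = r *: s x]) ->
    r = cform D e c i x - metric_form e c i x.
  move=> [Dh [cDh mDh H]]; rewrite -(metric_conn_cform cDh mDh fe QU i Qx cx).
  have := H Q e oQ QU Qx se; rewrite /cform -linearB => ->.
  by rewrite /= (dvecZZ _ (e0 _ Qx)).
by move=> r r' /val -> /val ->.
Qed.

Lemma theta_is_form1 D : is_conn U D -> is_form1 U (theta U D h).
Proof.
move=> cD; apply: is_form1_local => x Ux.
have [Q [e [fe Qx QU]]] := local_frame oU bl Ux; have [oQ _ _] := fe.
exists Q => //; apply: (@is_form1_ext _ _ _ _ (sub_form1 (cform D e) (metric_form e))) => //.
  by move=> c i y Qy cy; rewrite (theta_cform i cD fe QU).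
apply: is_form1_sub_form => //; first exact: (cform_is_form1 bl cD).
exact: metric_form_is_form1.
Qed.

(** The form of the metric connection is closed. *)
Lemma ext_d_theta D Q e c i j x : is_conn U D -> frame_on Q e -> Q `<=` U ->
  Q x -> mdom c x -> ext_d (theta U D h) c i j x = ext_d (cform D e) c i j x.
Proof.
move=> cD fe QU Qx cx; have [oQ _ _] := fe.
rewrite (@ext_d_ext _ _ _ Q c i x oQ Qx cx _ (sub_form1 (cform D e) (metric_form e))).
  rewrite (ext_d_sub _ oQ)//; [|exact: (cform_is_form1 bl cD)|exact: metric_form_is_form1].
  by rewrite (metric_form_closed fe QU)// subr0.
by move=> c' i' y Qy cy; rewrite (theta_cform i' cD fe QU).
Qed.

End OneMetric.
End Metrics.

(** * The fibres of a gerbe *)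

Section FrameLemmas.
Context (R : realType) (n : nat) (X : manifold R n).
Implicit Types (U V Q : set X) (x : X) (l m : lbundle X).

Lemma frame_ext l Q (e e' : Defs.section l) : (forall x, Q x -> e x = e' x) ->
  frame_on Q e -> frame_on Q e'.
Proof.
move=> ee [oQ se e0]; split=> // [|x Qx]; first exact: smooth_section_ext se.
by rewrite -ee// e0.
Qed.

Lemma frame_glue U V l (e : Defs.section l) : is_lbundle U l -> open V -> V `<=` U ->
  (forall x, V x -> exists2 Q, Q x & frame_on Q e) -> frame_on V e.
Proof.
move=> bl oV VU H; split=> // [|x Vx]; last by have [Q Qx [_ _]] := H x Vx; exact.
apply: (smooth_section_local bl) => // x Vx; have [Q Qx [oQ se _]] := H x Vx.
by exists Q.
Qed.

Definition hom_of (L M : vectType R) (e : L) (f : M) : 'Hom(L, M) :=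
  linfun (fun v => dvec e v *: f).

Lemma hom_ofE (L M : vectType R) (e : L) (f : M) v : hom_of e f v = dvec e v *: f.
Proof.
by rewrite /hom_of linfun_linear// => k u w; rewrite dvecD dvecZ scalerDl scalerA.
Qed.

(** The triple relation forces the antisymmetry of a real cocycle: its diagonal values
    are cube roots of 1, and 1 is the only one in R. *)
Lemma real_cocycle (K : Type) (P : set K) (q : K -> K -> R) :
  (forall a b e, P a -> P b -> P e -> q a b * q b e * q e a = 1) ->
  (forall a b, P a -> P b -> q a b != 0) /\
  (forall a b, P a -> P b -> q b a = (q a b)^-1) /\
  (forall a b e, P a -> P b -> P e -> q a e = q a b * q b e).
Proof.
move=> H.
have q0 a b : P a -> P b -> q a b != 0.
  move=> Pa Pb; apply/negP => /eqP qab; have := H a b b Pa Pb Pb.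
  by rewrite qab !mul0r => /eqP; rewrite eq_sym oner_eq0.
have q1 a : P a -> q a a = 1.
  move=> Pa; have /eqP := H a a a Pa Pa Pa; set t := q a a.
  have -> : (t * t * t == 1) = ((t - 1) * (t ^+ 2 + t + 1) == 0).
    by rewrite -subr_eq0; congr (_ == _); ring.
  rewrite mulf_eq0 subr_eq0 => /orP[/eqP//|/eqP]; nra.
have qV a b : P a -> P b -> q b a = (q a b)^-1.
  move=> Pa Pb; have := H a b a Pa Pb Pa; rewrite q1// mulr1 => E.
  by apply: (mulfI (q0 a b Pa Pb)); rewrite E divff// q0.
split=> //; split=> // a b e Pa Pb Pe.
have E := H a b e Pa Pb Pe; rewrite (qV e a)//.
have E' : q a b * q b e = (q e a)^-1.
  by apply: (mulIf (q0 e a Pe Pa)); rewrite E mulVf// q0.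
by rewrite E'.
Qed.

End FrameLemmas.

Section GerbePointwise.
Context (R : realType) (n : nat) (X : manifold R n) (G : gerbe X).
Local Notation I := (gidx G).
Local Notation U := (gU G).
Local Notation L := (@gl R n X G).

Lemma gU_open i : open (U i).
Proof. by have [+ _] := gU_cover G; apply. Qed.

Lemma gl_line i j x : U i x -> U j x -> line (L i j x).
Proof. by move=> ix jx; apply: (bundle_line (gl_bundle i j)). Qed.

Lemma gpair_scale i j x a b (u : L i j x) (v : L j i x) :
  (gpair i j x (tens (a *: u) (b *: v)) : R) = a * b * (gpair i j x (tens u v) : R).
Proof. by rewrite tensZl tensZr scalerA linearZ. Qed.

Lemma gpair_neq0 i j x (u : L i j x) (v : L j i x) : U i x -> U j x ->
  u != 0 -> v != 0 -> (gpair i j x (tens u v) : R) != 0.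
Proof.
move=> ix jx u0 v0; have [bij _] := @gpair_iso _ _ _ G i j.
exact: (hom_inj_neq0 (bij x (conj ix jx)) (tens_neq0 u0 v0)).
Qed.

(** At a single point the gerbe is trivial: an index z with x in U_z serves as base
    point, and the lines l_iz are used to trivialize all l_ij. *)
Lemma pointwise_bases : exists theta : forall i j, Defs.section (L i j),
  [/\ forall i j x, U i x -> U j x -> theta i j x != 0,
      forall i j x, U i x -> U j x ->
        (gpair i j x (tens (theta i j x) (theta j i x)) : R) = 1 &
      forall i j k x, U i x -> U j x -> U k x ->
        gs i j k x = tens (tens (theta i j x) (theta j k x)) (theta k i x)].
Proof.
have [_ cov] := gU_cover G; have [z /= zP] := choice cov.
pose eta i j x : L i j x := vpick {:L i j x}.
pose T i j k x := tens (tens (eta i j x) (eta j k x)) (eta k i x).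
pose p i j x : R := gpair i j x (tens (eta i j x) (eta j i x)).
pose c i j k x : R := dvec (T i j k x) (gs i j k x).
have eta0 i j x : U i x -> U j x -> eta i j x != 0.
  by move=> ix jx; apply/line_vpick/gl_line.
have T0 i j k x : U i x -> U j x -> U k x -> T i j k x != 0.
  by move=> ix jx kx; do 2?apply: tens_neq0; exact: eta0.
have p0 i j x : U i x -> U j x -> p i j x != 0.
  by move=> ix jx; apply: gpair_neq0 => //; exact: eta0.
have psym i j x : U i x -> U j x -> p i j x = p j i x.
  by move=> ix jx; exact: gpair_sym.
have gsE i j k x : U i x -> U j x -> U k x -> gs i j k x = c i j k x *: T i j k x.
  move=> ix jx kx; apply: line_coef; last exact: T0.
  by do 2?apply: line_tens; exact: gl_line.
have gsE1 i j k x : U i x -> U j x -> U k x ->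
    gs i j k x = tens (tens (c i j k x *: eta i j x) (eta j k x)) (eta k i x).
  by move=> ix jx kx; rewrite gsE// !tensZl.
have c0 i j k x : U i x -> U j x -> U k x -> c i j k x != 0.
  move=> ix jx kx; apply: contraNneq (gs_neq0 ix jx kx) => c0.
  by rewrite gsE// c0 scale0r.
have inv i j k x : U i x -> U j x -> U k x ->
    c i j k x * c j i k x * p i j x * p j k x * p k i x = 1.
  move=> ix jx kx.
  have := gs_inverse ix jx kx (gsE1 i j k x ix jx kx) (gsE1 j i k x jx ix kx).
  by rewrite gpair_scale.
have cocl i j k l x : U i x -> U j x -> U k x -> U l x ->
    c j k l x * c i j l x * p l j x = c i k l x * c i j k x * p i k x.
  move=> ix jx kx lx.
  have := gs_coclosed ix jx kx lx (gsE1 j k l x jx kx lx) (gsE1 i j l x ix jx lx)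
    (gsE1 i k l x ix kx lx) (gsE1 i j k x ix jx kx).
  rewrite -(scale1r (eta k i x)) gpair_scale mulr1 -/(p i k x) -/(p l j x).
  rewrite !(tensZl, tensZr) !scalerA.
  have S0 : tens (tens (tens (eta j k x) (eta k l x)) (eta i j x)) (eta l i x) != 0.
    by do 3?apply: tens_neq0; exact: eta0.
  move/(scale_line_inj S0) => E.
  transitivity (p l j x * (c i j l x * c j k l x)); first by ring.
  by rewrite E; ring.
(* Contracting s_ijz with eta_zj gives lam_ij eta_ij (x) eta_zi: the vector lam_ij eta_ij
   plays the role of eta_zj / eta_zi, and the relations become cancellations. *)
pose lam i j x := c i j (z x) x * p (z x) j x.
have lam0 i j x : U i x -> U j x -> lam i j x != 0.
  by move=> ix jx; rewrite mulf_neq0 ?c0 ?p0.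
exists (fun i j x => lam i j x *: eta i j x); split.
- by move=> i j x ix jx; rewrite scaler_eq0 negb_or lam0// eta0.
- move=> i j x ix jx; rewrite gpair_scale -/(p i j x) /lam.
  rewrite -(inv i j (z x) x ix jx (zP x)) (psym j (z x))//; ring.
- move=> i j k x ix jx kx; rewrite gsE// !(tensZl, tensZr) !scalerA -/(T i j k x).
  congr (_ *: _); rewrite /lam.
  have E1 := cocl i j k (z x) x ix jx kx (zP x).
  have E2 := inv i k (z x) x ix kx (zP x).
  transitivity ((c j k (z x) x * c i j (z x) x * p (z x) j x) *
     (c k i (z x) x * p (z x) k x * p (z x) i x)); last by ring.
  rewrite E1 -[LHS]mulr1 -E2 (psym k (z x))//; ring.
Qed.

Section SmoothBases.
Variable theta : forall i j, Defs.section (L i j).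
Hypothesis theta0 : forall i j x, U i x -> U j x -> theta i j x != 0.
Hypothesis thetaV : forall i j x, U i x -> U j x ->
  (gpair i j x (tens (theta i j x) (theta j i x)) : R) = 1.
Hypothesis thetaS : forall i j k x, U i x -> U j x -> U k x ->
  gs i j k x = tens (tens (theta i j x) (theta j k x)) (theta k i x).

(** The bases theta vary with the point in an arbitrary way, so the smoothness of a
    function a is expressed through the section a theta_ij. *)
Definition smooth_multiple i j Q (a : X -> R) :=
  frame_on Q (fun x => a x *: theta i j x).

(** The pairing of l_ij with l_ji is smooth and maps theta_ij (x) theta_ji to 1. *)
Lemma smooth_multiple_inv i j Q a : Q `<=` U i `&` U j -> smooth_multiple i j Q a ->
  smooth_multiple j i Q (fun x => (a x)^-1).
Proof.
move=> QU fa; have [oQ sa a0] := fa.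
have QU' : Q `<=` U j `&` U i by move=> x /QU[].
have oUU : open (U j `&` U i) by apply: openI; exact: gU_open.
have anz x : Q x -> a x != 0.
  by move=> /a0; rewrite scaler_eq0 negb_or => /andP[].
apply: (frame_glue (gl_bundle j i)) => // x Qx.
have [N [e [fe Nx NU]]] := local_frame oUU (gl_bundle j i) (QU' _ Qx).
have [oN se e0] := fe.
have oQN : open (Q `&` N) by exact: openI.
have QNU : Q `&` N `<=` U i `&` U j by move=> y [/QU].
have QNU' : Q `&` N `<=` U j `&` U i by move=> y [/QU[]].
have fe' : frame_on (Q `&` N) e by apply: frame_sub fe => // y [].
have fa' : smooth_multiple i j (Q `&` N) a by apply: frame_sub fa => // y [].
have bji : is_lbundle (U i `&` U j) (L j i).
  by apply: is_lbundle_sub (gl_bundle j i) => y [].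
have ft := frame_tens (gl_bundle i j) bji fa' fe'.
have [_ sp p0] := frame_iso ft QNU (gpair_iso i j).
have [v [sv vE]] := sp setT (fun=> 1) erefl.
pose m := coefs e (theta j i).
have thE y : (Q `&` N) y -> theta j i y = m y *: e y.
  move=> [Qy Ny]; apply: (coefsE (gl_bundle j i)); [exact: QU'|exact: e0].
have vm y : (Q `&` N) y -> v y * m y = a y.
  move=> QNy; have [Qy Ny] := QNy; have [iy jy] := QU _ Qy.
  have -> : v y = gpair i j y (tens (a y *: theta i j y) (e y)).
    by rewrite vE// /GRing.scale/= mulr1.
  have -> : (gpair i j y (tens (a y *: theta i j y) (e y)) : R) * m y =
     gpair i j y (tens (a y *: theta i j y) (m y *: e y)).
    by rewrite tensZr linearZ mulrC.
  by rewrite -thE// -(scale1r (theta j i y)) gpair_scale thetaV// !mulr1.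
exists (Q `&` N) => //.
have vnz y : (Q `&` N) y -> v y != 0.
  move=> QNy; have := anz _ QNy.1; rewrite -(vm y)// mulf_eq0 negb_or.
  by case/andP.
have sv' : smooth_on (Q `&` N) v by apply: smooth_sub sv => y.
have fv : frame_on (Q `&` N) (fun y => (v y)^-1 *: e y).
  apply: (frame_scale (gl_bundle j i)) => //; split; first exact: smooth_inv.
  by move=> y /vnz; rewrite invr_eq0.
apply: frame_ext fv => y QNy; have [Qy Ny] := QNy.
rewrite thE// scalerA; congr (_ *: _).
have := anz _ Qy; rewrite -(vm y)// mulf_eq0 negb_or => /andP[v0 m0].
by rewrite invfM divfK.
Qed.

(** As s_ijk is smooth and is the product of the theta, the statement holds for
    (a b)^-1 on l_ki; then smooth_multiple_inv applies. *)
Lemma smooth_multiple_mul i j k Q a b : Q `<=` U i `&` U j `&` U k ->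
  smooth_multiple i j Q a -> smooth_multiple j k Q b ->
  smooth_multiple i k Q (fun x => a x * b x).
Proof.
move=> QU fa fb; have [oQ sa a0] := fa; have [_ sb b0] := fb.
have QUi : Q `<=` U i by move=> x /QU[[]].
have QUj : Q `<=` U j by move=> x /QU[[]].
have QUk : Q `<=` U k by move=> x /QU[].
have anz x : Q x -> a x != 0 by move=> /a0; rewrite scaler_eq0 negb_or => /andP[].
have bnz x : Q x -> b x != 0 by move=> /b0; rewrite scaler_eq0 negb_or => /andP[].
suff third : smooth_multiple k i Q (fun x => (a x * b x)^-1).
  have QU' : Q `<=` U k `&` U i by move=> x Qx; split; [exact: QUk|exact: QUi].
  apply: frame_ext (smooth_multiple_inv QU' third) => x Qx.
  by rewrite invrK.
have oUU : open (U k `&` U i) by apply: openI; exact: gU_open.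
have QU' : Q `<=` U k `&` U i by move=> x Qx; split; [exact: QUk|exact: QUi].
apply: (frame_glue (gl_bundle k i)) => // x Qx.
have [N [e [fe Nx NU]]] := local_frame oUU (gl_bundle k i) (QU' _ Qx).
have [oN se e0] := fe.
have oQN : open (Q `&` N) by exact: openI.
have QN : Q `&` N `<=` Q by move=> y [].
have oQQ : open Q by [].
have bij : is_lbundle Q (L i j).
  by apply: is_lbundle_sub (gl_bundle i j) => y Qy; split; [exact: QUi|exact: QUj].
have bjk : is_lbundle Q (L j k).
  by apply: is_lbundle_sub (gl_bundle j k) => y Qy; split; [exact: QUj|exact: QUk].
have bki : is_lbundle Q (L k i) by exact: is_lbundle_sub (gl_bundle k i).
have fe' : frame_on (Q `&` N) e by apply: frame_sub fe => // y [].
have fa' : smooth_multiple i j (Q `&` N) a by exact: frame_sub fa.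
have fb' : smooth_multiple j k (Q `&` N) b by exact: frame_sub fb.
have ft := frame_tens (tensb_lbundle oQQ bij bjk) bki (frame_tens bij bjk fa' fb') fe'.
have bt := tensb_lbundle oQQ (tensb_lbundle oQQ bij bjk) bki.
have sgs : smooth_section (Q `&` N) (gs i j k).
  by apply: smooth_section_sub (@gs_smooth _ _ _ G i j k) => y [/QU].
have sv := coefs_smooth bt ft QN oQN (fun _ h => h) sgs.
set v := coefs _ _ in sv.
pose m := coefs e (theta k i).
have thE y : (Q `&` N) y -> theta k i y = m y *: e y.
  move=> [Qy Ny]; apply: (coefsE (gl_bundle k i)); [exact: QU'|exact: e0].
have vE y : (Q `&` N) y -> v y = (a y * b y)^-1 * m y.
  move=> QNy; have [Qy Ny] := QNy; have [_ _ ft0] := ft.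
  apply: (scale_line_inj (ft0 y QNy)).
  rewrite -(coefsE bt _ Qy (ft0 y QNy)) thetaS; [|exact: QUi|exact: QUj|exact: QUk].
  rewrite thE// !(tensZl, tensZr) !scalerA; congr (_ *: _).
  by field; rewrite anz// bnz.
exists (Q `&` N) => //.
have mnz y : (Q `&` N) y -> m y != 0.
  move=> QNy; have [Qy Ny] := QNy.
  apply: contraNneq (theta0 (QUk _ Qy) (QUi _ Qy)) => m0.
  by rewrite thE// m0 scale0r.
have fv : frame_on (Q `&` N) (fun y => v y *: e y).
  apply: (frame_scale (gl_bundle k i)) => //; first by move=> y [/QU'].
  split=> // y QNy; rewrite vE// mulf_neq0 ?mnz// invr_eq0 mulf_neq0 ?anz ?bnz//.
  by case: QNy.
  by case: QNy.
apply: frame_ext fv => y QNy.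
by rewrite thE// scalerA vE.
Qed.

End SmoothBases.
End GerbePointwise.

(** * Existence of a trivialization *)

Section Trivialize.
Context (R : realType) (n : nat) (X : manifold R n) (G : gerbe X).
Local Notation I := (gidx G).
Local Notation U := (gU G).
Local Notation L := (@gl R n X G).

Lemma refinement_trans (J K : Type) (V : J -> set X) (W : K -> set X)
    (tau : J -> I) (sigma : K -> J) :
  refinement U V tau -> refinement V W sigma -> refinement U W (tau \o sigma).
Proof.
move=> [_ VU] [oW WV]; split=> // a; apply: subset_trans (WV a) _.
exact: VU.
Qed.

(** Rescaling the t_ab by a cochain with coboundary r turns the s_abc into the
    products of the rescaled trivializations.  The coboundary involves the inverse of
    g_ae where the product involves g_ea; these agree because gs_inverse gives
    r_aea r_eaa = 1, which reads g_ea g_ae = 1. *)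
Lemma rescaled_frames (J K : Type) (V : J -> set X) (W : K -> set X)
    (tau : J -> I) (sigma : K -> J)
    (t : forall a b, Defs.section (L (tau a) (tau b))) (r : J -> J -> J -> X -> R)
    (g : K -> K -> X -> R) :
  refinement U V tau -> local_frames V t -> frame_cocycle V t r ->
  refinement V W sigma ->
  (forall a b x, W a x -> W b x -> g a b x != 0) ->
  (forall a b e x, W a x -> W b x -> W e x ->
     r (sigma a) (sigma b) (sigma e) x = g b e x * (g a e x)^-1 * g a b x) ->
  forall a b e x, W a x -> W b x -> W e x ->
    gs (tau (sigma a)) (tau (sigma b)) (tau (sigma e)) x =
    tens (tens (g a b x *: t (sigma a) (sigma b) x)
               (g b e x *: t (sigma b) (sigma e) x))
         (g e a x *: t (sigma e) (sigma a) x).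
Proof.
move=> [oV VU] [st t0 tp] fr [oW WV] g0 rg a b e x Wa Wb We.
have Vof k : W k x -> V (sigma k) x by apply: WV.
have Uof k : W k x -> U (tau (sigma k)) x by move=> /Vof; apply: VU.
have gsE i j k : W i x -> W j x -> W k x ->
   gs (tau (sigma i)) (tau (sigma j)) (tau (sigma k)) x =
   tens (tens (r (sigma i) (sigma j) (sigma k) x *: t (sigma i) (sigma j) x)
     (t (sigma j) (sigma k) x)) (t (sigma k) (sigma i) x).
  by move=> Wi Wj Wk; rewrite fr; [rewrite !tensZl|exact: Vof|exact: Vof|exact: Vof].
have rr i j k : W i x -> W j x -> W k x ->
   r (sigma i) (sigma j) (sigma k) x * r (sigma j) (sigma i) (sigma k) x = 1.
  move=> Wi Wj Wk.
  have := gs_inverse (Uof _ Wi) (Uof _ Wj) (Uof _ Wk) (gsE i j k Wi Wj Wk)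
    (gsE j i k Wj Wi Wk).
  rewrite gpair_scale (tp _ _ _ (Vof _ Wi) (Vof _ Wj)).
  by rewrite (tp _ _ _ (Vof _ Wj) (Vof _ Wk)) (tp _ _ _ (Vof _ Wk) (Vof _ Wi)) !mulr1.
have gV i k : W i x -> W k x -> g k i x * g i k x = 1.
  move=> Wi Wk; have := rr i k i Wi Wk Wi; rewrite !rg// => <-.
  by field; rewrite !g0.
rewrite gsE// !(tensZl, tensZr) !scalerA; congr (_ *: _).
rewrite rg// -[X in _ * X * _]mul1r -(gV a e)//.
by field; rewrite g0.
Qed.

Lemma rescaled_frame_on (J K : Type) (V : J -> set X) (W : K -> set X)
    (tau : J -> I) (sigma : K -> J)
    (t : forall a b, Defs.section (L (tau a) (tau b))) (g : K -> K -> X -> R) :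
  refinement U V tau -> local_frames V t -> refinement V W sigma ->
  (forall a b, smooth_unit (W a `&` W b) (g a b)) ->
  forall a b, frame_on (W a `&` W b) (fun x => g a b x *: t (sigma a) (sigma b) x).
Proof.
move=> [[oV _] VU] [st t0 tp] [[oW _] WV] sg a b.
have oN : open (W a `&` W b) by exact: openI.
have sub : W a `&` W b `<=` V (sigma a) `&` V (sigma b).
  by move=> x [/WV ? /WV ?].
apply: (frame_scale (gl_bundle (tau (sigma a)) (tau (sigma b)))) (sg a b).
  split=> //; first by apply: smooth_section_sub (st _ _).
  by move=> x /sub[? ?]; exact: t0.
by move=> x /sub[/VU ? /VU ?].
Qed.

Section Build.
Variables (K : Type) (W : K -> set X) (tau : K -> I).
Variable T : forall a b, Defs.section (L (tau a) (tau b)).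
Hypothesis ref : refinement U W tau.
Hypothesis fT : forall a b, frame_on (W a `&` W b) (T a b).
Hypothesis gsT : forall a b e x, W a x -> W b x -> W e x ->
  gs (tau a) (tau b) (tau e) x = tens (tens (T a b x) (T b e x)) (T e a x).

Variable theta : forall i j, Defs.section (L i j).
Hypothesis theta0 : forall i j x, U i x -> U j x -> theta i j x != 0.
Hypothesis thetaV : forall i j x, U i x -> U j x ->
  (gpair i j x (tens (theta i j x) (theta j i x)) : R) = 1.
Hypothesis thetaS : forall i j k x, U i x -> U j x -> U k x ->
  gs i j k x = tens (tens (theta i j x) (theta j k x)) (theta k i x).

Variable z : X -> K.
Hypothesis zP : forall x, W (z x) x.

Let ratio a b x : R := dvec (theta (tau a) (tau b) x) (T a b x).
Let q a x : R := ratio a (z x) x.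

Let WU a x : W a x -> U (tau a) x.
Proof. by have [_] := ref; apply. Qed.

Let TE a b x : W a x -> W b x -> T a b x = ratio a b x *: theta (tau a) (tau b) x.
Proof.
move=> Wa Wb; apply: line_coef; first by apply: gl_line; exact: WU.
by apply: theta0; exact: WU.
Qed.

Let ratio_cocycle x a b e : W a x -> W b x -> W e x ->
  ratio a b x * ratio b e x * ratio e a x = 1.
Proof.
move=> Wa Wb We; have := gsT Wa Wb We.
have Ua := WU Wa; have Ub := WU Wb; have Ue := WU We.
rewrite thetaS// !TE// !(tensZl, tensZr) !scalerA.
set S := tens (tens _ _) _; have S0 : S != 0 by do 2?apply: tens_neq0; exact: theta0.
by rewrite -{1}[S]scale1r => /(scale_line_inj S0) ->; ring.
Qed.

Let ratioP x := @real_cocycle R K (fun a => W a x) (fun a b => ratio a b x)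
  (fun a b e => @ratio_cocycle x a b e).

Let q0 a x : W a x -> q a x != 0.
Proof. by move=> Wa; have [+ _] := ratioP x; apply. Qed.

Let ratio_q a b x : W a x -> W b x -> ratio a b x = q a x / q b x.
Proof.
move=> Wa Wb; have [n0 [V M]] := ratioP x.
by rewrite /q (M a b (z x))// mulfK// n0.
Qed.

(** The line bundle l_i: over W_a its frames are those of l_(i, tau a), and over the
    intersection of W_a and W_b this is identified with l_(i, tau b) through T_ab.  As
    T_ab = (q_a / q_b) theta_ab, the bases theta_(i, tau a) / q_a correspond to one
    another.  They serve as basis of the fibres, which thus all become R, while the
    smooth structure records which multiples p of them are smooth. *)
Definition glued_bundle (i : I) : lbundle X :=
  @LBundle R n X (fun=> (R^o : vectType R))
    [set Np : set X * (X -> R^o) | open Np.1 /\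
       forall a, smooth_multiple theta i (tau a) (Np.1 `&` U i `&` W a)
         (fun x => (Np.2 x : R) / q a x)].

Let oUi i : open (U i). Proof. exact: gU_open. Qed.
Let oWa a : open (W a). Proof. by have [[+ _] _] := ref; apply. Qed.

Lemma line_regular : line (R^o : vectType R).
Proof. by rewrite /line dimvf. Qed.

Lemma glued_bundle_ratio i N N' (p p' : X -> R^o) :
  frames_of (glued_bundle i) (N, p) -> frames_of (glued_bundle i) (N', p') ->
  smooth_on (U i `&` N `&` N') (fun x => (p' x : R) / p x).
Proof.
move=> [/= oN Np] [/= oN' Np']; apply: smooth_local => x [[Ux Nx] N'x].
have Wx := zP x; set a := z x in Wx.
have oQ : open (N `&` N' `&` U i `&` W a) by do 3?apply: openI.
exists (N `&` N' `&` U i `&` W a) => //.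
have sub : N `&` N' `&` U i `&` W a `<=` U i `&` U (tau a).
  by move=> y [[_ ?] /WU ?].
have f1 : smooth_multiple theta i (tau a) (N `&` N' `&` U i `&` W a)
    (fun x => (p x : R) / q a x).
  by apply: frame_sub (Np a) => // y [[[? ?] ?] ?].
have f2 : smooth_multiple theta i (tau a) (N `&` N' `&` U i `&` W a)
    (fun x => (p' x : R) / q a x).
  by apply: frame_sub (Np' a) => // y [[[? ?] ?] ?].
have [sc _] := coefs_unit (gl_bundle i (tau a)) f1 f2 sub.
apply: smooth_ext sc => // y Qy; have [Uy Wy] := sub y Qy.
have [_ _ /(_ y Qy)] := f1; rewrite scaler_eq0 negb_or => /andP[pq0 th0].
have qy : q a y != 0 by apply: q0; case: Qy.
rewrite /coefs dvecV//; last exact: gl_line.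
rewrite scale_lfunE dvecZZ// /GRing.scale/= invfM invrK mulrCA.
by rewrite mulfK.
Qed.

Lemma glued_frame_neq0 i N (p : X -> R^o) x : frames_of (glued_bundle i) (N, p) ->
  U i x -> N x -> p x != 0.
Proof.
move=> [/= oN Np] Ux Nx; have Wx := zP x.
have [_ _ /(_ x)] := Np (z x); rewrite scaler_eq0 negb_or mulf_eq0 negb_or.
by move=> /(_ (conj (conj Nx Ux) Wx)) /andP[/andP[]].
Qed.

Lemma smooth_multiple_of_section i a N (e : Defs.section (L i (tau a))) :
  frame_on N e -> N `<=` U i `&` W a ->
  forall b, smooth_multiple theta i (tau b) (N `&` W b)
    (fun x => dvec (theta i (tau a) x) (e x) * q a x / q b x).
Proof.
move=> fe NU b; have [oN se e0] := fe.
have oNW : open (N `&` W b) by exact: openI.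
have f1 : smooth_multiple theta i (tau a) (N `&` W b)
    (fun x => dvec (theta i (tau a) x) (e x)).
  apply: (@frame_ext _ _ _ _ _ e); last by apply: frame_sub fe => // y [].
  move=> y [Ny Wb]; have [Uy Wa] := NU _ Ny.
  by apply: line_coef; [apply: gl_line => //; exact: WU|apply: theta0 => //; exact: WU].
have f2 : smooth_multiple theta (tau a) (tau b) (N `&` W b)
    (fun x => q a x / q b x).
  apply: (@frame_ext _ _ _ _ _ (T a b)).
    by move=> y [/NU[Uy Wa] Wb]; rewrite TE// ratio_q.
  by apply: frame_sub (fT a b) => // y [/NU[]].
apply: frame_ext (smooth_multiple_mul theta0 thetaV thetaS _ f1 f2).
  by move=> y _; rewrite mulrA.
by move=> y [/NU[Uy /WU Wa] /WU Wb].
Qed.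

Lemma glued_bundle_is_lbundle i : is_lbundle (U i) (glued_bundle i).
Proof.
split=> [x _|N p Np|x Ux|N p N' p' Np Np'].
- exact: line_regular.
- split; first by case: Np.
  by move=> x; exact: glued_frame_neq0 Np.
- have Wx := zP x; set a := z x in Wx.
  have oUW : open (U i `&` U (tau a)) by exact: openI.
  have [N [e [fe Nx NU]]] := local_frame oUW (gl_bundle i (tau a)) (conj Ux (WU Wx)).
  have [oN _ _] := fe.
  have fe' : frame_on (N `&` W a) e by exact: frameI.
  have NU' : N `&` W a `<=` U i `&` W a by move=> y [/NU[]].
  exists (N `&` W a), (fun y => dvec (theta i (tau a) y) (e y) * q a y); split=> //.
  split=> /=; first exact: openI.
  move=> b; apply: frame_sub (smooth_multiple_of_section fe' NU' b).
    by do 3?apply: openI.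
  by move=> y [[? ?] ?].
- exists (fun x => (p' x : R) / p x); split; first exact: glued_bundle_ratio Np Np'.
  move=> x Ux Nx N'x; rewrite /GRing.scale/= divfK//.
  exact: glued_frame_neq0 Np Ux Nx.
Qed.

(** In terms of theta_(i, tau a) and theta_(j, tau a), the basis of l_i (x) l_j^* is
    their quotient, that is theta_ij. *)
Definition glued_iso i j : bundle_map (tensb (glued_bundle i) (dualb (glued_bundle j)))
    (L i j) := fun x =>
  hom_of (tens (1 : R^o) (dvec (1 : R^o))) (theta i j x).

Let one0 : (1 : R^o) != 0. Proof. exact: oner_neq0. Qed.
Let one_tens0 : tens (1 : R^o) (dvec (1 : R^o)) != 0.
Proof. by apply: tens_neq0 => //; exact: dvec_vec_neq0. Qed.

Lemma tens_dual_regular (a b : R^o) : b != 0 ->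
  tens a (dvec b) = ((a : R) / b) *: tens (1 : R^o) (dvec (1 : R^o)).
Proof.
move=> b0; rewrite -{1}[a]mulr1 -[X in dvec X](mulr1 b).
rewrite -/(GRing.scale (a : R) (1 : R^o)) -/(GRing.scale (b : R) (1 : R^o)).
rewrite dvecV//; last exact: line_regular.
by rewrite tensZl tensZr scalerA.
Qed.

Lemma glued_isoE i j x (a b : R^o) : b != 0 ->
  glued_iso i j x (tens a (dvec b)) = ((a : R) / b) *: theta i j x.
Proof. by move=> b0; rewrite /glued_iso hom_ofE (tens_dual_regular a b0) dvecZZ. Qed.

Lemma glued_iso_is_iso i j : is_bundle_iso (U i `&` U j) (glued_iso i j).
Proof.
have bi : is_lbundle (U i `&` U j) (glued_bundle i).
  by apply: is_lbundle_sub (glued_bundle_is_lbundle i) => x [].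
have bj : is_lbundle (U i `&` U j) (glued_bundle j).
  by apply: is_lbundle_sub (glued_bundle_is_lbundle j) => x [].
have oUU : open (U i `&` U j) by exact: openI.
have bt := tensb_lbundle oUU bi (dualb_lbundle oUU bj).
split=> [x [ix jx]|V s oV VU ss].
  apply: (@line_hom_bijective _ _ _ _ (tens (1 : R^o) (dvec (1 : R^o)))) => //.
  - by apply: line_tens; [|apply: line_dual]; exact: line_regular.
  - exact: gl_line.
  - by rewrite /glued_iso hom_ofE dvec_self// scale1r theta0.
apply: (smooth_section_local (gl_bundle i j)) => // x Vx.
have [ix jx] := VU _ Vx; have Wx := zP x; set a := z x in Wx.
have [N [p [Np Nx]]] : exists N p, frames_of (glued_bundle i) (N, p) /\ N x.
  by have [_ _ + _] := glued_bundle_is_lbundle i; apply.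
have [N' [p' [Np' N'x]]] : exists N p, frames_of (glued_bundle j) (N, p) /\ N x.
  by have [_ _ + _] := glued_bundle_is_lbundle j; apply.
have oN : open N by case: Np.
have oN' : open N' by case: Np'.
pose Q := V `&` N `&` N' `&` W a.
have oQ : open Q by do 3?apply: openI.
have QU : Q `<=` U i `&` U j by move=> y [[[/VU]]].
have fp : frame_on (l := glued_bundle i) Q p.
  apply: frame_sub (frames_frame_on (oUi i) (glued_bundle_is_lbundle i) Np) => //.
  by move=> y [[[/VU[]]]].
have fp' : frame_on (l := glued_bundle j) Q p'.
  apply: frame_sub (frames_frame_on (oUi j) (glued_bundle_is_lbundle j) Np') => //.
  by move=> y [[[/VU[]]]].
have fd := frame_dual bj fp' QU.
have ft := frame_tens bi (dualb_lbundle oUU bj) fp fd.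
have sF := coefs_smooth bt ft QU oQ (fun _ h => h)
  (smooth_section_sub (fun y (h : Q y) => h.1.1.1) ss).
exists Q; split=> //.
have f1 : smooth_multiple theta i (tau a) Q (fun x => (p x : R) / q a x).
  by have [_ /(_ a)] := Np; apply: frame_sub => // y [[[/VU[? ?] ?] ?] ?].
have f2 : smooth_multiple theta j (tau a) Q (fun x => (p' x : R) / q a x).
  by have [_ /(_ a)] := Np'; apply: frame_sub => // y [[[/VU[? ?] ?] ?] ?].
have f2' := smooth_multiple_inv thetaV _ f2.
have {}f2' : smooth_multiple theta (tau a) j Q (fun x => ((p' x : R) / q a x)^-1).
  by apply: f2' => y [[[/VU[? ?] ?] ?] /WU].
have f3 : smooth_multiple theta i j Q (fun x => (p x : R) / p' x).
  apply: (@frame_ext _ _ _ _ _ (fun y => ((p y : R) / q a y * ((p' y : R) / q a y)^-1)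
      *: theta i j y)).
    move=> y Qy; congr (_ *: _); rewrite invfM invrK mulrCA -mulrA.
    rewrite mulVf; last by apply: q0; case: Qy.
    by rewrite mulr1 mulrC.
  apply: (smooth_multiple_mul theta0 thetaV thetaS _ f1 f2').
  by move=> y [[[/VU[? ?] ?] ?] /WU].
have [_ s3 _] := f3.
apply: (@smooth_section_ext _ _ _ _ _ (fun y => coefs (l := tensb (glued_bundle i) (dualb (glued_bundle j)))
    (fun y => tens (p y) (dvec (p' y))) s y *: (((p y : R) / p' y) *: theta i j y))).
  move=> y Qy; have [_ _ t0] := ft; have [_ _ p0'] := fp'.
  have sE := @coefsE _ _ _ _ _ bt (fun y => tens (p y) (dvec (p' y))) s y
    (QU _ Qy) (t0 y Qy).
  rewrite -(@glued_isoE i j y (p y) (p' y) (p0' y Qy)) -linearZ.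
  exact: (congr1 (glued_iso i j y) (esym sE)).
exact: (section_of_coef (gl_bundle i j) f3).
Qed.

Lemma glued_iso_gs i j k x : U i x -> U j x -> U k x ->
  forall (a b c : R^o) (a' b' c' : dualv (R^o : vectType R)),
  a' a = 1 -> b' b = 1 -> c' c = 1 ->
  gs i j k x = tens (tens (glued_iso i j x (tens a b')) (glued_iso j k x (tens b c')))
                    (glued_iso k i x (tens c a')).
Proof.
move=> ix jx kx a b c a' b' c' a1 b1 c1.
have nz (d : R^o) (d' : dualv (R^o : vectType R)) : d' d = 1 -> d != 0.
  move=> d1; apply: contra_eq_neq d1 => ->.
  by rewrite linear0 eq_sym oner_neq0.
have a0 := nz _ _ a1; have b0 := nz _ _ b1; have c0 := nz _ _ c1.
rewrite (dvec_unique line_regular a0 a1) (dvec_unique line_regular b0 b1).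
rewrite (dvec_unique line_regular c0 c1) !glued_isoE//.
rewrite !(tensZl, tensZr) !scalerA thetaS//.
set k0 := (X in _ = X *: _); suff -> : k0 = 1 by rewrite scale1r.
by rewrite /k0; field; rewrite a0 b0 c0.
Qed.

Definition glued_trivialization : trivialization G :=
  @Trivialization R n X G glued_bundle glued_bundle_is_lbundle glued_iso
    glued_iso_is_iso glued_iso_gs.

End Build.

Lemma trivialization_exists : gerbe_class_trivial G -> inhabited (trivialization G).
Proof.
move=> [J [V [tau [t [r [rV ft fr [K [W [sigma [g [rW sg rg]]]]]]]]]]].
have [theta [theta0 thetaV thetaS]] := pointwise_bases G.
have rUW := refinement_trans rV rW.
have [[_ cW] _] := rW; have [z zP] := choice cW.
have g0 a b x : W a x -> W b x -> g a b x != 0.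
  by move=> Wa Wb; have [_] := sg a b; apply.
split; exact: (@glued_trivialization K W (tau \o sigma)
  (fun a b x => g a b x *: t (sigma a) (sigma b) x) rUW
  (rescaled_frame_on rV ft rW sg) (rescaled_frames rV ft fr rW g0 rg)
  theta theta0 thetaV thetaS z zP).
Qed.

End Trivialize.

(** * Patching two trivializations *)

Section TrivializationFrames.
Context (R : realType) (n : nat) (X : manifold R n) (G : gerbe X).
Local Notation I := (gidx G).
Local Notation U := (gU G).
Local Notation L := (@gl R n X G).

Section One.
Variable T : trivialization G.

(** The element u (x) v^* of l_ij, with v^* dual to v. *)
Definition quot i j x (u : tl T i x) (v : tl T j x) : L i j x :=
  tiso T i j x (tens u (dvec v)).

Lemma tl_line i x : U i x -> line (tl T i x).
Proof. by move=> ix; exact: (bundle_line (tl_bundle T i) ix). Qed.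

Lemma quot_neq0 i j x (u : tl T i x) (v : tl T j x) : U i x -> U j x ->
  u != 0 -> v != 0 -> quot u v != 0.
Proof.
move=> ix jx u0 v0; have [bij _] := @tiso_iso _ _ _ _ T i j.
apply: (hom_inj_neq0 (bij x (conj ix jx))).
by apply: tens_neq0 => //; exact: dvec_vec_neq0.
Qed.

Lemma quotZ i j x (u : tl T i x) (v : tl T j x) a b : U j x -> v != 0 -> b != 0 ->
  quot (a *: u) (b *: v) = (a / b) *: quot u v.
Proof.
move=> jx v0 b0; rewrite /quot dvecV//; last exact: tl_line.
by rewrite tensZl tensZr scalerA linearZ.
Qed.

Lemma quot_gs i j k x (u : tl T i x) (v : tl T j x) (w : tl T k x) :
  U i x -> U j x -> U k x -> u != 0 -> v != 0 -> w != 0 ->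
  gs i j k x = tens (tens (quot u v) (quot v w)) (quot w u).
Proof.
by move=> ix jx kx u0 v0 w0; apply: tiso_gs => //; exact: dvec_self.
Qed.

Lemma frame_quot i j Q (e : Defs.section (tl T i)) (f : Defs.section (tl T j)) :
  frame_on Q e -> frame_on Q f -> Q `<=` U i `&` U j ->
  frame_on Q (fun x => quot (e x) (f x)).
Proof.
move=> fe ff QU; have [oQ _ _] := fe.
have bi : is_lbundle Q (tl T i) by apply: is_lbundle_sub (tl_bundle T i) => x /QU[].
have bj : is_lbundle Q (tl T j) by apply: is_lbundle_sub (tl_bundle T j) => x /QU[].
have fd := frame_dual bj ff (fun _ h => h).
have ft := frame_tens bi (dualb_lbundle oQ bj) fe fd.
exact: (frame_iso ft QU (tiso_iso T i j)).
Qed.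

Lemma tl_dual_lbundle i : is_lbundle (U i) (dualb (tl T i)).
Proof. by apply: dualb_lbundle; [exact: gU_open|exact: tl_bundle]. Qed.

End One.

Section Two.
Variables T T' : trivialization G.

Lemma frame_tens_dual i Q (e : Defs.section (tl T i)) (f : Defs.section (tl T' i)) :
  frame_on Q e -> frame_on Q f -> Q `<=` U i ->
  frame_on (l := tensb (tl T i) (dualb (tl T' i))) Q (fun x => tens (e x) (dvec (f x))).
Proof.
move=> fe ff QU; have fd := frame_dual (tl_bundle T' i) ff QU.
exact: (frame_tens (tl_bundle T i) (tl_dual_lbundle T' i) fe fd).
Qed.

Lemma tens_dual_lbundle i : is_lbundle (U i) (tensb (tl T i) (dualb (tl T' i))).
Proof.
by apply: tensb_lbundle; [exact: gU_open|exact: tl_bundle|exact: tl_dual_lbundle].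
Qed.

(** Frames of l_i and l'_i on a common neighbourhood. *)
Lemma local_frame_pair i x : U i x -> exists Q e f,
  [/\ frame_on (l := tl T i) Q e, frame_on (l := tl T' i) Q f, Q x & Q `<=` U i].
Proof.
move=> ix; have [Q [e [fe Qx QU]]] := local_frame (gU_open i) (tl_bundle T i) ix.
have [Q' [f [ff Q'x Q'U]]] := local_frame (gU_open i) (tl_bundle T' i) ix.
have [oQ _ _] := fe; have [oQ' _ _] := ff.
exists (Q `&` Q'), e, f; split=> //.
- exact: frameI.
- by rewrite setIC; exact: frameI.
- by move=> y [/QU].
Qed.

Variable e : forall i x, tl T i x.
Variable f : forall i x, tl T' i x.
Hypothesis e0 : forall i x, U i x -> e i x != 0.
Hypothesis f0 : forall i x, U i x -> f i x != 0.
Hypothesis ef : forall i j x, U i x -> U j x ->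
  quot (e i x) (e j x) = quot (f i x) (f j x).

(** As for l_i, arbitrary bases of the fibres are chosen, here e_i (x) f_i^*, and the
    smooth structure records which multiples of them are smooth.  The bases for i and j
    are identified because e_i (x) e_j^* and f_i (x) f_j^* agree in l_ij. *)
Definition patched_bundle : lbundle X :=
  @LBundle R n X (fun=> (R^o : vectType R))
    [set Np : set X * (X -> R^o) | open Np.1 /\
       forall i, frame_on (l := tensb (tl T i) (dualb (tl T' i))) (Np.1 `&` U i)
         (fun x => (Np.2 x : R) *: tens (e i x) (dvec (f i x)))].

Let ef0 i x : U i x -> tens (e i x) (dvec (f i x)) != 0.
Proof. by move=> ix; apply: tens_neq0; [exact: e0|apply: dvec_vec_neq0; exact: f0]. Qed.

Let cov x : exists i, U i x. Proof. by have [_] := gU_cover G; apply. Qed.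

Lemma patched_frame_neq0 N (p : X -> R^o) x : frames_of patched_bundle (N, p) ->
  N x -> p x != 0.
Proof.
move=> [/= oN Np] Nx; have [i ix] := cov x.
by have [_ _ /(_ x (conj Nx ix))] := Np i; rewrite scaler_eq0 negb_or => /andP[].
Qed.

(** A smooth frame p (x) p'^* over U_i is smooth when seen from U_j: comparing it with
    a frame g (x) g'^* there yields the quotient of the frames p (x) g^* and
    p' (x) g'^* of l_ij. *)
Lemma patched_frame_exists i N (p : Defs.section (tl T i)) (p' : Defs.section (tl T' i)) :
  frame_on N p -> frame_on N p' -> N `<=` U i ->
  frames_of patched_bundle
    (N, fun x => dvec (tens (e i x) (dvec (f i x))) (tens (p x) (dvec (p' x)))).
Proof.
move=> fp fp' NU; have [oN sp p0] := fp; have [_ sp' p0'] := fp'; split=> //= j.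
have oNj : open (N `&` U j) by apply: openI => //; exact: gU_open.
apply: (frame_glue (tens_dual_lbundle j)) => //.
move=> y [Ny jy]; have [Q [g [g' [fg fg' Qy QU]]]] := local_frame_pair jy.
have [oQ sg g0] := fg; have [_ sg' g0'] := fg'.
have oM : open (N `&` Q) by exact: openI.
have MN : N `&` Q `<=` N by move=> w [].
have MQ : N `&` Q `<=` Q by move=> w [].
have MU : N `&` Q `<=` U i `&` U j by move=> w [/NU ? /QU ?].
have MU' : N `&` Q `<=` U j by move=> w [_ /QU].
have fpM := frame_sub oM MN fp; have fpM' := frame_sub oM MN fp'.
have fgM := frame_sub oM MQ fg; have fgM' := frame_sub oM MQ fg'.
have fu := frame_quot fpM fgM MU; have fu' := frame_quot fpM' fgM' MU.
have ratio := coefs_unit (gl_bundle i j) fu' fu MU.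
exists (N `&` Q) => //.
apply: frame_ext (frame_scale (tens_dual_lbundle j) (frame_tens_dual fgM fgM' MU') MU' ratio).
move=> w Mw; have [Nw Qw] := Mw; have [iw jw] := MU _ Mw.
have Ei : p w = dvec (e i w) (p w) *: e i w by apply: line_coef; [exact: tl_line|exact: e0].
have Ei' : p' w = dvec (f i w) (p' w) *: f i w by apply: line_coef; [exact: tl_line|exact: f0].
have Ej : g w = dvec (e j w) (g w) *: e j w by apply: line_coef; [exact: tl_line|exact: e0].
have Ej' : g' w = dvec (f j w) (g' w) *: f j w by apply: line_coef; [exact: tl_line|exact: f0].
have al0 : dvec (e i w) (p w) != 0.
  by apply: dvec_neq0; [exact: tl_line|exact: e0|exact: p0].
have be0 : dvec (f i w) (p' w) != 0.
  by apply: dvec_neq0; [exact: tl_line|exact: f0|exact: p0'].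
have ga0 : dvec (e j w) (g w) != 0.
  by apply: dvec_neq0; [exact: tl_line|exact: e0|exact: g0].
have de0 : dvec (f j w) (g' w) != 0.
  by apply: dvec_neq0; [exact: tl_line|exact: f0|exact: g0'].
move: Ei Ei' Ej Ej' al0 be0 ga0 de0.
set al := dvec (e i w) _; set be := dvec (f i w) _.
set ga := dvec (e j w) _; set de := dvec (f j w) _.
move=> -> -> -> -> al0 be0 ga0 de0.
have eiw := e0 iw; have fiw := f0 iw; have ejw := e0 jw; have fjw := f0 jw.
have tq : quot (f i w) (f j w) != 0 by exact: quot_neq0.
rewrite /coefs.
have -> : quot (p w) (g w) = (al / ga) *: quot (f i w) (f j w).
  rewrite -ef// -quotZ//; congr (quot _ _); apply: line_coef => //; exact: tl_line.
have -> : quot (p' w) (g' w) = (be / de) *: quot (f i w) (f j w).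
  rewrite -quotZ//; congr (quot _ _); apply: line_coef => //; exact: tl_line.
rewrite dvecV//; [|exact: gl_line|by rewrite mulf_neq0// invr_eq0].
rewrite scale_lfunE dvecZZ//.
rewrite !dvecV//; try exact: tl_line.
rewrite !(tensZl, tensZr) !scalerA dvecZZ; last exact: ef0.
congr (_ *: _); rewrite /GRing.scale/=; field.
by rewrite be0 ga0 de0.
Qed.

Lemma patched_bundle_is_lbundle : is_lbundle setT patched_bundle.
Proof.
split=> [x _|N p Np|x _|N p N' p' Np Np'].
- exact: line_regular.
- split; first by case: Np.
  by move=> x _; exact: patched_frame_neq0 Np.
- have [i ix] := cov x.
  have [Q [g [g' [fg fg' Qx QU]]]] := local_frame_pair ix.
  by have := patched_frame_exists fg fg' QU; eexists; eexists; split; [eassumption|].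
- exists (fun x => (p' x : R) / p x); split; last first.
    move=> x _ Nx N'x; rewrite /GRing.scale/= divfK//.
    exact: patched_frame_neq0 Np Nx.
  rewrite setTI; apply: smooth_local => x [Nx N'x]; have [i ix] := cov x.
  have [/= oN Ni] := Np; have [/= oN' Ni'] := Np'.
  have oQ : open (N `&` N' `&` U i) by do 2?apply: openI => //; exact: gU_open.
  exists (N `&` N' `&` U i) => //.
  have f1 := frame_sub oQ (fun y (h : (N `&` N' `&` U i) y) => conj h.1.1 h.2) (Ni i).
  have f2 := frame_sub oQ (fun y (h : (N `&` N' `&` U i) y) => conj h.1.2 h.2) (Ni' i).
  have QU : N `&` N' `&` U i `<=` U i by move=> y [].
  have [sc _] := coefs_unit (tens_dual_lbundle i) f1 f2 QU.
  apply: smooth_ext sc => // y [[Ny N'y] iy].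
  have py := patched_frame_neq0 Np Ny.
  rewrite /coefs dvecV//; [|exact: (bundle_line (tens_dual_lbundle i) iy)|exact: ef0].
  by rewrite scale_lfunE dvecZZ ?ef0// /GRing.scale/= mulrC.
Qed.

Definition patching_iso i : bundle_map patched_bundle (tensb (tl T i) (dualb (tl T' i))) :=
  fun x => hom_of (1 : R^o) (tens (e i x) (dvec (f i x))).

Lemma patching_isoE i x (v : R^o) :
  patching_iso i x v = (v : R) *: tens (e i x) (dvec (f i x)).
Proof.
rewrite /patching_iso hom_ofE; congr (_ *: _).
have := dvecZZ (v : R) (oner_neq0 R : (1 : R^o) != 0).
by rewrite {1}/GRing.scale/= mulr1.
Qed.

Lemma patching_iso_is_iso i : is_bundle_iso (U i) (@patching_iso i).
Proof.
split=> [x ix|V s oV VU ss].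
  apply: (@line_hom_bijective _ _ _ _ (1 : R^o)); first exact: line_regular.
  - exact: (bundle_line (tens_dual_lbundle i) ix).
  - exact: oner_neq0.
  - by rewrite patching_isoE scale1r; exact: ef0.
apply: (smooth_section_local (tens_dual_lbundle i)) => // x Vx.
have [N [p [Np Nx]]] : exists N p, frames_of patched_bundle (N, p) /\ N x.
  by have [_ _ + _] := patched_bundle_is_lbundle; apply.
have [/= oN Ni] := Np; have [a [sa aE]] := ss N p Np.
have oQ : open (V `&` N) by exact: openI.
have oNi : open (N `&` U i) by apply: openI => //; exact: gU_open.
exists (V `&` N); split=> //.
apply: (@smooth_section_ext _ _ _ (tensb (tl T i) (dualb (tl T' i))) _
  (fun y => a y *: ((p y : R) *: tens (e i y) (dvec (f i y))))).
  move=> y [Vy Ny]; rewrite aE//.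
  by rewrite [RHS](patching_isoE i y (a y *: p y)) scalerA.
have QU : N `&` U i `<=` U i by move=> y [].
apply: (section_of_coef (tens_dual_lbundle i) (Ni i) oQ _ QU sa).
by move=> y [/VU ? ?].
Qed.

Lemma is_patching_patched : is_patching T T' patched_bundle patching_iso.
Proof.
split; [exact: patched_bundle_is_lbundle|exact: patching_iso_is_iso|].
move=> i j x ix jx v u u' uu' w.
have ei := e0 ix; have ej := e0 jx; have fi := f0 ix; have fj := f0 jx.
have tee : tens (e i x) (dvec (e j x)) != 0 by apply: tens_neq0 => //; exact: dvec_vec_neq0.
have tff : tens (f i x) (dvec (f j x)) != 0 by apply: tens_neq0 => //; exact: dvec_vec_neq0.
have uE : u = dvec (tens (e i x) (dvec (e j x))) u *: tens (e i x) (dvec (e j x)).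
  apply: line_coef => //; apply: line_tens; first exact: tl_line.
  by apply: line_dual; exact: tl_line.
have u'E : u' = dvec (tens (f i x) (dvec (f j x))) u' *: tens (f i x) (dvec (f j x)).
  apply: line_coef => //; apply: line_tens; first exact: tl_line.
  by apply: line_dual; exact: tl_line.
have wE : w = dvec (f j x) w *: f j x by apply: line_coef => //; exact: tl_line.
move: uE u'E wE; set a := dvec _ u; set b := dvec _ u'; set d := dvec _ w.
move=> uE u'E wE.
have ab : a = b.
  move: uu'; rewrite uE u'E !linearZ /=.
  rewrite -/(quot (e i x) (e j x)) -/(quot (f i x) (f j x)) -ef//.
  by apply: scale_line_inj; exact: quot_neq0.
rewrite !patching_isoE uE u'E wE.
rewrite !(contractvZ, contractvZr) !contractvE !dvec_self//.
rewrite !scale1r !dvec_self// !scale1r.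
by rewrite !scalerA ab; congr (_ *: _); ring.
Qed.

End Two.

(** At each point, the two families of bases of the l_ij induced by bases of the l_i
    and of the l'_i differ by a real cocycle, hence by a coboundary; rescaling the
    bases of the l'_i removes it. *)
Lemma patching_exists (T T' : trivialization G) : exists xi psi, is_patching T T' xi psi.
Proof.
have [_ cov] := gU_cover G; have [z /= zP] := choice cov.
pose e i x : tl T i x := vpick {:tl T i x}.
pose f1 i x : tl T' i x := vpick {:tl T' i x}.
have e0 i x : U i x -> e i x != 0 by move=> ix; apply/line_vpick/tl_line.
have f10 i x : U i x -> f1 i x != 0 by move=> ix; apply/line_vpick/tl_line.
pose ka i j x : R := dvec (quot (e i x) (e j x)) (quot (f1 i x) (f1 j x)).
have kaE i j x : U i x -> U j x ->
    quot (f1 i x) (f1 j x) = ka i j x *: quot (e i x) (e j x).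
  move=> ix jx; apply: line_coef; first exact: gl_line.
  by apply: quot_neq0 => //; exact: e0.
have kaP x : forall a b d, U a x -> U b x -> U d x ->
    ka a b x * ka b d x * ka d a x = 1.
  move=> a b d ax bx dx.
  have E1 := quot_gs ax bx dx (e0 _ _ ax) (e0 _ _ bx) (e0 _ _ dx).
  have := quot_gs ax bx dx (f10 _ _ ax) (f10 _ _ bx) (f10 _ _ dx).
  rewrite E1 !kaE// !(tensZl, tensZr) !scalerA.
  set S := tens (tens _ _) _.
  have S0 : S != 0 by do 2?apply: tens_neq0; apply: quot_neq0 => //; exact: e0.
  by rewrite -{1}[S]scale1r => /(scale_line_inj S0) ->; ring.
have ka_c x := @real_cocycle R I (fun a => U a x) (fun a b => ka a b x) (kaP x).
pose k i x := ka i (z x) x.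
have k0 i x : U i x -> k i x != 0 by move=> ix; have [+ _] := ka_c x; apply.
pose f i x := (k i x)^-1 *: f1 i x.
have f0 i x : U i x -> f i x != 0.
  by move=> ix; rewrite scaler_eq0 negb_or invr_eq0 k0// f10.
have ef i j x : U i x -> U j x -> quot (e i x) (e j x) = quot (f i x) (f j x).
  move=> ix jx; rewrite quotZ// ?f10// ?invr_eq0 ?k0// kaE// scalerA.
  have [_ [_ M]] := ka_c x; rewrite invrK.
  have E : k i x = ka i j x * k j x by exact: M.
  have kij : ka i j x != 0 by have [+ _] := ka_c x; apply.
  have kj := k0 j x jx.
  suff -> : (k i x)^-1 * k j x * ka i j x = 1 by rewrite scale1r.
  by rewrite E; field; rewrite kij kj.
by exists (patched_bundle e f), (@patching_iso T T' e f); exact: is_patching_patched.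
Qed.

End TrivializationFrames.

(** * Connections subordinate to a gerbe connection *)

Section LocalConnections.
Context (R : realType) (n : nat) (X : manifold R n) (G : gerbe X).
Local Notation I := (gidx G).
Local Notation U := (gU G).
Local Notation L := (@gl R n X G).

Lemma gUI_open i j : open (U i `&` U j).
Proof. by apply: openI; exact: gU_open. Qed.

(** The form of the tensor product is 0 in the frame s_ijk, which is parallel. *)
Lemma cform_gs (D : gerbe_conn G) i j k Q (u : Defs.section (L i j))
    (v : Defs.section (L j k)) (w : Defs.section (L k i)) :
  is_gerbe_conn D -> frame_on Q u -> frame_on Q v -> frame_on Q w ->
  Q `<=` U i `&` U j `&` U k ->
  (forall x, Q x -> gs i j k x = tens (tens (u x) (v x)) (w x)) ->
  forall c a x, Q x -> mdom c x ->
    cform (D i j) u c a x + cform (D j k) v c a x + cform (D k i) w c a x = 0.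
Proof.
move=> [cD _ pD] fu fv fw QU gsE c a x Qx cx; have [oQ _ _] := fu.
have Qij : Q `<=` U i `&` U j by move=> y /QU[[]].
have Qjk : Q `<=` U j `&` U k by move=> y /QU[[]].
have Qki : Q `<=` U k `&` U i by move=> y /QU[[]].
have bij := is_lbundle_sub Qij (gl_bundle i j).
have bjk := is_lbundle_sub Qjk (gl_bundle j k).
have bki := is_lbundle_sub Qki (gl_bundle k i).
have cij := is_conn_sub Qij (cD i j).
have cjk := is_conn_sub Qjk (cD j k).
have cki := is_conn_sub Qki (cD k i).
have b2 := tensb_lbundle oQ bij bjk.
have c2 := tens_is_conn oQ bij bjk cij cjk.
have f2 := frame_tens bij bjk fu fv.
have f3 := frame_tens b2 bki f2 fw.
have c3 := tens_is_conn oQ b2 bki c2 cki.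
have id : Q `<=` Q by [].
have E3 := cform_tens oQ b2 bki c2 cki f2 fw id a Qx cx.
have E2 := cform_tens oQ bij bjk cij cjk fu fv id a Qx cx.
rewrite /add_form1 E2 /add_form1 in E3; rewrite -E3.
apply: (parallel_cform f3) => // c' a' y Qy cy.
have [_ s3 _] := f3; have [H1 _ _ _ _] := c3 Q oQ id.
have sgs : smooth_section Q (gs i j k).
  by apply: smooth_section_sub (@gs_smooth _ _ _ G i j k).
rewrite (H1 _ (gs i j k) s3 sgs _ c' a' y Qy cy); last by move=> z Qz; rewrite gsE.
by apply: pD => //; exact: QU.
Qed.

Section OneTrivialization.
Variable T : trivialization G.

(** All local frames of the l_i will index the covers of X to which partitions of unity
    are applied: a change of frame within l_i and the passage from l_i to l_j then
    become instances of the same cocycle identity. *)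
Definition lframe i := {p : set X * Defs.section (tl T i) | frame_on p.1 p.2 /\ p.1 `<=` U i}.
Definition ldom i (k : lframe i) : set X := (sval k).1.
Definition lsec i (k : lframe i) : Defs.section (tl T i) := (sval k).2.
Definition lindex := {i : I & lframe i}.

Lemma lframeP i (k : lframe i) : frame_on (ldom k) (lsec k).
Proof. exact: (svalP k).1. Qed.

Lemma ldom_sub i (k : lframe i) : ldom k `<=` U i.
Proof. exact: (svalP k).2. Qed.

Lemma ldom_open i (k : lframe i) : open (ldom k).
Proof. by have [] := lframeP k. Qed.

Lemma lsec_neq0 i (k : lframe i) x : ldom k x -> lsec k x != 0.
Proof. by have [_ _] := lframeP k; apply. Qed.

Lemma lframe_cover i x : U i x -> exists k : lframe i, ldom k x.
Proof.
move=> ix; have [Q [e [fe Qx QU]]] := local_frame (gU_open i) (tl_bundle T i) ix.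
by exists (exist _ (Q, e) (conj fe QU)).
Qed.

Lemma lindex_cover x : exists a : lindex, ldom (projT2 a) x.
Proof.
have [_ cov] := gU_cover G; have [i ix] := cov x.
by have [k kx] := lframe_cover ix; exists (existT _ i k).
Qed.

Definition lquot i j (k : lframe i) (k' : lframe j) : Defs.section (L i j) :=
  fun x => quot (lsec k x) (lsec k' x).

Lemma lframe_pair i j (k : lframe i) (k' : lframe j) :
  [/\ open (ldom k `&` ldom k'), frame_on (ldom k `&` ldom k') (lsec k),
      frame_on (ldom k `&` ldom k') (lsec k') &
      ldom k `&` ldom k' `<=` U i `&` U j].
Proof.
have oQ : open (ldom k `&` ldom k') by apply: openI; exact: ldom_open.
split=> // [||y [/ldom_sub ? /ldom_sub ?]//].
  by apply: frame_sub (lframeP k) => // y [].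
by apply: frame_sub (lframeP k') => // y [].
Qed.

Lemma frame_lquot i j (k : lframe i) (k' : lframe j) :
  frame_on (ldom k `&` ldom k') (lquot k k').
Proof. by have [_ f1 f2] := lframe_pair k k'; exact: frame_quot. Qed.

Lemma lquot_sub i j (k : lframe i) (k' : lframe j) :
  ldom k `&` ldom k' `<=` U i `&` U j.
Proof. by move=> y [/ldom_sub ? /ldom_sub ?]. Qed.

Lemma lquot_gs i j m (k : lframe i) (k' : lframe j) (k'' : lframe m) x :
  ldom k x -> ldom k' x -> ldom k'' x ->
  gs i j m x = tens (tens (lquot k k' x) (lquot k' k'' x)) (lquot k'' k x).
Proof.
move=> kx k'x k''x; apply: quot_gs; [exact: ldom_sub kx|exact: ldom_sub k'x|
  exact: ldom_sub k''x|exact: lsec_neq0 kx|exact: lsec_neq0 k'x|exact: lsec_neq0 k''x].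
Qed.

Lemma quotZl i j a x (u : tl T i x) (v : tl T j x) : quot (a *: u) v = a *: quot u v.
Proof. by rewrite /quot tensZl linearZ. Qed.

(** In l_ii, the section e' (x) e^* is the transition function times e (x) e^*. *)
Lemma lquot_diag i (k k' : lframe i) x : ldom k x -> ldom k' x ->
  coefs (lquot k k) (lquot k' k) x = coefs (lsec k) (lsec k') x.
Proof.
move=> kx k'x; have ix := ldom_sub kx.
have n0 := lsec_neq0 kx; rewrite /coefs /lquot.
rewrite [in LHS](line_coef (lsec k' x) (tl_line T ix) n0).
by rewrite quotZl dvecZ dvec_self ?mulr1//; exact: quot_neq0.
Qed.

Section GerbeConnection.
Variable D : gerbe_conn G.
Arguments D : clear implicits.
Hypothesis gD : is_gerbe_conn D.

Definition qform i j (k : lframe i) (k' : lframe j) : form1 X :=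
  cform (D i j) (lquot k k').

Lemma qform_is_form1 i j (k : lframe i) (k' : lframe j) :
  is_form1 (ldom k `&` ldom k') (qform k k').
Proof.
have [cD _ _] := gD.
exact: (cform_is_form1 (gl_bundle i j) (cD i j) (frame_lquot k k') (@lquot_sub _ _ k k')).
Qed.

Lemma qform_sum0 i j m (k : lframe i) (k' : lframe j) (k'' : lframe m) c a x :
  ldom k x -> ldom k' x -> ldom k'' x -> mdom c x ->
  qform k k' c a x + qform k' k'' c a x + qform k'' k c a x = 0.
Proof.
move=> kx k'x k''x cx; pose Q := ldom k `&` ldom k' `&` ldom k''.
have oQ : open Q by do 2?apply: openI; exact: ldom_open.
apply: (@cform_gs D i j m Q) => //.
- by apply: frame_sub (frame_lquot k k') => // y [].
- by apply: frame_sub (frame_lquot k' k'') => // y [[]].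
- by apply: frame_sub (frame_lquot k'' k) => // y [[]].
- by move=> y [[/ldom_sub ? /ldom_sub ?] /ldom_sub ?].
- by move=> y [[? ?] ?]; exact: lquot_gs.
Qed.

(** Repeated indices in the triple relation yield the antisymmetry. *)
Lemma qform_cocycle i j m (k : lframe i) (k' : lframe j) (k'' : lframe m) c a x :
  ldom k x -> ldom k' x -> ldom k'' x -> mdom c x ->
  qform k k'' c a x = qform k k' c a x + qform k' k'' c a x.
Proof.
move=> kx k'x k''x cx.
have E1 := qform_sum0 a kx kx kx cx.
have E2 := qform_sum0 a kx k''x kx cx.
have E3 := qform_sum0 a kx k'x k''x cx.
lra.
Qed.

(** For i = j the cocycle consists of the terms by which connection forms on l_i
    change with the frame. *)
Lemma qform_diag i (k k' : lframe i) c a x : ldom k x -> ldom k' x -> mdom c x ->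
  qform k' k c a x = dlog (coefs (lsec k) (lsec k')) c a x.
Proof.
move=> kx k'x cx; have [cD _ _] := gD.
have E0 := qform_sum0 a kx kx kx cx.
have oQ : open (ldom k `&` ldom k') by apply: openI; exact: ldom_open.
have Qx : (ldom k `&` ldom k') x by [].
have f1 : frame_on (ldom k `&` ldom k') (lquot k k).
  by apply: frame_sub (frame_lquot k k) => // y [].
have f2 : frame_on (ldom k `&` ldom k') (lquot k' k).
  by rewrite setIC; exact: frame_lquot.
have sub : ldom k `&` ldom k' `<=` U i `&` U i by exact: lquot_sub.
rewrite /qform (cform_change (gl_bundle i i) (cD i i) f1 f2 sub a Qx Qx cx).
rewrite (dlog_ext a oQ Qx cx (g := coefs (lsec k) (lsec k'))).
  by rewrite -/(qform k k); lra.
by move=> y [? ?]; exact: lquot_diag.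
Qed.

(** This is what subordination means for the connection forms; by
    local_conns_of_cform it is enough to have it on a family of frames covering the
    overlaps. *)
Lemma local_conns_cform (E : forall i, conn (tl T i)) : is_local_conns D E ->
  forall i j Q (e : Defs.section (tl T i)) (f : Defs.section (tl T j)),
  frame_on Q e -> frame_on Q f -> Q `<=` U i `&` U j ->
  forall c a x, Q x -> mdom c x ->
  cform (D i j) (fun y => quot (e y) (f y)) c a x = cform (E i) e c a x - cform (E j) f c a x.
Proof.
move=> [cE vE] i j Q e f fe ff QU c a x Qx cx; have [oQ _ _] := fe.
have Ui : Q `<=` U i by move=> y /QU[].
have Uj : Q `<=` U j by move=> y /QU[].
have bi := is_lbundle_sub Ui (tl_bundle T i).
have bj := is_lbundle_sub Uj (tl_bundle T j).
have ci := is_conn_sub Ui (cE i); have cj := is_conn_sub Uj (cE j).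
have id : Q `<=` Q by [].
have bd := dualb_lbundle oQ bj; have cd := dual_is_conn oQ bj cj.
have fd := frame_dual bj ff id.
have ft := frame_tens bi bd fe fd.
have bij : is_lbundle (U i `&` U j) (tensb (tl T i) (dualb (tl T j))).
  apply: tensb_lbundle; first exact: gUI_open.
    by apply: is_lbundle_sub (tl_bundle T i) => y [].
  by apply: is_lbundle_sub (tl_dual_lbundle T j) => y [].
rewrite -(conn_via_cform bij (tiso_iso T i j) (vE i j) ft QU a Qx cx).
rewrite (cform_tens oQ bi bd ci cd fe fd id a Qx cx).
rewrite /add_form1 (cform_dual oQ bj cj ff id a Qx cx).
by rewrite /scale_form1 mulN1r.
Qed.

Lemma local_conns_of_cform (E : forall i, conn (tl T i)) :
  (forall i, is_conn (U i) (E i)) ->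
  (forall i j (k : lframe i) (k' : lframe j) c a x,
     ldom k x -> ldom k' x -> mdom c x ->
     qform k k' c a x = cform (E i) (lsec k) c a x - cform (E j) (lsec k') c a x) ->
  is_local_conns D E.
Proof.
move=> cE H; split=> // i j; have [cD _ _] := gD.
have oU := gUI_open i j.
have subi : U i `&` U j `<=` U i by move=> y [].
have subj : U i `&` U j `<=` U j by move=> y [].
have bi := is_lbundle_sub subi (tl_bundle T i).
have bj := is_lbundle_sub subj (tl_bundle T j).
have ci := is_conn_sub subi (cE i); have cj := is_conn_sub subj (cE j).
have bd := dualb_lbundle oU bj; have cd := dual_is_conn oU bj cj.
have bt := tensb_lbundle oU bi bd; have ct := tens_is_conn oU bi bd ci cd.
apply: (conn_via_of_cform bt (gl_bundle i j) (tiso_iso T i j) ct (cD i j)) => x [ix jx].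
have [k kx] := lframe_cover ix; have [k' k'x] := lframe_cover jx.
have [oQ f1 f2 QU] := lframe_pair k k'.
have fd := frame_dual bj f2 QU.
exists (ldom k `&` ldom k'), (fun y => tens (lsec k y) (dvec (lsec k' y))); split=> //.
  exact: (frame_tens bi bd f1 fd).
move=> c a cx; have Qx : (ldom k `&` ldom k') x by [].
rewrite (cform_tens oU bi bd ci cd f1 fd QU a Qx cx).
rewrite /add_form1 (cform_dual oU bj cj f2 QU a Qx cx) /scale_form1 mulN1r.
by rewrite -H.
Qed.

Lemma local_conns_of_splitting (B : lindex -> form1 X) :
  (forall a, is_form1 (ldom (projT2 a)) (B a)) ->
  (forall i j (k : lframe i) (k' : lframe j) c a x,
     ldom k x -> ldom k' x -> mdom c x ->
     B (existT _ i k) c a x = qform k k' c a x + B (existT _ j k') c a x) ->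
  exists E : forall i, conn (tl T i), is_local_conns D E /\
    forall i (k : lframe i), eq_form1 (ldom k) (cform (E i) (lsec k)) (B (existT _ i k)).
Proof.
move=> fB HB.
have exE i : exists E : conn (tl T i), is_conn (U i) E /\
    forall k : lframe i, local_formula E (ldom k) (lsec k) (B (existT _ i k)).
  apply: (conn_of_forms (tl_bundle T i)).
  - by move=> k; split; [exact: lframeP|exact: ldom_sub|exact: (fB (existT _ i k))].
  - by move=> x; exact: lframe_cover.
  - move=> k k' c a x kx k'x cx; rewrite (HB i i k' k)// addrC; congr (_ + _).
    exact: qform_diag.
have [E EP] : {E : forall i, conn (tl T i) & forall i, is_conn (U i) (E i) /\
    forall k : lframe i, local_formula (E i) (ldom k) (lsec k) (B (existT _ i k))}.
  by exists (fun i => sval (cid (exE i))) => i; exact: (svalP (cid (exE i))).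
have EB i (k : lframe i) : eq_form1 (ldom k) (cform (E i) (lsec k)) (B (existT _ i k)).
  by apply: cform_of_formula (lframeP k) _; exact: (EP i).2.
exists E; split=> //; apply: local_conns_of_cform => [i|i j k k' c a x kx k'x cx].
  exact: (EP i).1.
by rewrite !EB// (HB i j k k')// addrK.
Qed.

Lemma local_conns_exist : exists E : forall i, conn (tl T i), is_local_conns D E.
Proof.
have oO (a : lindex) : open (ldom (projT2 a)) by exact: ldom_open.
have [a b|a b e c i x ax bx ex cx|B [fB HB]] := split_form1_cocycle oO lindex_cover
  (A := fun a b => qform (projT2 a) (projT2 b)).
- exact: qform_is_form1.
- exact: qform_cocycle.
have [E [lE _]] := local_conns_of_splitting fB
  (fun i j k k' c a x => HB (existT _ i k) (existT _ j k') c a x).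
by exists E.
Qed.

End GerbeConnection.
End OneTrivialization.
End LocalConnections.

(** * The connection of the patched bundle *)

Section PatchedConnections.
Context (R : realType) (n : nat) (X : manifold R n) (G : gerbe X).
Local Notation I := (gidx G).
Local Notation U := (gU G).
Local Notation L := (@gl R n X G).
Variables (T T' : trivialization G).

(** The patching relation in terms of bases: with psi_i v = p a (x) a'^*,
    psi_j v = q b (x) b'^* and a (x) b^* = h a' (x) b'^* inside l_ij, it says
    p h = q. *)
Lemma patching_coef xi psi i j x (v : fiber xi x) (a : tl T i x) (b : tl T j x)
    (a' : tl T' i x) (b' : tl T' j x) p q h :
  is_patching T T' xi psi -> U i x -> U j x -> a != 0 -> b != 0 -> a' != 0 -> b' != 0 ->
  psi i x v = p *: tens a (dvec a') -> psi j x v = q *: tens b (dvec b') ->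
  quot a b = h *: quot a' b' -> p * h = q.
Proof.
move=> [_ _ pat] ix jx a0 b0 a'0 b'0 vi vj ab.
have uu' : tiso T i j x (tens a (dvec b)) = tiso T' i j x (h *: tens a' (dvec b')).
  by rewrite linearZ.
have := pat i j x ix jx v _ _ uu' b'.
rewrite vi vj !(contractvZ, contractvZr) !contractvE !dvec_self//.
by rewrite !scale1r !dvec_self// !scale1r scalerA => /(scale_line_inj a0).
Qed.

Variables (D : gerbe_conn G) (E : forall i, conn (tl T i)) (E' : forall i, conn (tl T' i)).
Arguments D : clear implicits.
Arguments E : clear implicits.
Arguments E' : clear implicits.
Hypotheses (gD : is_gerbe_conn D) (lE : is_local_conns D E) (lE' : is_local_conns D E').

Definition quot_conn i : conn (tensb (tl T i) (dualb (tl T' i))) :=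
  tens_conn (E i) (dual_conn (E' i)).
Arguments quot_conn : clear implicits.

Lemma quot_conn_is_conn i : is_conn (U i) (quot_conn i).
Proof.
have [cE _] := lE; have [cE' _] := lE'.
apply: tens_is_conn; [exact: gU_open|exact: tl_bundle|exact: tl_dual_lbundle|exact: cE|].
by apply: dual_is_conn; [exact: gU_open|exact: tl_bundle|exact: cE'].
Qed.

Lemma cform_quot_conn i Q (e : Defs.section (tl T i)) (f : Defs.section (tl T' i)) :
  frame_on Q e -> frame_on Q f -> Q `<=` U i -> forall c a x, Q x -> mdom c x ->
  cform (quot_conn i) (fun y => tens (e y) (dvec (f y))) c a x =
    cform (E i) e c a x - cform (E' i) f c a x.
Proof.
move=> fe ff QU c a x Qx cx; have [cE _] := lE; have [cE' _] := lE'.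
have oU := gU_open i; have bT := tl_bundle T i; have bT' := tl_bundle T' i.
have bd := tl_dual_lbundle T' i; have cd := dual_is_conn oU bT' (cE' i).
have fd := frame_dual bT' ff QU.
rewrite /quot_conn (cform_tens oU bT bd (cE i) cd fe fd QU a Qx cx).
by rewrite /add_form1 (cform_dual oU bT' (cE' i) ff QU a Qx cx) /scale_form1 mulN1r.
Qed.

Section Patching.
Variables (xi : lbundle X) (psi : forall i, bundle_map xi (tensb (tl T i) (dualb (tl T' i)))).
Hypothesis pat : is_patching T T' xi psi.

Lemma patched_bundle_sub i : is_lbundle (U i) xi.
Proof. by have [bx _ _] := pat; apply: is_lbundle_sub bx. Qed.

Lemma frame_patched i Q (f : Defs.section xi) : frame_on Q f -> Q `<=` U i ->
  frame_on Q (fun y => psi i y (f y)).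
Proof. by move=> ff QU; have [_ ip _] := pat; exact: frame_iso ff QU (ip i). Qed.

(** Passing from i to j changes the forms of nabla_i and of nabla'_i by the form of
    nabla_ij in two frames of l_ij, whose ratio is the one in patching_coef. *)
Lemma quot_conn_patch i j Q (f : Defs.section xi) : frame_on Q f ->
  Q `<=` U i -> Q `<=` U j -> forall c a x, Q x -> mdom c x ->
  cform (quot_conn i) (fun y => psi i y (f y)) c a x =
  cform (quot_conn j) (fun y => psi j y (f y)) c a x.
Proof.
move=> ff QUi QUj c a x Qx cx; have [oQ _ f0] := ff.
have [Ni [e [e' [fe fe' Nix NUi]]]] := local_frame_pair T T' (QUi _ Qx).
have [Nj [k [k' [fk fk' Njx NUj]]]] := local_frame_pair T T' (QUj _ Qx).
have [oNi _ _] := fe; have [oNj _ _] := fk.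
pose N := Q `&` (Ni `&` Nj).
have oN : open N by apply: openI => //; exact: openI.
have Nx : N x by [].
have NQ : N `<=` Q by move=> y [].
have Ui : N `<=` U i by move=> y [/QUi].
have Uj : N `<=` U j by move=> y [/QUj].
have Uij : N `<=` U i `&` U j by move=> y Ny; split; [exact: Ui|exact: Uj].
have {}fe : frame_on N e by apply: frame_sub fe => // y [_ []].
have {}fe' : frame_on N e' by apply: frame_sub fe' => // y [_ []].
have {}fk : frame_on N k by apply: frame_sub fk => // y [_ []].
have {}fk' : frame_on N k' by apply: frame_sub fk' => // y [_ []].
have {}ff : frame_on N f by apply: frame_sub ff.
have fpi := frame_patched ff Ui; have fpj := frame_patched ff Uj.
have fti := frame_tens_dual fe fe' Ui; have ftj := frame_tens_dual fk fk' Uj.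
have fq := frame_quot fe fk Uij; have fq' := frame_quot fe' fk' Uij.
pose p := coefs (l := tensb (tl T i) (dualb (tl T' i)))
  (fun y => tens (e y) (dvec (e' y))) (fun y => psi i y (f y)).
pose q := coefs (l := tensb (tl T j) (dualb (tl T' j)))
  (fun y => tens (k y) (dvec (k' y))) (fun y => psi j y (f y)).
pose h := coefs (fun y => quot (e' y) (k' y)) (fun y => quot (e y) (k y)).
have bi := tens_dual_lbundle T T' i; have bj := tens_dual_lbundle T T' j.
have [cD _ _] := gD.
have [sp p0] : smooth_unit N p := coefs_unit bi fti fpi Ui.
have [sh h0] : smooth_unit N h := coefs_unit (gl_bundle i j) fq' fq Uij.
have [_ _ e0] := fe; have [_ _ e'0] := fe'; have [_ _ k0] := fk; have [_ _ k'0] := fk'.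
have [_ _ ti0] := fti; have [_ _ tj0] := ftj; have [_ _ q'0] := fq'.
have pq y : N y -> q y = p y * h y.
  move=> Ny; symmetry; have iy := Ui _ Ny; have jy := Uj _ Ny.
  apply: (patching_coef pat iy jy (e0 _ Ny) (k0 _ Ny) (e'0 _ Ny) (k'0 _ Ny)).
  - by apply: coefsE bi _ _ _ iy _; exact: ti0.
  - by apply: coefsE bj _ _ _ jy _; exact: tj0.
  - by apply: coefsE (gl_bundle i j) _ _ _ (Uij _ Ny) _; exact: q'0.
rewrite (cform_change bi (@quot_conn_is_conn i) fti fpi Ui a Nx Nx cx).
rewrite (cform_change bj (@quot_conn_is_conn j) ftj fpj Uj a Nx Nx cx).
rewrite (cform_quot_conn fe fe' Ui a Nx cx) (cform_quot_conn fk fk' Uj a Nx cx).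
rewrite -/p -/q (dlog_ext a oN Nx cx pq) (dlog_mul a oN)//; [|exact: p0|exact: h0].
have E1 := local_conns_cform lE fe fk Uij a Nx cx.
have E2 := local_conns_cform lE' fe' fk' Uij a Nx cx.
have := cform_change (gl_bundle i j) (cD i j) fq' fq Uij a Nx Nx cx.
rewrite E1 E2 -/h; lra.
Qed.

Lemma patched_conn_exists : exists Dxi : conn xi, is_patched_conn E E' psi Dxi.
Proof.
have [bx ip _] := pat; have [_ cov] := gU_cover G.
pose K := {p : I * (set X * Defs.section xi) | frame_on p.2.1 p.2.2 /\ p.2.1 `<=` U p.1}.
pose ind (k : K) := (sval k).1; pose Q (k : K) := (sval k).2.1.
pose f (k : K) := (sval k).2.2.
pose A (k : K) := cform (quot_conn (ind k)) (fun y => psi (ind k) y (f k y)).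
have fQ (k : K) : frame_on (Q k) (f k) by exact: (svalP k).1.
have QU (k : K) : Q k `<=` U (ind k) by exact: (svalP k).2.
have covK i x : U i x -> exists2 k : K, Q k x & ind k = i.
  move=> ix; have [N [e [fe Nx NU]]] := local_frame (gU_open i) (patched_bundle_sub i) ix.
  by exists (exist _ (i, (N, e)) (conj fe NU)).
have [k|x|k k' c a x kx k'x cx|Dxi [cDxi DA]] := @conn_of_forms _ _ _ setT xi bx K Q f A.
- split=> //; apply: cform_is_form1 (frame_patched (fQ k) (QU k)) (QU k).
    exact: tens_dual_lbundle.
  exact: quot_conn_is_conn.
- by have [i ix] := cov x; have [k kx _] := covK i x ix; exists k.
- have oN : open (Q k `&` Q k') by have [? _ _] := fQ k; have [? _ _] := fQ k'; exact: openI.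
  have Nx : (Q k `&` Q k') x by [].
  have f1 : frame_on (Q k `&` Q k') (f k) by apply: frame_sub (fQ k) => // y [].
  have f2 : frame_on (Q k `&` Q k') (f k') by apply: frame_sub (fQ k') => // y [].
  have U1 : Q k `&` Q k' `<=` U (ind k) by move=> y [/QU].
  have U2 : Q k `&` Q k' `<=` U (ind k') by move=> y [_ /QU].
  rewrite /A (quot_conn_patch f2 U2 U1 a Nx cx).
  rewrite (cform_change (tens_dual_lbundle T T' (ind k)) (@quot_conn_is_conn (ind k))
    (frame_patched f1 U1) (frame_patched f2 U1) U1 a Nx Nx cx); congr (_ + _).
  have [_ _ e0] := f1.
  apply: (dlog_ext a oN Nx cx) => y Ny; rewrite /coefs.
  exact: (bundle_iso_coef (patched_bundle_sub (ind k)) _ (U1 _ Ny) (e0 _ Ny) (ip _)).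
exists Dxi; split=> // i.
apply: (conn_via_of_cform (patched_bundle_sub i) (tens_dual_lbundle T T' i) (ip i)).
- exact: is_conn_sub cDxi.
- exact: quot_conn_is_conn.
move=> x ix; have [k kx ki] := covK i x ix.
exists (Q k), (f k); split=> //; first by rewrite -ki; exact: QU.
move=> c a cx; rewrite (cform_of_formula (fQ k) (DA k) a kx cx).
by rewrite /A ki.
Qed.

Lemma quot_conn_flat i : flat_local_conns E -> flat_local_conns E' ->
  flat_conn (U i) (quot_conn i).
Proof.
move=> fE fE'; have [cE _] := lE; have [cE' _] := lE'.
apply: (flat_conn_of_forms (tens_dual_lbundle T T' i) (@quot_conn_is_conn i)) => x ix.
have [Q [e [f [fe ff Qx QU]]]] := local_frame_pair T T' ix.
exists Q, (fun y => tens (e y) (dvec (f y))); split=> //; first exact: frame_tens_dual.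
move=> c a b cx; have [oQ _ _] := fe.
have bT := tl_bundle T i; have bT' := tl_bundle T' i.
rewrite (@ext_d_ext _ _ _ Q c a x oQ Qx cx _ (sub_form1 (cform (E i) e) (cform (E' i) f))).
  rewrite (ext_d_sub _ oQ)//.
  - rewrite (flat_conn_form bT (cE i) (fE i) fe QU a b Qx cx).
    by rewrite (flat_conn_form bT' (cE' i) (fE' i) ff QU a b Qx cx) subrr.
  - exact: cform_is_form1 bT _ _ _ (cE i) fe QU.
  - exact: cform_is_form1 bT' _ _ _ (cE' i) ff QU.
by move=> c' a' y Qy cy; exact: (cform_quot_conn fe ff QU a' Qy cy).
Qed.

Lemma patched_conn_flat (Dxi : conn xi) : flat_local_conns E -> flat_local_conns E' ->
  is_patched_conn E E' psi Dxi -> flat_conn setT Dxi.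
Proof.
move=> fE fE' [cDxi via]; have [bx ip _] := pat; have [_ cov] := gU_cover G.
apply: (flat_conn_of_forms bx cDxi) => x _; have [i ix] := cov x.
have [Q [f [ff Qx QU]]] := local_frame (gU_open i) (patched_bundle_sub i) ix.
have [oQ _ _] := ff; exists Q, f; split=> // c a b cx.
rewrite (ext_d_ext a oQ Qx cx b (conn_via_cform (patched_bundle_sub i) (ip i) (via i) ff QU)).
exact: (flat_conn_form (tens_dual_lbundle T T' i) (@quot_conn_is_conn i)
  (@quot_conn_flat i fE fE') (frame_patched ff QU) QU).
Qed.

End Patching.
End PatchedConnections.

(** * Flat local connections *)

Section FlatConnections.
Context (R : realType) (n : nat) (X : manifold R n) (G : gerbe X).
Local Notation I := (gidx G).
Local Notation U := (gU G).
Local Notation L := (@gl R n X G).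

Lemma locconst_nbhd V (g : X -> R) x : open V -> locconst_unit V g -> V x ->
  exists Q, [/\ open Q, Q x, Q `<=` V & forall y, Q y -> g y = g x].
Proof.
move=> oV cg Vx; have [_] := cg x Vx; rewrite /prop_near1 nbhsE/= => -[N [oN Nx] gN].
by exists (N `&` V); split=> // [|y [/gN]//]; exact: openI.
Qed.

Lemma locconst_smooth_unit V (g : X -> R) : open V -> locconst_unit V g -> smooth_unit V g.
Proof.
move=> oV cg; split=> [|x /cg[]//].
apply: smooth_local => x Vx; have [Q [oQ Qx QV gQ]] := locconst_nbhd oV cg Vx.
by exists Q => //; apply: smooth_ext (smooth_cst _ (g x)) => // y /gQ.
Qed.

Lemma locconst_pd V (g : X -> R) c a x : open V -> locconst_unit V g -> V x -> mdom c x ->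
  pd c a g x = 0.
Proof.
move=> oV cg Vx cx; have [Q [oQ Qx _ gQ]] := locconst_nbhd oV cg Vx.
by rewrite (pd_ext a oQ Qx cx gQ) pd_cst.
Qed.

(** Rescaling by locally constant functions keeps frames parallel, so trivial holonomy
    provides parallel frames of the l_ij whose triple products are the s_abc. *)
Lemma parallel_frames (D : gerbe_conn G) : is_gerbe_conn D -> holonomy_trivial D ->
  exists (K : Type) (W : K -> set X) (tau : K -> I)
         (t : forall a b, Defs.section (L (tau a) (tau b))),
    [/\ refinement U W tau, forall a b, frame_on (W a `&` W b) (t a b),
        forall a b e x, W a x -> W b x -> W e x ->
          gs (tau a) (tau b) (tau e) x = tens (tens (t a b x) (t b e x)) (t e a x) &
        forall a b c i x, (W a `&` W b) x -> mdom c x ->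
          cform (D (tau a) (tau b)) (t a b) c i x = 0].
Proof.
move=> [cD _ _] [J [V [tau [t [r [rV ft pt fr [K [W [sigma [g [rW lg rg]]]]]]]]]]].
have rUW := refinement_trans rV rW.
have [[oV _] VU] := rV; have [[oW _] WV] := rW.
have oWW a b : open (W a `&` W b) by exact: openI.
have sg a b := locconst_smooth_unit (oWW a b) (lg a b).
have g0 a b x : W a x -> W b x -> g a b x != 0.
  by move=> Wa Wb; have [_] := sg a b; apply.
have fT := rescaled_frame_on rV ft rW sg.
exists K, W, (tau \o sigma), (fun a b x => g a b x *: t (sigma a) (sigma b) x).
split=> //; first exact: (rescaled_frames rV ft fr rW g0 rg).
move=> a b; have WVV : W a `&` W b `<=` V (sigma a) `&` V (sigma b).
  by move=> y [/WV ? /WV ?].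
have VUU : V (sigma a) `&` V (sigma b) `<=` U (tau (sigma a)) `&` U (tau (sigma b)).
  by move=> y [/VU ? /VU ?].
apply: (parallel_cform (fT a b)) => c i x Qx cx.
have [st _ _] := ft; have sub : W a `&` W b `<=` U (tau (sigma a)) `&` U (tau (sigma b)).
  by move=> y /WVV/VUU.
have [_ _ H3 _ _] := cD (tau (sigma a)) (tau (sigma b)) (W a `&` W b) (oWW a b) sub.
have sst : smooth_section (W a `&` W b) (t (sigma a) (sigma b)).
  by apply: smooth_section_sub (st _ _).
have [sgab _] := sg a b; rewrite (H3 _ _ sgab sst c i x Qx cx).
rewrite (locconst_pd i (oWW a b) (lg a b) Qx cx) scale0r add0r.
have oVV : open (V (sigma a) `&` V (sigma b)) by exact: openI.
have [H1 _ _ _ _] := cD (tau (sigma a)) (tau (sigma b)) _ oVV VUU.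
by rewrite (pt _ _ c i x (WVV _ Qx) cx) scaler0.
Qed.

Section Flat.
Variables (T : trivialization G) (D : gerbe_conn G).
Arguments D : clear implicits.
Hypothesis gD : is_gerbe_conn D.
Hypothesis fD : forall i j, flat_conn (U i `&` U j) (D i j).

Lemma qform_closed i j (k : lframe T i) (k' : lframe T j) c a b x :
  (ldom k `&` ldom k') x -> mdom c x -> ext_d (qform D k k') c a b x = 0.
Proof.
move=> Qx cx; have [cD _ _] := gD.
exact: (flat_conn_form (gl_bundle i j) (@cD i j) (@fD i j) (frame_lquot k k')
  (@lquot_sub _ _ _ _ _ _ _ k k') a b Qx cx).
Qed.

Section ParallelFrames.
Variables (K : Type) (W : K -> set X) (tau : K -> I)
  (t : forall a b, Defs.section (L (tau a) (tau b))).
Hypotheses (rW : refinement U W tau)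
  (ft : forall a b, frame_on (W a `&` W b) (t a b))
  (tgs : forall a b e x, W a x -> W b x -> W e x ->
     gs (tau a) (tau b) (tau e) x = tens (tens (t a b x) (t b e x)) (t e a x))
  (pt : forall a b c i x, (W a `&` W b) x -> mdom c x ->
     cform (D (tau a) (tau b)) (t a b) c i x = 0).

(** Frames of the l_i paired with members W_a of the refined cover with i = tau a: the
    connection forms of nabla can be compared with parallel frames only there. *)
Definition rindex := {a : K & lframe T (tau a)}.
Definition rdom (p : rindex) := W (projT1 p) `&` ldom (projT2 p).

Lemma rdom_open p : open (rdom p).
Proof. by have [[oW _] _] := rW; apply: openI => //; exact: ldom_open. Qed.

Lemma rdom_cover x : exists p, rdom p x.
Proof.
have [[_ cW] WU] := rW; have [a Wx] := cW x.
have [k kx] := lframe_cover T (WU a x Wx).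
by exists (existT _ a k).
Qed.

Definition rratio (p q : rindex) : X -> R :=
  coefs (t (projT1 p) (projT1 q)) (lquot (projT2 p) (projT2 q)).

Lemma rdomI_frames p q :
  [/\ open (rdom p `&` rdom q), frame_on (rdom p `&` rdom q) (t (projT1 p) (projT1 q)),
      frame_on (rdom p `&` rdom q) (lquot (projT2 p) (projT2 q)) &
      rdom p `&` rdom q `<=` U (tau (projT1 p)) `&` U (tau (projT1 q))].
Proof.
have oQ : open (rdom p `&` rdom q) by apply: openI; exact: rdom_open.
split=> //.
- by apply: frame_sub (ft _ _) => // y [[? _] [? _]].
- by apply: frame_sub (frame_lquot _ _) => // y [[_ ?] [_ ?]].
- by move=> y [[_ /ldom_sub ?] [_ /ldom_sub ?]].
Qed.

Lemma rratio_unit p q : smooth_unit (rdom p `&` rdom q) (rratio p q).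
Proof. by have [oQ f1 f2 QU] := rdomI_frames p q; exact: (coefs_unit (gl_bundle _ _) f1 f2 QU). Qed.

Lemma rratio_cocycle p q s x : rdom p x -> rdom q x -> rdom s x ->
  rratio p s x = rratio p q x * rratio q s x.
Proof.
move=> px qx sx.
have rE p' q' : rdom p' x -> rdom q' x -> lquot (projT2 p') (projT2 q') x =
    rratio p' q' x *: t (projT1 p') (projT1 q') x.
  move=> p'x q'x; have [_ f1 _ QU] := rdomI_frames p' q'; have [_ _ t0] := f1.
  have Qx : (rdom p' `&` rdom q') x by [].
  by apply: (coefsE (gl_bundle _ _)); [exact: QU|exact: t0].
have cyc p' q' s' : rdom p' x -> rdom q' x -> rdom s' x ->
    rratio p' q' x * rratio q' s' x * rratio s' p' x = 1.
  move=> p'x q'x s'x; have [Wp kp] := p'x; have [Wq kq] := q'x; have [Ws ks] := s'x.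
  have := lquot_gs kp kq ks; rewrite (tgs Wp Wq Ws) !rE// !(tensZl, tensZr) !scalerA.
  set S := tens (tens _ _) _; have S0 : S != 0.
    have nz p1 q1 : rdom p1 x -> rdom q1 x -> t (projT1 p1) (projT1 q1) x != 0.
      by move=> h1 h2; have [_ [_ _ t0] _ _] := rdomI_frames p1 q1; exact: t0.
    by do 2?apply: tens_neq0; apply: nz.
  by rewrite -{1}[S]scale1r => /(scale_line_inj S0) ->; ring.
have [_ [_ M]] := @real_cocycle R rindex (fun p => rdom p x) (fun p q => rratio p q x) cyc.
exact: M.
Qed.

Lemma qform_rratio p q c a x : rdom p x -> rdom q x -> mdom c x ->
  qform D (projT2 p) (projT2 q) c a x = dlog (rratio p q) c a x.
Proof.
move=> px qx cx; have [oQ f1 f2 QU] := rdomI_frames p q; have [cD _ _] := gD.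
have Qx : (rdom p `&` rdom q) x by [].
rewrite /qform (cform_change (gl_bundle _ _) (@cD _ _) f1 f2 QU a Qx Qx cx).
by rewrite pt ?add0r//; case: px; case: qx.
Qed.

(** The forms of nabla_ij in the frames e (x) e'^* are dlog r for a real cocycle r.
    Its square is positive, hence of the form m_p / m_q, so that dlog r is half the
    difference of dlog m_p and dlog m_q, both closed. *)
Lemma closed_splitting : exists m : rindex -> X -> R,
  (forall p, smooth_unit (rdom p) (m p)) /\
  forall p q c a x, rdom p x -> rdom q x -> mdom c x ->
    qform D (projT2 p) (projT2 q) c a x =
    2^-1 * dlog (m p) c a x - 2^-1 * dlog (m q) c a x.
Proof.
have sr p q : smooth_on (rdom p `&` rdom q) (rratio p q) by have [] := rratio_unit p q.
have r0 p q x : rdom p x -> rdom q x -> rratio p q x != 0.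
  by move=> px qx; have [_] := rratio_unit p q; apply.
have oI p q : open (rdom p `&` rdom q) by apply: openI; exact: rdom_open.
have [p q|p q x px qx|p q s x px qx sx|m [sm m0 mE]] :=
  split_positive_cocycle rdom_open rdom_cover (H := fun p q x => rratio p q x * rratio p q x).
- by apply: smooth_mul => //; exact: oI.
- by rewrite -expr2 exprn_even_gt0//= r0.
- by rewrite (rratio_cocycle px qx sx); ring.
exists m; split=> [p|p q c a x px qx cx]; first by split=> // x px; rewrite gt_eqF ?m0.
have Qx : (rdom p `&` rdom q) x by [].
have m_p : smooth_on (rdom p `&` rdom q) (m p) by apply: smooth_sub (sm p) => y [].
have m_q : smooth_on (rdom p `&` rdom q) (m q) by apply: smooth_sub (sm q) => y [].
have mq0 : m q x != 0 by rewrite gt_eqF ?m0.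
have E : dlog (m p) c a x = dlog (rratio p q) c a x + dlog (rratio p q) c a x
    + dlog (m q) c a x.
  rewrite (dlog_ext a (oI p q) Qx cx (g := fun y => rratio p q y * rratio p q y * m q y)).
    rewrite (dlog_mul a (oI p q))//; last by rewrite mulf_neq0// r0.
      by rewrite (dlog_mul a (oI p q))// r0.
    by apply: smooth_mul => //; exact: oI.
  by move=> y [py qy]; exact: mE.
by rewrite qform_rratio// E; field.
Qed.

End ParallelFrames.

Lemma flat_local_conns_exist : holonomy_trivial D ->
  exists E : forall i, conn (tl T i), is_local_conns D E /\ flat_local_conns E.
Proof.
move=> /(parallel_frames gD)[K [W [tau [t [rW ft tgs pt]]]]].
have [m [um mE]] := closed_splitting rW ft tgs pt.
have [z zP] := choice (rdom_cover rW).
pose C i (k : lframe T i) (p : rindex tau) : form1 X :=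
  add_form1 (qform D k (projT2 p)) (scale_form1 2^-1 (dlog (m p))).
have CE i (k : lframe T i) (p q : rindex tau) c a x : ldom k x -> rdom W p x ->
    rdom W q x -> mdom c x -> C i k p c a x = C i k q c a x.
  move=> kx px qx cx; have [_ pk] := px; have [_ qk] := qx.
  rewrite /C /add_form1 /scale_form1 (qform_cocycle gD a kx pk qk cx).
  by rewrite mE//; ring.
(* C k p does not depend on p, so picking any p at each point gives a form B that agrees
   locally with the C k p. *)
pose B (al : lindex T) : form1 X := fun c a x => C _ (projT2 al) (z x) c a x.
have oQ i (k : lframe T i) (p : rindex tau) : open (ldom k `&` rdom W p).
  by apply: openI; [exact: ldom_open|exact: (rdom_open rW p)].
have BC i (k : lframe T i) (p : rindex tau) : eq_form1 (ldom k `&` rdom W p) (C i k p) (B (existT _ i k)).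
  by move=> c a x [kx px] cx; exact: CE.
have fq i (k : lframe T i) (p : rindex tau) :
    is_form1 (ldom k `&` rdom W p) (qform D k (projT2 p)).
  by apply: is_form1_sub (qform_is_form1 gD k (projT2 p)) => y [? [_ ?]].
have um' i (k : lframe T i) (p : rindex tau) : smooth_unit (ldom k `&` rdom W p) (m p).
  by have [sm m0] := um p; split=> [|x [_ /m0]//]; apply: smooth_sub sm => x [].
have fC i (k : lframe T i) (p : rindex tau) : is_form1 (ldom k `&` rdom W p) (C i k p).
  apply: is_form1_add => //; apply: is_form1_scale => //.
  exact: is_form1_dlog.
have fB al : is_form1 (ldom (projT2 al)) (B al).
  case: al => i k /=; apply: is_form1_local => x kx.
  exists (ldom k `&` rdom W (z x)); first by split=> //; exact: zP.
  exact: is_form1_ext (BC i k (z x)) (fC i k (z x)).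
have [i j k k' c a x kx k'x cx|E [lE EB]] := local_conns_of_splitting gD fB.
  have [_ zx] := zP x.
  by rewrite /B /C /add_form1 /= (qform_cocycle gD a kx k'x zx cx) addrA.
exists E; split=> // i; have [cE _] := lE.
apply: (flat_conn_of_forms (tl_bundle T i) (cE i)) => x ix.
have [k kx] := lframe_cover T ix.
exists (ldom k), (lsec k); split=> //; [exact: lframeP|exact: ldom_sub|].
move=> c a b cx; have Qx : (ldom k `&` rdom W (z x)) x by split=> //; exact: zP.
have oQx := oQ i k (z x).
rewrite (ext_d_ext a (ldom_open k) kx cx b (EB i k)).
rewrite -(ext_d_ext a oQx Qx cx b (BC i k (z x))).
rewrite (ext_d_add a oQx Qx cx b (fq i k _)); last first.
  by apply: is_form1_scale => //; exact: is_form1_dlog.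
rewrite (ext_d_scale a oQx Qx cx 2^-1 b); last exact: is_form1_dlog.
rewrite (ext_d_dlog a oQx Qx cx b (um' i k _)) mulr0 addr0.
by apply: qform_closed => //; case: Qx => ? [].
Qed.

End Flat.
End FlatConnections.

(** * Local metrics and adaptations *)

Section LocalMetrics.
Context (R : realType) (n : nat) (X : manifold R n) (G : gerbe X).
Local Notation I := (gidx G).
Local Notation U := (gU G).
Local Notation L := (@gl R n X G).

(** The section s_ijk has norm 1. *)
Lemma sqnorm_gs (h : gerbe_metric G) i j k x (a : L i j x) (b : L j k x) (c : L k i x) :
  is_gerbe_metric h -> U i x -> U j x -> U k x -> a != 0 -> b != 0 -> c != 0 ->
  gs i j k x = tens (tens a b) c ->
  h i j x a a * h j k x b b * h k i x c c = 1.
Proof.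
move=> [mh _ sh] ix jx kx a0 b0 c0 gsE.
have Lij : line (L i j x) by exact: gl_line.
have Ljk : line (L j k x) by exact: gl_line.
have Lki : line (L k i x) by exact: gl_line.
have Hij : homogeneous_at (h i j) x by apply: metric_homogeneous (mh i j) _.
have Hjk : homogeneous_at (h j k) x by apply: metric_homogeneous (mh j k) _.
have Hki : homogeneous_at (h k i) x by apply: metric_homogeneous (mh k i) _.
have := sh i j k x ix jx kx; rewrite gsE.
have -> (u : tensb (tensb (L i j) (L j k)) (L k i) x) : tens_metric
  (tens_metric (h i j) (h j k)) (h k i) u u = tens_metric
  (tens_metric (h i j) (h j k)) (h k i) (1 *: u) (1 *: u) by rewrite scale1r.
rewrite tens_metricE//.
- have -> (u : tensb (L i j) (L j k) x) : tens_metric (h i j) (h j k) u u =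
    tens_metric (h i j) (h j k) (1 *: u) (1 *: u) by rewrite scale1r.
  by rewrite tens_metricE// !mul1r.
- exact: line_tens.
- exact: tens_metric_homogeneous.
- exact: tens_neq0.
Qed.

Section OneTrivialization.
Variable T : trivialization G.

Lemma quot_metric (k : forall i, metric (tl T i)) i j x (u : tl T i x) (v : tl T j x) :
  (forall i, is_metric (U i) (k i)) -> U i x -> U j x -> u != 0 -> v != 0 ->
  tens_metric (k i) (dual_metric (k j)) (tens u (dvec v)) (tens u (dvec v)) =
    k i x u u / k j x v v.
Proof.
move=> mk ix jx u0 v0.
have Li := tl_line T ix; have Lj := tl_line T jx.
have Hi := metric_homogeneous (mk i) ix; have Hj := metric_homogeneous (mk j) jx.
have pos (w : tl T j x) : w != 0 -> k j x w w != 0.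
  by have [_ _ P _] := mk j; move=> w0; rewrite gt_eqF// P.
have dE : dual_metric (k j) (dvec v) (dvec v) = (k j x v v)^-1.
  by rewrite -[dvec v]scale1r dual_metricE// ?pos// mul1r div1r.
rewrite -[tens u (dvec v)]scale1r tens_metricE//.
- by rewrite dE !mul1r.
- exact: line_dual.
- exact: dual_metric_homogeneous.
- exact: dvec_vec_neq0.
Qed.

Section LocalMetric.
Variables (h : gerbe_metric G).
Arguments h : clear implicits.
Hypothesis gh : is_gerbe_metric h.

Definition qnorm i j (k : lframe T i) (k' : lframe T j) : X -> R :=
  sqnorm (h i j) (lquot k k').

Lemma qnorm_unit i j (k : lframe T i) (k' : lframe T j) :
  smooth_unit (ldom k `&` ldom k') (qnorm k k') /\
  forall x, (ldom k `&` ldom k') x -> 0 < qnorm k k' x.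
Proof.
have [mh _ _] := gh.
exact: (sqnorm_unit (mh i j) (frame_lquot k k') (@lquot_sub _ _ _ _ _ _ _ k k')).
Qed.

Lemma qnorm_cocycle i j l (k : lframe T i) (k' : lframe T j) (k'' : lframe T l) x :
  ldom k x -> ldom k' x -> ldom k'' x ->
  qnorm k k'' x = qnorm k k' x * qnorm k' k'' x.
Proof.
move=> kx k'x k''x; pose q (a b : lindex T) := qnorm (projT2 a) (projT2 b) x.
have cyc (a b e : lindex T) : ldom (projT2 a) x -> ldom (projT2 b) x ->
    ldom (projT2 e) x -> q a b * q b e * q e a = 1.
  move=> ax bx ex; have n0 (a1 b1 : lindex T) : ldom (projT2 a1) x -> ldom (projT2 b1) x ->
    lquot (projT2 a1) (projT2 b1) x != 0.
    move=> h1 h2; have [_ _ nz] := frame_lquot (projT2 a1) (projT2 b1); exact: nz.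
  apply: (sqnorm_gs gh (ldom_sub ax) (ldom_sub bx) (ldom_sub ex)); try exact: n0.
  exact: lquot_gs.
have [_ [_ M]] := @real_cocycle R (lindex T) (fun a => ldom (projT2 a) x) q cyc.
exact: (M (existT _ i k) (existT _ j k') (existT _ l k'')).
Qed.

(** The squared norms of the e (x) e'^* form a positive cocycle indexed by the frames of
    the l_i; the functions m that split it are the squared norms of the frames for the
    metrics h_i.  For frames of the same l_i the cocycle is the square of the
    transition function, as it must be. *)
Lemma local_metrics_exist : exists k : forall i, metric (tl T i), is_local_metrics h k.
Proof.
have [mh _ _] := gh.
have oL (a : lindex T) : open (ldom (projT2 a)) by exact: ldom_open.
have [a b|a b x ax bx|a b e x ax bx ex|m [sm m0 mE]] :=
  split_positive_cocycle oL (lindex_cover T) (H := fun a b => qnorm (projT2 a) (projT2 b)).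
- by have [[]] := qnorm_unit (projT2 a) (projT2 b).
- by have [_ ] := qnorm_unit (projT2 a) (projT2 b); apply.
- exact: qnorm_cocycle.
have exk i : exists k : metric (tl T i), is_metric (U i) k /\
    forall (p : lframe T i) x, ldom p x -> sqnorm k (lsec p) x = m (existT _ i p) x.
  apply: (metric_of_values (tl_bundle T i)).
  - by move=> p; split; [exact: lframeP|exact: ldom_sub].
  - by move=> x; exact: lframe_cover.
  - by move=> p; exact: (sm (existT _ i p)).
  - by move=> p; exact: (m0 (existT _ i p)).
  move=> p p' x px p'x; rewrite (mE (existT _ i p') (existT _ i p) x p'x px) /=.
  congr (_ * _); rewrite -(lquot_diag px p'x).
  have f1 : frame_on (ldom p `&` ldom p') (lquot p p).
    by apply: frame_sub (frame_lquot p p) => [|y [//]]; apply: openI; exact: ldom_open.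
  have Qx : (ldom p `&` ldom p') x by [].
  rewrite /qnorm (sqnorm_change (gl_bundle i i) (lquot p' p) (mh i i) f1
    (@lquot_sub _ _ _ _ _ _ _ p p') Qx) -/(qnorm p p).
  have q1 : qnorm p p x = 1.
    have q0 : qnorm p p x != 0.
      by have [[_ +] _] := qnorm_unit p p; apply.
    by apply: (mulfI q0); rewrite -qnorm_cocycle// mulr1.
  by rewrite q1 mulr1.
have [k kP] : {k : forall i, metric (tl T i) & forall i, is_metric (U i) (k i) /\
    forall (p : lframe T i) x, ldom p x -> sqnorm (k i) (lsec p) x = m (existT _ i p) x}.
  by exists (fun i => sval (cid (exk i))) => i; exact: (svalP (cid (exk i))).
have mk i : is_metric (U i) (k i) by exact: (kP i).1.
exists k; split=> // i j.
have bij : is_lbundle (U i `&` U j) (tensb (tl T i) (dualb (tl T j))).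
  apply: tensb_lbundle; first exact: gUI_open.
    by apply: is_lbundle_sub (tl_bundle T i) => y [].
  by apply: is_lbundle_sub (tl_dual_lbundle T j) => y [].
apply: (metric_via_of_values bij) => x Ux; have [ix jx] := Ux.
- apply: tens_metric_homogeneous; [exact: tl_line|apply: line_dual; exact: tl_line| |].
    exact: metric_homogeneous (mk i) ix.
  apply: dual_metric_homogeneous; [exact: tl_line|exact: metric_homogeneous (mk j) jx|].
  by have [_ _ P _] := mk j; move=> w w0; rewrite gt_eqF// P.
- exact: metric_homogeneous (mh i j) Ux.
have [p px] := lframe_cover T ix; have [p' p'x] := lframe_cover T jx.
have e0 := lsec_neq0 px; have f0 := lsec_neq0 p'x.
exists (tens (lsec p x) (dvec (lsec p' x))).
  by apply: tens_neq0 => //; exact: dvec_vec_neq0.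
rewrite quot_metric// -/(sqnorm (k i) (lsec p) x) -/(sqnorm (k j) (lsec p') x).
rewrite (kP i).2// (kP j).2// (mE (existT _ i p) (existT _ j p') x px p'x) mulfK//.
by rewrite gt_eqF// m0.
Qed.

Variable k : forall i, metric (tl T i).
Arguments k : clear implicits.
Hypothesis lk : is_local_metrics h k.

Lemma metric_form_quot i j Q (e : Defs.section (tl T i)) (f : Defs.section (tl T j)) :
  frame_on Q e -> frame_on Q f -> Q `<=` U i `&` U j ->
  forall c a x, Q x -> mdom c x ->
  metric_form (h i j) (fun y => quot (e y) (f y)) c a x =
    metric_form (k i) e c a x - metric_form (k j) f c a x.
Proof.
move=> fe ff QU c a x Qx cx; have [oQ _ e0] := fe; have [_ _ f0] := ff.
have [mk vk] := lk.
have Ui : Q `<=` U i by move=> y /QU[].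
have Uj : Q `<=` U j by move=> y /QU[].
have [[si ni] _] := sqnorm_unit (mk i) fe Ui.
have [[sj nj] _] := sqnorm_unit (mk j) ff Uj.
have E y : Q y -> sqnorm (h i j) (fun y => quot (e y) (f y)) y =
    sqnorm (k i) e y * (sqnorm (k j) f y)^-1.
  move=> Qy; rewrite /sqnorm (vk i j y (QU _ Qy)) quot_metric//;
    [exact: Ui|exact: Uj|exact: e0|exact: f0].
rewrite /metric_form /scale_form1 (dlog_ext a oQ Qx cx E).
rewrite (dlog_mul a oQ Qx cx)//; [|exact: smooth_inv|exact: ni|].
  by rewrite (dlog_inv a oQ Qx cx)// ?nj//; ring.
by rewrite invr_eq0 nj.
Qed.

(** In local frames, both terms of theta are additive. *)
Lemma theta_adaptation (D : gerbe_conn G) (E : forall i, conn (tl T i)) :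
  is_gerbe_conn D -> is_local_conns D E ->
  is_adaptation D h (fun i => theta (U i) (E i) (k i)).
Proof.
move=> gD lE; have [mk _] := lk; have [cE _] := lE; have [cD _ _] := gD.
have [mh _ _] := gh.
split=> [i|i j c a x [ix jx] cx].
  exact: (theta_is_form1 (gU_open i) (tl_bundle T i) (mk i) (cE i)).
have [p px] := lframe_cover T ix; have [p' p'x] := lframe_cover T jx.
have Qx : (ldom p `&` ldom p') x by [].
have [oQ f1 f2 QU] := lframe_pair p p'.
rewrite (theta_cform (gUI_open i j) (gl_bundle i j) (mh i j) a (cD i j)
  (frame_lquot p p') QU Qx cx).
rewrite (metric_form_quot f1 f2 QU a Qx cx) (local_conns_cform lE f1 f2 QU a Qx cx).
rewrite /sub_form1.
rewrite (theta_cform (gU_open i) (tl_bundle T i) (mk i) a (cE i) (lframeP p)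
  (@ldom_sub _ _ _ _ _ _ p) px cx).
rewrite (theta_cform (gU_open j) (tl_bundle T j) (mk j) a (cE j) (lframeP p')
  (@ldom_sub _ _ _ _ _ _ p') p'x cx).
by ring.
Qed.

(** Both nabla_i and the metric connection of h_i are flat. *)
Lemma ext_d_theta_flat (E : forall i, conn (tl T i)) i : (forall i, is_conn (U i) (E i)) ->
  flat_local_conns E -> eq_form2 (U i) zero_form2 (ext_d (theta (U i) (E i) (k i))).
Proof.
move=> cE fE c a b x ix cx; have [mk _] := lk; have [p px] := lframe_cover T ix.
rewrite (ext_d_theta (gU_open i) (tl_bundle T i) (mk i) a b (cE i) (lframeP p)
  (@ldom_sub _ _ _ _ _ _ p) px cx).
by rewrite (flat_conn_form (tl_bundle T i) (cE i) (fE i) (lframeP p)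
  (@ldom_sub _ _ _ _ _ _ p) a b px cx).
Qed.

(** nabla'_i is the metric connection of h_i plus beta_i.  Its curvature is d beta_i,
    and it is subordinate to D since beta is an adaptation. *)
Lemma conns_of_adaptation (D : gerbe_conn G) (beta : I -> form1 X) :
  is_gerbe_conn D -> is_adaptation D h beta ->
  (forall i, eq_form2 (U i) zero_form2 (ext_d (beta i))) ->
  exists E : forall i, conn (tl T i), [/\ is_local_conns D E, flat_local_conns E &
    forall i, eq_form1 (U i) (beta i) (theta (U i) (E i) (k i))].
Proof.
move=> gD [fb ab] db; have [mk _] := lk; have [cD _ _] := gD; have [mh _ _] := gh.
pose A i (p : lframe T i) := add_form1 (metric_form (k i) (lsec p)) (beta i).
have fm i (p : lframe T i) : is_form1 (ldom p) (metric_form (k i) (lsec p)).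
  exact: (metric_form_is_form1 (mk i) (lframeP p) (@ldom_sub _ _ _ _ _ _ p)).
have fbp i (p : lframe T i) : is_form1 (ldom p) (beta i).
  exact: (is_form1_sub (@ldom_sub _ _ _ _ _ _ p) (fb i)).
have exE i : exists E : conn (tl T i), is_conn (U i) E /\
    forall p : lframe T i, local_formula E (ldom p) (lsec p) (A i p).
  apply: (conn_of_forms (tl_bundle T i)).
  - move=> p; split; [exact: lframeP|exact: ldom_sub|].
    by apply: is_form1_add => //; exact: ldom_open.
  - by move=> x; exact: lframe_cover.
  - move=> p p' c a x px p'x cx; rewrite /A /add_form1.
    rewrite (metric_form_change (tl_bundle T i) (mk i) a (lframeP p) (lframeP p')
      (@ldom_sub _ _ _ _ _ _ p) (@ldom_sub _ _ _ _ _ _ p') px p'x cx).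
    by ring.
have [E EP] : {E : forall i, conn (tl T i) & forall i, is_conn (U i) (E i) /\
    forall p : lframe T i, local_formula (E i) (ldom p) (lsec p) (A i p)}.
  by exists (fun i => sval (cid (exE i))) => i; exact: (svalP (cid (exE i))).
have cE i : is_conn (U i) (E i) by exact: (EP i).1.
have EA i (p : lframe T i) : eq_form1 (ldom p) (cform (E i) (lsec p)) (A i p).
  by apply: cform_of_formula (lframeP p) _; exact: (EP i).2.
exists E; split.
- apply: local_conns_of_cform => // i j p p' c a x px p'x cx.
  have Qx : (ldom p `&` ldom p') x by [].
  have [oQ f1 f2 QU] := lframe_pair p p'.
  rewrite !EA// /A /add_form1.
  have := ab i j c a x (QU _ Qx) cx.
  rewrite (theta_cform (gUI_open i j) (gl_bundle i j) (mh i j) a (cD i j)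
    (frame_lquot p p') QU Qx cx) (metric_form_quot f1 f2 QU a Qx cx).
  rewrite /sub_form1 -/(qform D p p'); lra.
- move=> i; apply: (flat_conn_of_forms (tl_bundle T i) (cE i)) => x ix.
  have [p px] := lframe_cover T ix.
  exists (ldom p), (lsec p); split=> //; [exact: lframeP|exact: ldom_sub|].
  move=> c a b cx; rewrite (ext_d_ext a (ldom_open p) px cx b (EA i p)).
  rewrite (ext_d_add a (ldom_open p) px cx b (fm i p) (fbp i p)).
  rewrite (metric_form_closed (mk i) (lframeP p) (@ldom_sub _ _ _ _ _ _ p) a b px cx).
  by rewrite -db// add0r.
- move=> i c a x ix cx; have [p px] := lframe_cover T ix.
  rewrite (theta_cform (gU_open i) (tl_bundle T i) (mk i) a (cE i) (lframeP p)
    (@ldom_sub _ _ _ _ _ _ p) px cx).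
  by rewrite EA// /A /add_form1 addrC addKr.
Qed.

End LocalMetric.
End OneTrivialization.

Lemma zero_form2_is_form2 : is_form2 (X := X) setT zero_form2.
Proof.
split=> [c i j|c i j x _ _|c d i j x _ _ _]; first exact: smooth_cst.
  by rewrite oppr0.
by rewrite big1// => k _; rewrite big1// => l _; rewrite mulr0.
Qed.

Lemma holonomy_form_unique (beta : I -> form1 X) B B' :
  is_holonomy_form beta B -> (forall i, eq_form2 (U i) B' (ext_d (beta i))) ->
  eq_form2 setT B B'.
Proof.
move=> [_ dB] dB' c a b x _ cx; have [_ cov] := gU_cover G; have [i ix] := cov x.
by rewrite (dB i)// (dB' i).
Qed.

End LocalMetrics.

(** * The theorem *)

Theorem theorem3p5 (R : realType) (n : nat) (X : manifold R n) (G : gerbe X)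
    (G_trivial : gerbe_class_trivial G) :
  (* (a) *)
  (inhabited (trivialization G) /\
   forall T T' : trivialization G, exists xi psi, is_patching T T' xi psi)
  /\
  (* (b) *)
  (forall D : gerbe_conn G, is_gerbe_conn D ->
     (forall T : trivialization G,
        exists E : forall i, conn (tl T i), is_local_conns D E) /\
     (forall (T T' : trivialization G)
             (E : forall i, conn (tl T i)) (E' : forall i, conn (tl T' i)),
        is_local_conns D E -> is_local_conns D E' ->
        forall xi psi, is_patching T T' xi psi ->
          exists Dxi : conn xi, is_patched_conn E E' psi Dxi))
  /\
  (* (c) *)
  (forall D : gerbe_conn G, is_flat_gerbe_conn D -> holonomy_trivial D ->
     (forall T : trivialization G,
        exists E : forall i, conn (tl T i),
          is_local_conns D E /\ flat_local_conns E) /\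
     (forall (T T' : trivialization G)
             (E : forall i, conn (tl T i)) (E' : forall i, conn (tl T' i)),
        is_local_conns D E -> flat_local_conns E ->
        is_local_conns D E' -> flat_local_conns E' ->
        forall xi psi, is_patching T T' xi psi ->
        forall Dxi : conn xi, is_patched_conn E E' psi Dxi ->
          flat_conn setT Dxi))
  /\
  (* (d) *)
  (forall h : gerbe_metric G, is_gerbe_metric h ->
     (forall T : trivialization G,
        exists k : forall i, metric (tl T i), is_local_metrics h k) /\
     (forall (T : trivialization G) (k : forall i, metric (tl T i)),
        is_local_metrics h k ->
        forall D : gerbe_conn G, is_flat_gerbe_conn D -> holonomy_trivial D ->
        forall E : forall i, conn (tl T i),
          is_local_conns D E -> flat_local_conns E ->
          let beta0 := fun i => theta (gU G i) (E i) (k i) in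
          [/\ is_adaptation D h beta0,
              exists B0, is_holonomy_form beta0 B0 &
              forall B0, is_holonomy_form beta0 B0 ->
                eq_form2 setT B0 zero_form2]))
  /\
  (* (e) *)
  (forall (h : gerbe_metric G) (T : trivialization G)
          (k : forall i, metric (tl T i)),
     is_gerbe_metric h -> is_local_metrics h k ->
     forall (D : gerbe_conn G) (beta : gidx G -> form1 X) (B : form2 X),
       is_flat_gerbe_conn D -> holonomy_trivial D -> is_adaptation D h beta ->
       is_holonomy_form beta B ->
       (eq_form2 setT B zero_form2 <->
        exists (D' : gerbe_conn G) (E' : forall i, conn (tl T i)),
          [/\ is_flat_gerbe_conn D', holonomy_trivial D',
              is_local_conns D' E', flat_local_conns E' &
              forall i, eq_form1 (gU G i) (beta i)
                (theta (gU G i) (E' i) (k i))])).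
Proof.
split; last split; last split; last split.
- by split; [exact: trivialization_exists|exact: patching_exists].
- move=> D gD; split=> [T|T T' E E' lE lE' xi psi pat]; first exact: local_conns_exist.
  exact: (patched_conn_exists gD lE lE' pat).
- move=> D [gD fD] hD; split=> [T|]; first exact: flat_local_conns_exist.
  move=> T T' E E' lE fE lE' fE' xi psi pat Dxi.
  exact: (patched_conn_flat lE lE' pat fE fE').
- move=> h gh; split=> [T|T k lk D [gD _] _ E lE fE]; first exact: local_metrics_exist.
  have d0 i := ext_d_theta_flat lk lE.1 fE (i := i).
  split; first exact: theta_adaptation.
    by exists zero_form2; split=> //; exact: zero_form2_is_form2.
  by move=> B0 hB; exact: holonomy_form_unique hB d0.
move=> h T k gh lk D beta B [gD fD] hD ab hB; split=> [B0|[D' [E' [_ _ lE fE bE]]]].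
  have [E [lE fE bE]] : exists E : forall i, conn (tl T i), [/\ is_local_conns D E,
      flat_local_conns E & forall i, eq_form1 (gU G i) (beta i) (theta (gU G i) (E i) (k i))].
    apply: (conns_of_adaptation gh lk gD ab) => i c a b x ix cx.
    by have [_ dB] := hB; rewrite -dB// B0.
  by exists D, E.
apply: (holonomy_form_unique hB) => i c a b x ix cx.
rewrite (ext_d_ext a (gU_open i) ix cx b (bE i)).
exact: (ext_d_theta_flat lk lE.1 fE).
Qed.
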